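(* Suppose that $A$ is a transcendental entire function such that $A^{-1}$ has a logarithmic singularity over $\infty$. Then there exists a path $\Gamma$ tending to infinity in a neighbourhood of the singularity on which all solutions $y$ of $$ y'' + A(z) y = 0 $$ tend to $0$ as $z \to \infty$.
   Context: Let $G$ be a transcendental meromorphic function in $\mathbb{C}$. If $G(z) \to a \in \mathbb{C}$ as $z \to \infty$ along a path $\gamma$ tending to infinity, then $a$ is an asymptotic value of $G$ and the inverse $G^{-1}$ is said to have a transcendental singularity over $a$. For each $\varepsilon > 0$ there is then a component $\Omega(a,\varepsilon,G)$ of $\{ z \in \mathbb{C} : |G(z)-a| < \varepsilon \}$ such that $\gamma \setminus \Omega(a,\varepsilon,G)$ is bounded; these components are called neighbourhoods of the singularity. The singularity is called direct if for some $\varepsilon > 0$ the component $\Omega(a,\varepsilon,G)$ contains finitely many zeros of $G-a$. Transcendental singularities over $\infty$ are classified using $1/G$ and $a = 0$, so that their neighbourhoods are components $\Omega(0, 1/M, 1/G)$ of sets $\{ z : |G(z)| > M \}$. A direct singularity of $G^{-1}$ over $\infty$ is called logarithmic if there exists $M > 0$ such that $w = \log G(z)$ maps $\Omega(0,1/M,1/G)$ univalently onto the half-plane $\mathrm{Re}\, w > \log M$. *)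

(* Defs.v *)
From Stdlib Require Import Reals List.
From Coquelicot Require Import Coquelicot.
Open Scope R_scope.

Definition holomorphic_on (D : C -> Prop) (f : C -> C) : Prop :=
  forall z : C, D z -> @ex_derive C_AbsRing C_NormedModule f z.

Definition entire (f : C -> C) : Prop := holomorphic_on (fun _ => True) f.

Definition polynomial_function (f : C -> C) : Prop :=
  exists (n : nat) (a : nat -> C),
    forall z : C, f z = sum_n (fun k => Cmult (a k) (Cpow z k)) n.

Definition transcendental_entire (f : C -> C) : Prop :=
  entire f /\ ~ polynomial_function f.

(* Coquelicot has no complex exponential. *)
Definition Cexp (z : C) : C := (exp (Re z) * cos (Im z), exp (Re z) * sin (Im z)).

Definition connected_set (S : C -> Prop) : Prop :=
  forall U V : C -> Prop, open U -> open V ->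
    (forall z, S z -> U z \/ V z) ->
    (exists z, S z /\ U z) -> (exists z, S z /\ V z) ->
    exists z, S z /\ U z /\ V z.

Definition is_component (S Omega : C -> Prop) : Prop :=
  (exists z, Omega z) /\ (forall z, Omega z -> S z) /\ connected_set Omega /\
  (forall T : C -> Prop, connected_set T ->
     (forall z, Omega z -> T z) -> (forall z, T z -> S z) ->
     forall z, T z -> Omega z).

(* Paths are parametrised by [0, +oo); the values at negative t are irrelevant. *)
Definition path_to_infinity (gamma : R -> C) : Prop :=
  continuous_on (fun t => 0 <= t) gamma /\
  is_lim (fun t => Cmod (gamma t)) p_infty p_infty.

(* G tends to infinity along gamma.  A transcendental singularity of the inverse
   of G over infinity is represented throughout by such a path gamma; it enters
   only through the components that it singles out. *)
Definition transcendental_singularity_infty (G : C -> C) (gamma : R -> C) : Prop :=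
  path_to_infinity gamma /\ is_lim (fun t => Cmod (G (gamma t))) p_infty p_infty.

(* Omega is the component Omega(0, 1/M, 1/G) determined by gamma.  The set is
   written {|G| > M} and not {|1/G| < 1/M}, since Cinv 0 = 0 would put the zeros
   of G in the latter. *)
Definition singularity_neighbourhood
    (G : C -> C) (gamma : R -> C) (M : R) (Omega : C -> Prop) : Prop :=
  is_component (fun z => M < Cmod (G z)) Omega /\
  exists B : R, forall t : R, 0 <= t -> ~ Omega (gamma t) -> Cmod (gamma t) <= B.

(* The zeros of 1/G are the poles of G, so every singularity over infinity of an
   entire G is direct; the condition is kept because the general classification
   includes it. *)
Definition direct_singularity_infty (G : C -> C) (gamma : R -> C) : Prop :=
  transcendental_singularity_infty G gamma /\
  exists (M : R) (Omega : C -> Prop), 0 < M /\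
    singularity_neighbourhood G gamma M Omega /\
    exists zeros : list C, forall z, Omega z -> Cinv (G z) = RtoC 0 -> In z zeros.

(* L is a branch of log G on Omega. *)
Definition logarithmic_singularity_infty (G : C -> C) (gamma : R -> C) : Prop :=
  direct_singularity_infty G gamma /\
  exists (M : R) (Omega : C -> Prop) (L : C -> C), 0 < M /\
    singularity_neighbourhood G gamma M Omega /\
    holomorphic_on Omega L /\
    (forall z, Omega z -> Cexp (L z) = G z) /\
    (forall z1 z2, Omega z1 -> Omega z2 -> L z1 = L z2 -> z1 = z2) /\
    (forall w : C, ln M < Re w <-> exists z, Omega z /\ L z = w).

(* y is an entire solution of y'' + A y = 0.  As A is entire, every local solution
   extends to such a y.  C_derive is a total operator, hence the differentiability
   hypotheses. *)
Definition solves_ode (A y : C -> C) : Prop :=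
  entire y /\ entire (C_derive y) /\
  forall z : C, Cplus (C_derive (C_derive y) z) (Cmult (A z) (y z)) = RtoC 0.

(* Main.v *)
Require Import Defs.
From Stdlib Require Import Reals Lra Psatz ClassicalEpsilon.
From Coquelicot Require Import Coquelicot.
Open Scope R_scope.

(** Let [phi] be the inverse of the branch [L] of [log A], a univalent map of the half-plane
    [Re v > c], [c = ln M], onto the tract, so that [A (phi v) = exp v].  In the variable [v]
    the Liouville variable [Z = \int A^(1/2) dz] has derivative [q v = exp (v/2) phi' v].
    Along a path on which [Z = t] is real, [p = A^(1/4) y] solves [p'' + (1 + O(1/t^2)) p = 0],
    hence is bounded, and [y = A^(-1/4) p] tends to [0] because [|A| = exp (Re v)] tends to
    infinity.  Such a path exists because univalence forces [phi'' / phi' = O(1 / (Re v - c))]: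
    then [q' / q] is close to [1/2] far to the right, [Z] is close to [2 q] on a cone, and
    [log Z] is univalent there with an image containing all large reals.  The distortion bound is
    obtained without the area theorem: for [zeta] outside the tract a branch of
    [log (phi - zeta)] never takes two values differing by [2 pi i], so Bloch's argument bounds
    its derivative, which makes [L] holomorphic on a disc of the right size; Cauchy's estimate
    for [L] does the rest. *)

(** * Complex derivatives *)

(** Where [Z] is real the transformed equation is a perturbed harmonic oscillator, so no solution is
    distinguished from another and one path serves every [y]. The difficulty is to find such a level
    line inside the tract. The tract is known only through [L], hence everything is pulled back to
    the half-plane, where no regularity of the boundary is available and only distortion estimates
    remain. The level line is sought for [log Z]: injectivity is not to be expected of [Z], which
    behaves like an exponential, whereas the derivative of [log Z] is nearly constant on the cone,
    and the mean value inequality then gives both injectivity and covering. The disc on which [L] is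
    holomorphic appears by contraposition: a point outside the tract is an omitted value of [phi],
    and Bloch's bound keeps it away from [phi v0]. There [L] itself is not bounded, but it takes
    values in a half-plane, so a suitable exponential of it is. All complex analysis is drawn from
    Goursat's lemma on axis-parallel rectangles, which dictates the shapes of domains, [box] and
    [rstar]. *)

Notation Cder := (@is_derive C_AbsRing C_NormedModule).
Notation Rder := (@is_derive R_AbsRing C_R_NormedModule).
Notation Ccont := (@continuous C_UniformSpace C_UniformSpace).
Notation Rcont := (@continuous R_UniformSpace C_UniformSpace).

Lemma Cder_eps (f : C -> C) (z l : C) :
  Cder f z l <->
  forall eps, 0 < eps -> exists d, 0 < d /\ forall w, Cmod (w - z) < d ->
    Cmod (f w - f z - (w - z) * l) <= eps * Cmod (w - z).
Proof.
split.
- intros [_ H] eps Heps.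
  destruct (H z (fun P HP => HP) (mkposreal eps Heps)) as [d Hd].
  exists d; split; [apply cond_pos|].
  intros w Hw. exact (Hd w Hw).
- intros H; split.
  + exact (@is_linear_scal_l C_AbsRing C_NormedModule l).
  + intros x Hx.
    assert (E : x = z).
    { symmetry. exact (@is_filter_lim_locally_unique C_AbsRing (AbsRing_NormedModule C_AbsRing) z x Hx). }
    subst x. intros [eps Heps].
    destruct (H eps Heps) as [d [Hd0 Hd]].
    exists (mkposreal d Hd0). intros w Hw. exact (Hd w Hw).
Qed.

(** Two module structures on [C] with the same norm: the product rule and the inner function of the
    chain rule are typed with the second, the rest of the development with the first. *)
Lemma Cder_AbsRing (f : C -> C) (z l : C) :
  Cder f z l <-> @is_derive C_AbsRing (AbsRing_NormedModule C_AbsRing) f z l.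
Proof.
split; intros [_ H]; split.
- exact (@is_linear_scal_l C_AbsRing (AbsRing_NormedModule C_AbsRing) l).
- intros x Hx eps. exact (H x Hx eps).
- exact (@is_linear_scal_l C_AbsRing C_NormedModule l).
- intros x Hx eps. exact (H x Hx eps).
Qed.

Lemma Rder_eps (f : R -> C) (t : R) (l : C) :
  Rder f t l <->
  forall eps, 0 < eps -> exists d, 0 < d /\ forall s, Rabs (s - t) < d ->
    Cmod (f s - f t - RtoC (s - t) * l) <= eps * Rabs (s - t).
Proof.
split.
- intros [_ H] eps Heps.
  destruct (H t (fun P HP => HP) (mkposreal eps Heps)) as [d Hd].
  exists d; split; [apply cond_pos|].
  intros w Hw. specialize (Hd w Hw). rewrite Cmod_norm.
  replace (f w - f t - RtoC (w - t) * l)%C with (minus (minus (f w) (f t)) (scal (minus w t) l) : C_R_NormedModule); [exact Hd|].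
  destruct l, (f w), (f t); cbv -[Rplus Rmult Ropp]; f_equal; ring.
- intros H; split.
  + exact (@is_linear_scal_l R_AbsRing C_R_NormedModule l).
  + intros x Hx.
    assert (E : x = t).
    { symmetry. exact (@is_filter_lim_locally_unique R_AbsRing (AbsRing_NormedModule R_AbsRing) t x Hx). }
    subst x. intros [eps Heps].
    destruct (H eps Heps) as [d [Hd0 Hd]].
    exists (mkposreal d Hd0). intros w Hw. specialize (Hd w Hw). rewrite Cmod_norm in Hd.
    replace (f w - f t - RtoC (w - t) * l)%C with (minus (minus (f w) (f t)) (scal (minus w t) l) : C_R_NormedModule) in Hd; [exact Hd|].
    destruct l, (f w), (f t); cbv -[Rplus Rmult Ropp]; f_equal; ring.
Qed.

Lemma Cmod_le_Rabs (z : C) : Cmod z <= Rabs (Re z) + Rabs (Im z).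
Proof.
replace z with (RtoC (Re z) + Ci * RtoC (Im z))%C at 1.
2: destruct z; cbv -[Rplus Rmult Ropp Rminus]; f_equal; ring.
eapply Rle_trans; [apply Cmod_triangle|]. rewrite Cmod_mult, Cmod_Ci, !Cmod_R; lra.
Qed.

Lemma im_le_Cmod (z : C) : Rabs (Im z) <= Cmod z.
Proof. eapply Rle_trans; [|apply Rmax_Cmod]. apply Rmax_r. Qed.

(** [C_UniformSpace] is the product structure, whose balls are squares; discs in [Cmod] generate the
    same neighbourhoods. *)
Lemma locally_C_Cmod (z : C) (P : C -> Prop) :
  @locally C_UniformSpace z P <-> exists d, 0 < d /\ forall w, Cmod (w - z) < d -> P w.
Proof.
rewrite locally_C. split.
- intros [d H]; exists d; split; [apply cond_pos|exact H].
- intros [d [Hd H]]; exists (mkposreal d Hd); exact H.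
Qed.

Lemma continuous_C_eps (U : UniformSpace) (f : U -> C) (x : U) :
  @continuous U C_UniformSpace f x <->
  forall eps, 0 < eps -> @locally U x (fun y => Cmod (f y - f x) < eps).
Proof.
split.
- intros H eps Heps. apply (H (fun w => Cmod (w - f x) < eps)).
  apply locally_C_Cmod. exists eps; auto.
- intros H P HP. apply locally_C_Cmod in HP. destruct HP as [d [Hd HP]].
  generalize (H d Hd). unfold filtermap. apply filter_imp. intros y Hy; now apply HP.
Qed.

Lemma Ccont_eps (f : C -> C) (z : C) :
  Ccont f z <-> forall eps, 0 < eps -> exists d, 0 < d /\ forall w, Cmod (w - z) < d -> Cmod (f w - f z) < eps.
Proof.
rewrite continuous_C_eps. split; intros H eps Heps; specialize (H eps Heps).
- now apply locally_C_Cmod in H.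
- now apply locally_C_Cmod.
Qed.

Lemma Rcont_eps (f : R -> C) (t : R) :
  Rcont f t <-> forall eps, 0 < eps -> exists d, 0 < d /\ forall s, Rabs (s - t) < d -> Cmod (f s - f t) < eps.
Proof.
rewrite continuous_C_eps. split; intros H eps Heps; specialize (H eps Heps).
- destruct H as [d H]; exists d; split; [apply cond_pos|exact H].
- destruct H as [d [Hd H]]; exists (mkposreal d Hd); exact H.
Qed.

Lemma continuous_re (U : UniformSpace) (f : U -> C) x :
  @continuous U C_UniformSpace f x -> continuous (fun y => Re (f y)) x.
Proof. intros H. apply (continuous_comp f (fun z : C_UniformSpace => Re z)); [exact H|apply continuous_fst]. Qed.

Lemma continuous_im (U : UniformSpace) (f : U -> C) x :
  @continuous U C_UniformSpace f x -> continuous (fun y => Im (f y)) x.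
Proof. intros H. apply (continuous_comp f (fun z : C_UniformSpace => Im z)); [exact H|apply continuous_snd]. Qed.

Lemma continuous_pairC (U : UniformSpace) (f g : U -> R) x :
  continuous f x -> continuous g x -> @continuous U C_UniformSpace (fun y => (f y, g y)) x.
Proof.
intros Hf Hg. apply (continuous_comp_2 f g (fun a b => (a, b) : C_UniformSpace)); auto.
apply continuous_ext with (fun p : R * R => p); [intros [? ?]; reflexivity|apply continuous_id].
Qed.

Lemma continuous_Cplus (U : UniformSpace) (f g : U -> C) x :
  @continuous U C_UniformSpace f x -> @continuous U C_UniformSpace g x ->
  @continuous U C_UniformSpace (fun y => f y + g y)%C x.
Proof.
intros Hf Hg.
pose proof (continuous_re _ _ _ Hf) as Rf. pose proof (continuous_re _ _ _ Hg) as Rg.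
pose proof (continuous_im _ _ _ Hf) as If. pose proof (continuous_im _ _ _ Hg) as Ig.
exact (continuous_pairC _ _ _ _
  (continuous_plus (V := R_NormedModule) _ _ _ Rf Rg)
  (continuous_plus (V := R_NormedModule) _ _ _ If Ig)).
Qed.

Lemma continuous_Cmult (U : UniformSpace) (f g : U -> C) x :
  @continuous U C_UniformSpace f x -> @continuous U C_UniformSpace g x ->
  @continuous U C_UniformSpace (fun y => f y * g y)%C x.
Proof.
intros Hf Hg.
pose proof (continuous_re _ _ _ Hf) as Rf. pose proof (continuous_re _ _ _ Hg) as Rg.
pose proof (continuous_im _ _ _ Hf) as If. pose proof (continuous_im _ _ _ Hg) as Ig.
exact (continuous_pairC _ _ _ _
  (continuous_minus (V := R_NormedModule) _ _ _
    (continuous_mult (K := R_AbsRing) _ _ _ Rf Rg) (continuous_mult (K := R_AbsRing) _ _ _ If Ig))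
  (continuous_plus (V := R_NormedModule) _ _ _
    (continuous_mult (K := R_AbsRing) _ _ _ Rf Ig) (continuous_mult (K := R_AbsRing) _ _ _ If Rg))).
Qed.

Lemma continuous_Copp (U : UniformSpace) (f : U -> C) x :
  @continuous U C_UniformSpace f x -> @continuous U C_UniformSpace (fun y => - f y)%C x.
Proof.
intros Hf.
exact (continuous_pairC _ _ _ _
  (continuous_opp (V := R_NormedModule) _ _ (continuous_re _ _ _ Hf))
  (continuous_opp (V := R_NormedModule) _ _ (continuous_im _ _ _ Hf))).
Qed.

Lemma continuous_Cminus (U : UniformSpace) (f g : U -> C) x :
  @continuous U C_UniformSpace f x -> @continuous U C_UniformSpace g x ->
  @continuous U C_UniformSpace (fun y => f y - g y)%C x.
Proof. intros; apply continuous_Cplus; [|apply continuous_Copp]; assumption. Qed.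

Lemma Cder_continuous (f : C -> C) (z l : C) : Cder f z l -> Ccont f z.
Proof.
intros H. apply Ccont_eps. intros eps Heps.
destruct (proj1 (Cder_eps f z l) H 1 Rlt_0_1) as [d [Hd0 Hd]].
assert (P := Cmod_ge_0 l).
exists (Rmin d (eps / (1 + Cmod l))). split.
{ apply Rmin_pos; auto. apply Rdiv_lt_0_compat; lra. }
intros w Hw.
assert (H1 := Hd w (Rlt_le_trans _ _ _ Hw (Rmin_l _ _))).
assert (H2 := Rlt_le_trans _ _ _ Hw (Rmin_r _ _)).
replace (f w - f z)%C with ((f w - f z - (w - z) * l) + (w - z) * l)%C by ring.
eapply Rle_lt_trans; [apply Cmod_triangle|]. rewrite Cmod_mult.
apply Rle_lt_trans with (Cmod (w - z) * (1 + Cmod l)); [lra|].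
apply (Rmult_lt_reg_r (/ (1 + Cmod l))); [apply Rinv_0_lt_compat; lra|].
rewrite Rmult_assoc, Rinv_r, Rmult_1_r by lra. exact H2.
Qed.

Lemma Rder_continuous (f : R -> C) (t : R) (l : C) : Rder f t l -> Rcont f t.
Proof. intros H. apply (ex_derive_continuous (V := C_R_NormedModule)). now exists l. Qed.

Lemma Cder_const (c z : C) : Cder (fun _ => c) z (RtoC 0).
Proof. exact (@is_derive_const C_AbsRing C_NormedModule c z). Qed.

Lemma Cder_id (z : C) : Cder (fun w => w) z (RtoC 1).
Proof. apply Cder_eps. intros eps He; exists 1; split; [lra|]. intros w _.
replace (w - z - (w - z) * 1)%C with (RtoC 0) by ring. rewrite Cmod_0.
apply Rmult_le_pos; [lra|apply Cmod_ge_0]. Qed.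

Lemma Cder_plus (f g : C -> C) (z a b : C) :
  Cder f z a -> Cder g z b -> Cder (fun w => f w + g w)%C z (a + b)%C.
Proof. exact (@is_derive_plus C_AbsRing C_NormedModule f g z a b). Qed.

Lemma Cder_minus (f g : C -> C) (z a b : C) :
  Cder f z a -> Cder g z b -> Cder (fun w => f w - g w)%C z (a - b)%C.
Proof. exact (@is_derive_minus C_AbsRing C_NormedModule f g z a b). Qed.

Lemma Cder_opp (f : C -> C) (z a : C) : Cder f z a -> Cder (fun w => - f w)%C z (- a)%C.
Proof. exact (@is_derive_opp C_AbsRing C_NormedModule f z a). Qed.

Lemma Cder_mult (f g : C -> C) (z a b : C) :
  Cder f z a -> Cder g z b -> Cder (fun w => f w * g w)%C z (a * g z + f z * b)%C.
Proof.
intros Hf Hg. apply Cder_AbsRing in Hf. apply Cder_AbsRing in Hg. apply Cder_AbsRing.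
exact (@is_derive_mult C_AbsRing f g z a b Hf Hg Cmult_comm).
Qed.

Lemma Cder_inv (z : C) : z <> RtoC 0 -> Cder Cinv z (- (/ (z * z)))%C.
Proof.
intros Hz. apply Cder_eps. intros eps He.
assert (P : 0 < Cmod z) by now apply Cmod_gt_0.
assert (P' : 0 < eps * (Cmod z) ^ 3 / 2).
{ apply Rdiv_lt_0_compat; [apply Rmult_lt_0_compat; auto; apply pow_lt; auto|lra]. }
exists (Rmin (Cmod z / 2) (eps * (Cmod z) ^ 3 / 2)). split; [apply Rmin_pos; lra|].
intros w Hw.
assert (A1 := Rlt_le_trans _ _ _ Hw (Rmin_l _ _)).
assert (A2 := Rlt_le_trans _ _ _ Hw (Rmin_r _ _)).
assert (Pw : Cmod z / 2 < Cmod w).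
{ assert (Cmod z <= Cmod w + Cmod (w - z)).
  { replace z with (w + - (w - z))%C at 1 by ring. eapply Rle_trans; [apply Cmod_triangle|]. rewrite Cmod_opp; lra. }
  lra. }
assert (Hw0 : w <> RtoC 0) by (apply Cmod_gt_0; lra).
replace (/ w - / z - (w - z) * - / (z * z))%C with ((w - z) * ((w - z) / (w * (z * z))))%C
  by (field; auto).
rewrite !Cmod_mult, Cmod_div, !Cmod_mult by (repeat apply Cmult_neq_0; auto).
rewrite (Rmult_comm eps). apply Rmult_le_compat_l; [apply Cmod_ge_0|].
assert (0 < Cmod w * (Cmod z * Cmod z)) by (repeat apply Rmult_lt_0_compat; lra).
apply Rle_div_l; auto. apply Rlt_le, Rlt_le_trans with (1 := A2).
assert (0 < eps * (Cmod z * Cmod z)) by (repeat apply Rmult_lt_0_compat; lra). nra.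
Qed.

Lemma Cder_comp (f g : C -> C) (z a b : C) :
  Cder f (g z) a -> Cder g z b -> Cder (fun w => f (g w)) z (b * a)%C.
Proof.
intros Hf Hg. apply Cder_AbsRing in Hg. exact (@is_derive_comp C_AbsRing C_NormedModule f g z a b Hf Hg).
Qed.

(** The inner function is differentiated over the reals and the outer one over [C], so the two
    remainders are combined by hand; [M] collects the factors that they pick up. *)
Lemma Rder_comp (f : C -> C) (g : R -> C) (t : R) (a b : C) :
  Cder f (g t) a -> Rder g t b -> Rder (fun s => f (g s)) t (b * a)%C.
Proof.
intros Hf Hg. apply Rder_eps. intros eps He.
assert (P1 := Cmod_ge_0 b). assert (P3 := Cmod_ge_0 a).
assert (Hc := proj1 (Rcont_eps _ _) (Rder_continuous _ _ _ Hg)).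
set (M := 1 + Cmod a + Cmod b).
assert (HM : 1 <= M) by (unfold M; lra).
assert (He' : 0 < Rmin 1 (eps / (2 * M))).
{ apply Rmin_pos; [lra|]. apply Rdiv_lt_0_compat; lra. }
set (e := Rmin 1 (eps / (2 * M))) in *.
assert (He1 : e <= 1) by apply Rmin_l.
assert (He2 : 2 * M * e <= eps).
{ apply Rle_trans with (2 * M * (eps / (2 * M))); [apply Rmult_le_compat_l; [lra|apply Rmin_r]|].
  right; field; lra. }
destruct (proj1 (Cder_eps f _ a) Hf e He') as [d1 [Hd1 H1]].
destruct (proj1 (Rder_eps g t b) Hg e He') as [d2 [Hd2 H2]].
destruct (Hc d1 Hd1) as [d3 [Hd3 H3]].
exists (Rmin d2 d3). split; [repeat apply Rmin_pos; auto|].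
intros w Hw.
assert (A2 := H2 w (Rlt_le_trans _ _ _ Hw (Rmin_l _ _))).
assert (A1 := H1 _ (H3 w (Rlt_le_trans _ _ _ Hw (Rmin_r _ _)))).
assert (Q := Rabs_pos (w - t)).
replace (f (g w) - f (g t) - RtoC (w - t) * (b * a))%C with
 ((f (g w) - f (g t) - (g w - g t) * a) + (g w - g t - RtoC (w - t) * b) * a)%C by ring.
eapply Rle_trans; [apply Cmod_triangle|]. rewrite Cmod_mult.
assert (A4 : Cmod (g w - g t) <= Rabs (w - t) * (1 + Cmod b)).
{ replace (g w - g t)%C with ((g w - g t - RtoC (w - t) * b) + RtoC (w - t) * b)%C by ring.
  eapply Rle_trans; [apply Cmod_triangle|]. rewrite Cmod_mult, Cmod_R. nra. }
apply Rle_trans with (2 * M * e * Rabs (w - t)); [|apply Rmult_le_compat_r; auto].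
assert (Cmod (f (g w) - f (g t) - (g w - g t) * a) <= e * (Rabs (w - t) * M)).
{ eapply Rle_trans; [exact A1|]. apply Rmult_le_compat_l; [lra|].
  eapply Rle_trans; [exact A4|]. apply Rmult_le_compat_l; auto. unfold M; lra. }
assert (Cmod (g w - g t - RtoC (w - t) * b) * Cmod a <= e * Rabs (w - t) * M).
{ apply Rmult_le_compat; auto using Cmod_ge_0. unfold M; lra. }
lra.
Qed.

Lemma Cder_derive (f : C -> C) (z l : C) : Cder f z l -> C_derive f z = l.
Proof. apply is_C_derive_unique. Qed.

Lemma hol_Cder (D : C -> Prop) (f : C -> C) (z : C) :
  holomorphic_on D f -> D z -> Cder f z (C_derive f z).
Proof. intros H Hz. apply C_derive_correct; [exact z|exact (H z Hz)]. Qed.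

Lemma Cder_ex (f : C -> C) (z l : C) : Cder f z l -> @ex_derive C_AbsRing C_NormedModule f z.
Proof. intros H; now exists l. Qed.

Lemma Cder_eq (f : C -> C) (z l l' : C) : Cder f z l -> l = l' -> Cder f z l'.
Proof. now intros H <-. Qed.

Lemma Rder_eq (f : R -> C) (t : R) (l l' : C) : Rder f t l -> l = l' -> Rder f t l'.
Proof. now intros H <-. Qed.

Lemma Cder_ext_loc (f g : C -> C) (z l : C) (d : R) :
  0 < d -> (forall w, Cmod (w - z) < d -> f w = g w) -> Cder f z l -> Cder g z l.
Proof.
intros Hd E. apply is_derive_ext_loc. exists (mkposreal d Hd). exact E.
Qed.

Lemma hol_cont (D : C -> Prop) (f : C -> C) (z : C) :
  holomorphic_on D f -> D z -> Ccont f z.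
Proof. intros H Hz. exact (Cder_continuous _ _ _ (hol_Cder D f z H Hz)). Qed.

Lemma Cder_div (f g : C -> C) (z a b : C) :
  Cder f z a -> Cder g z b -> g z <> RtoC 0 ->
  Cder (fun w => f w / g w)%C z ((a * g z - f z * b) / (g z * g z))%C.
Proof.
intros Hf Hg H0.
eapply Cder_eq.
- apply (Cder_mult f (fun w => / g w)%C); [exact Hf|].
  apply (Cder_comp Cinv g); [apply Cder_inv, H0|exact Hg].
- field; auto.
Qed.

Lemma hol_minus (D : C -> Prop) (f g : C -> C) :
  holomorphic_on D f -> holomorphic_on D g -> holomorphic_on D (fun z => f z - g z)%C.
Proof. intros Hf Hg z Hz. eapply Cder_ex, Cder_minus; eapply hol_Cder; eauto. Qed.

Lemma hol_div (D : C -> Prop) (f g : C -> C) :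
  holomorphic_on D f -> holomorphic_on D g -> (forall z, D z -> g z <> RtoC 0) ->
  holomorphic_on D (fun z => f z / g z)%C.
Proof. intros Hf Hg H0 z Hz. eapply Cder_ex, Cder_div; eauto; eapply hol_Cder; eauto. Qed.

Lemma hol_const (D : C -> Prop) (c : C) : holomorphic_on D (fun _ => c).
Proof. intros z _. eapply Cder_ex, Cder_const. Qed.

Lemma Rder_re_im (f : R -> C) (t : R) (l : C) :
  Rder f t l <-> is_derive (fun s => Re (f s)) t (Re l) /\ is_derive (fun s => Im (f s)) t (Im l).
Proof.
assert (A : forall (p : C -> R) (H1 : forall z, Rabs (p z) <= Cmod z)
   (H2 : forall u v w x, p (u - v - RtoC x * w)%C = p u - p v - x * p w), Rder f t l -> is_derive (fun s => p (f s)) t (p l)).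
{ intros p H1 H2 H. split; [apply (is_linear_scal_l (V := R_NormedModule))|].
  intros x Hx.
  assert (E : x = t) by (symmetry; exact (@is_filter_lim_locally_unique R_AbsRing (AbsRing_NormedModule R_AbsRing) t x Hx)).
  subst x. intros [eps Heps].
  destruct (proj1 (Rder_eps f t l) H eps Heps) as [d [Hd0 Hd]].
  exists (mkposreal d Hd0). intros w Hw. specialize (Hd w Hw).
  eapply Rle_trans; [|exact Hd].
  eapply Rle_trans; [|apply H1]. rewrite H2. right. reflexivity. }
split.
- intros H; split; apply A; auto.
  + exact re_le_Cmod.
  + intros [] [] [] x; simpl; ring.
  + exact im_le_Cmod.
  + intros [] [] [] x; simpl; ring.
- intros [[_ H1] [_ H2]]. apply Rder_eps. intros eps Heps.
  destruct (H1 t (fun P HP => HP) (mkposreal (eps/2) ltac:(lra))) as [d1 K1].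
  destruct (H2 t (fun P HP => HP) (mkposreal (eps/2) ltac:(lra))) as [d2 K2].
  exists (Rmin d1 d2). split; [apply Rmin_pos; apply cond_pos|].
  intros s Hs.
  specialize (K1 s (Rlt_le_trans _ _ _ Hs (Rmin_l _ _))).
  specialize (K2 s (Rlt_le_trans _ _ _ Hs (Rmin_r _ _))).
  eapply Rle_trans; [apply Cmod_le_Rabs|].
  replace (Re (f s - f t - RtoC (s - t) * l)) with (Re (f s) - Re (f t) - (s - t) * Re l)
   by (destruct (f s), (f t), l; simpl; ring).
  replace (Im (f s - f t - RtoC (s - t) * l)) with (Im (f s) - Im (f t) - (s - t) * Im l)
   by (destruct (f s), (f t), l; simpl; ring).
  change (Rabs (Re (f s) - Re (f t) - (s - t) * Re l) <= eps / 2 * Rabs (s - t)) in K1.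
  change (Rabs (Im (f s) - Im (f t) - (s - t) * Im l) <= eps / 2 * Rabs (s - t)) in K2.
  lra.
Qed.

Lemma Rder_const (c : C) (t : R) : Rder (fun _ => c) t (RtoC 0).
Proof. exact (@is_derive_const R_AbsRing C_R_NormedModule c t). Qed.

Lemma Rder_RtoC (g : R -> R) (t l : R) : is_derive g t l -> Rder (fun s => RtoC (g s)) t (RtoC l).
Proof.
intros H. apply Rder_re_im; simpl; split; [exact H|]. exact (@is_derive_const R_AbsRing R_NormedModule 0 t).
Qed.

Lemma Rder_plus (f g : R -> C) (t : R) (a b : C) :
  Rder f t a -> Rder g t b -> Rder (fun s => f s + g s)%C t (a + b)%C.
Proof. exact (@is_derive_plus R_AbsRing C_R_NormedModule f g t a b). Qed.

Lemma Rder_mult (f g : R -> C) (t : R) (a b : C) :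
  Rder f t a -> Rder g t b -> Rder (fun s => f s * g s)%C t (a * g t + f t * b)%C.
Proof.
intros Hf Hg.
apply Rder_re_im in Hf. apply Rder_re_im in Hg. destruct Hf as [F1 F2], Hg as [G1 G2].
apply Rder_re_im; split.
- replace (Re (a * g t + f t * b)) with ((Re a * Re (g t) + Re (f t) * Re b) - (Im a * Im (g t) + Im (f t) * Im b))
    by (destruct a, b, (g t), (f t); simpl; ring).
  exact (is_derive_minus (V := R_NormedModule) _ _ _ _ _ (is_derive_mult _ _ _ _ _ F1 G1 Rmult_comm) (is_derive_mult _ _ _ _ _ F2 G2 Rmult_comm)).
- replace (Im (a * g t + f t * b)) with ((Re a * Im (g t) + Re (f t) * Im b) + (Im a * Re (g t) + Im (f t) * Re b))
    by (destruct a, b, (g t), (f t); simpl; ring).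
  exact (is_derive_plus (V := R_NormedModule) _ _ _ _ _ (is_derive_mult _ _ _ _ _ F1 G2 Rmult_comm) (is_derive_mult _ _ _ _ _ F2 G1 Rmult_comm)).
Qed.

Lemma Rder_scal (k : C) (f : R -> C) (t : R) (l : C) : Rder f t l -> Rder (fun s => k * f s)%C t (k * l)%C.
Proof.
intros H. eapply Rder_eq; [apply (Rder_mult (fun _ => k) f); [apply Rder_const|exact H]|ring].
Qed.

Lemma Cder_scal (k : C) (f : C -> C) (z l : C) : Cder f z l -> Cder (fun w => k * f w)%C z (k * l)%C.
Proof.
intros H. eapply Cder_eq; [apply (Cder_mult (fun _ => k) f); [apply Cder_const|exact H]|ring].
Qed.

Lemma Rder_id_RtoC (t : R) : Rder (fun s => RtoC s) t (RtoC 1).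
Proof. apply (Rder_RtoC (fun t => t)). apply (is_derive_id (K := R_AbsRing)). Qed.

Lemma is_derive_le_incr (h dh : R -> R) (a b : R) :
  a <= b -> (forall t, a <= t <= b -> is_derive h t (dh t)) -> (forall t, a <= t <= b -> dh t <= 0) -> h b <= h a.
Proof.
intros Hab Hd Hn.
destruct (MVT_gen h a b dh) as [c [Hc E]].
- rewrite Rmin_left, Rmax_right by lra. intros; apply Hd; lra.
- rewrite Rmin_left, Rmax_right by lra. intros x Hx.
  apply continuity_pt_filterlim. apply (ex_derive_continuous (V := R_NormedModule)). exists (dh x). now apply Hd.
- rewrite Rmin_left, Rmax_right in Hc by lra. specialize (Hn c Hc). nra.
Qed.

(** A rotation that reduces complex estimates to real parts. The bound is [<= 1] rather than [= 1]
    because the factor 0 is taken at [z = 0]. *)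
Lemma exists_conj_unit (z : C) : exists u : C, Cmod u <= 1 /\ (u * z)%C = RtoC (Cmod z).
Proof.
destruct (Req_dec (Cmod z) 0) as [E|E].
- exists (RtoC 0). rewrite Cmod_0, E. split; [lra|ring].
- exists (Cconj z / RtoC (Cmod z))%C.
  assert (E' : RtoC (Cmod z) <> RtoC 0) by (intros H; apply E; now injection H).
  split.
  + rewrite Cmod_div, Cmod_conj, Cmod_R, Rabs_right by (auto; apply Rle_ge, Cmod_ge_0).
    right; field; auto.
  + transitivity ((z * Cconj z) / RtoC (Cmod z))%C; [field; auto|].
    rewrite <- Cmod2_conj. rewrite RtoC_pow. simpl. field; auto.
Qed.

(** Once [f b - f a] is rotated onto the positive real axis, [Re (u * f) - g] has nonpositive
    derivative. The majorant [g] need not be linear: [primitive_near_2q] uses a multiple of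
    [|q|]. *)
Lemma mean_value_le (f df : R -> C) (g dg : R -> R) (a b : R) :
  a <= b ->
  (forall t, a <= t <= b -> Rder f t (df t)) ->
  (forall t, a <= t <= b -> is_derive g t (dg t)) ->
  (forall t, a <= t <= b -> Cmod (df t) <= dg t) ->
  Cmod (f b - f a) <= g b - g a.
Proof.
intros Hab Hf Hg Hle.
destruct (exists_conj_unit (f b - f a)) as [u [Hu E]].
set (h := fun t => Re (u * f t) - g t).
assert (H : h b <= h a).
{ apply (is_derive_le_incr h (fun t => Re (u * df t) - dg t)); auto.
  - intros t Ht. apply (is_derive_minus (V := R_NormedModule)); [|apply Hg; auto].
    assert (K := Rder_mult (fun _ => u) f t _ _ (Rder_const u t) (Hf t Ht)).
    apply Rder_re_im in K. destruct K as [K _].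
    replace (Re (u * df t)) with (Re (0 * f t + u * df t)); [exact K|].
    destruct u, (df t), (f t); simpl; ring.
  - intros t Ht. specialize (Hle t Ht).
    assert (Rabs (Re (u * df t)) <= Cmod (df t)).
    { eapply Rle_trans; [apply re_le_Cmod|]. rewrite Cmod_mult.
      assert (P := Cmod_ge_0 (df t)). nra. }
    assert (P := Rle_abs (Re (u * df t))). lra. }
unfold h in H.
assert (Cmod (f b - f a) = Re (u * f b) - Re (u * f a)).
{ replace (Re (u * f b) - Re (u * f a)) with (Re (u * (f b - f a))) by (destruct u, (f b), (f a); simpl; ring).
  rewrite E. reflexivity. }
lra.
Qed.

Definition seg (a b : C) (t : R) : C := (a + RtoC t * (b - a))%C.

Lemma Rder_seg (a b : C) (t : R) : Rder (seg a b) t (b - a)%C.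
Proof.
unfold seg. eapply Rder_eq.
- apply Rder_plus; [apply Rder_const|]. apply (Rder_mult (fun t => RtoC t) (fun _ => b - a)%C); [|apply Rder_const].
  apply (Rder_RtoC (fun t => t)). apply (is_derive_id (K := R_AbsRing)).
- change (@one R_AbsRing) with 1. ring.
Qed.

Lemma seg_mean_value (f df : C -> C) (a b : C) (K : R) :
  (forall t, 0 <= t <= 1 -> Cder f (seg a b t) (df (seg a b t))) ->
  (forall t, 0 <= t <= 1 -> Cmod (df (seg a b t)) <= K) ->
  Cmod (f b - f a) <= K * Cmod (b - a).
Proof.
intros Hf HK.
replace (f b - f a)%C with (f (seg a b 1) - f (seg a b 0))%C.
2: { unfold seg. do 2 f_equal; [|f_equal]; ring. }
replace (K * Cmod (b - a)) with (K * Cmod (b - a) * 1 - K * Cmod (b - a) * 0) by ring.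
apply (mean_value_le (fun t => f (seg a b t)) (fun t => (b - a) * df (seg a b t))%C
  (fun t => K * Cmod (b - a) * t) (fun t => K * Cmod (b - a))); [lra| | |].
- intros t Ht. apply Rder_comp; [auto|apply Rder_seg].
- intros t _. auto_derive; auto; ring.
- intros t Ht. rewrite Cmod_mult, Rmult_comm. apply Rmult_le_compat_r; [apply Cmod_ge_0|auto].
Qed.

(** * The complex exponential *)

Lemma Cexp_plus (a b : C) : Cexp (a + b) = (Cexp a * Cexp b)%C.
Proof.
destruct a as [a1 a2], b as [b1 b2]. unfold Cexp, Cmult, Cplus; simpl.
rewrite exp_plus, cos_plus, sin_plus. f_equal; ring.
Qed.

Lemma Cmod_Cexp (z : C) : Cmod (Cexp z) = exp (Re z).
Proof.
unfold Cexp, Cmod; simpl.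
replace (_ + _) with (exp (Re z) ^ 2 * (Rsqr (sin (Im z)) + Rsqr (cos (Im z)))) by (unfold Rsqr; ring).
rewrite sin2_cos2, Rmult_1_r. apply sqrt_pow2. apply Rlt_le, exp_pos.
Qed.

Lemma Cexp_0 : Cexp 0 = RtoC 1.
Proof. unfold Cexp; simpl. rewrite exp_0, cos_0, sin_0. unfold RtoC. f_equal; ring. Qed.

Lemma Cexp_neq_0 (z : C) : Cexp z <> RtoC 0.
Proof. apply Cmod_gt_0. rewrite Cmod_Cexp. apply exp_pos. Qed.

Lemma Cexp_opp (z : C) : Cexp (- z) = (/ Cexp z)%C.
Proof.
assert (H := Cexp_neq_0 z).
assert (E : (Cexp z * Cexp (- z))%C = RtoC 1).
{ rewrite <- Cexp_plus. replace (z + - z)%C with (RtoC 0) by ring. apply Cexp_0. }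
transitivity (/ Cexp z * (Cexp z * Cexp (- z)))%C; [field; auto|]. rewrite E. ring.
Qed.

Lemma derive_eps (f : R -> R) (x l : R) : is_derive f x l -> forall eps, 0 < eps ->
  exists d, 0 < d /\ forall h, Rabs h < d -> Rabs (f (x + h) - f x - l * h) <= eps * Rabs h.
Proof.
intros [_ H] eps He.
destruct (H x (fun P HP => HP) (mkposreal eps He)) as [d Hd].
exists d; split; [apply cond_pos|]. intros h Hh.
assert (E : x + h - x = h) by ring.
specialize (Hd (x + h)).
change (Rabs (x + h - x) < d -> Rabs (f (x + h) - f x - (x + h - x) * l) <= eps * Rabs (x + h - x)) in Hd.
rewrite E in Hd. rewrite (Rmult_comm l). auto.
Qed.

(** The addition law reduces the claim to the point 0, where the real derivatives of [exp], [cos]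
    and [sin] are assembled. *)
Lemma Cder_Cexp (z : C) : Cder Cexp z (Cexp z).
Proof.
assert (H0 : Cder Cexp (RtoC 0) (RtoC 1)).
{ apply Cder_eps. intros eps He.
  (* The remainders of [exp], [cos], [sin] and the product [(exp x - 1) * y] add up to at most
     [7 * e * Cmod w]. *)
  assert (He' : 0 < Rmin 1 (eps / 8)) by (apply Rmin_pos; lra).
  set (e := Rmin 1 (eps / 8)) in *.
  assert (e1 : e <= 1) by apply Rmin_l. assert (e2 : e <= eps / 8) by apply Rmin_r.
  destruct (derive_eps exp 0 1) with (eps := e) as [d1 [Hd1 H1]]; auto.
  { rewrite <- exp_0. apply is_derive_exp. }
  destruct (derive_eps cos 0 0) with (eps := e) as [d2 [Hd2 H2]]; auto.
  { replace (is_derive cos 0 0) with (is_derive cos 0 (- sin 0)) by (rewrite sin_0, Ropp_0; reflexivity). apply is_derive_cos. }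
  destruct (derive_eps sin 0 1) with (eps := e) as [d3 [Hd3 H3]]; auto.
  { rewrite <- cos_0. apply is_derive_sin. }
  exists (Rmin (Rmin e (1/2)) (Rmin d1 (Rmin d2 d3))). split; [repeat apply Rmin_pos; lra|].
  intros w Hw. replace (w - 0)%C with w in * by ring.
  assert (W0 := Rlt_le_trans _ _ _ Hw (Rle_trans _ _ _ (Rmin_l _ _) (Rmin_l _ _))).
  assert (W0' := Rlt_le_trans _ _ _ Hw (Rle_trans _ _ _ (Rmin_l _ _) (Rmin_r _ _))).
  assert (W1 := Rlt_le_trans _ _ _ Hw (Rle_trans _ _ _ (Rmin_r _ _) (Rmin_l _ _))).
  assert (W2 := Rlt_le_trans _ _ _ Hw (Rle_trans _ _ _ (Rmin_r _ _) (Rle_trans _ _ _ (Rmin_r _ _) (Rmin_l _ _)))).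
  assert (W3 := Rlt_le_trans _ _ _ Hw (Rle_trans _ _ _ (Rmin_r _ _) (Rle_trans _ _ _ (Rmin_r _ _) (Rmin_r _ _)))).
  clear Hw.
  assert (Rw := re_le_Cmod w). assert (Iw := im_le_Cmod w).
  destruct w as [x y]. simpl in Rw, Iw. set (m := Cmod (x, y)) in *.
  specialize (H1 x ltac:(lra)). specialize (H2 y ltac:(lra)). specialize (H3 y ltac:(lra)).
  rewrite Rplus_0_l, exp_0 in H1. rewrite Rplus_0_l, cos_0 in H2. rewrite Rplus_0_l, sin_0 in H3.
  rewrite Cexp_0. eapply Rle_trans; [apply Cmod_le_Rabs|].
  unfold Cexp; simpl.
  assert (m0 : 0 <= m) by apply Cmod_ge_0.
  assert (e0 : e * Rabs x <= e * m) by (apply Rmult_le_compat_l; lra).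
  assert (e0' : e * Rabs y <= e * m) by (apply Rmult_le_compat_l; lra).
  assert (e3 : e * m <= m) by nra.
  assert (X1 : Rabs (exp x - 1) <= 2 * m).
  { replace (exp x - 1) with ((exp x - 1 - 1 * x) + x) by ring. eapply Rle_trans; [apply Rabs_triang|]. lra. }
  assert (X2 : Rabs (exp x) <= 2).
  { replace (exp x) with ((exp x - 1) + 1) by ring. eapply Rle_trans; [apply Rabs_triang|]. rewrite Rabs_R1. lra. }
  replace (exp x * cos y + - (1) + - (x * 1 - y * 0)) with ((exp x - 1 - 1 * x) + exp x * (cos y - 1 - 0 * y)) by ring.
  replace (exp x * sin y + - 0 + - (x * 0 + y * 1)) with (exp x * (sin y - 0 - 1 * y) + (exp x - 1) * y) by ring.
  assert (T1 : Rabs (exp x * (cos y - 1 - 0 * y)) <= 2 * (e * m)).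
  { rewrite Rabs_mult. apply Rmult_le_compat; try apply Rabs_pos; lra. }
  assert (T2 : Rabs (exp x * (sin y - 0 - 1 * y)) <= 2 * (e * m)).
  { rewrite Rabs_mult. apply Rmult_le_compat; try apply Rabs_pos; lra. }
  assert (T3 : Rabs ((exp x - 1) * y) <= 2 * (e * m)).
  { rewrite Rabs_mult. apply Rle_trans with (2 * m * m); [apply Rmult_le_compat; try apply Rabs_pos; lra|nra]. }
  assert (Rabs (exp x - 1 - 1 * x) <= e * m) by lra.
  eapply Rle_trans; [apply Rplus_le_compat; apply Rabs_triang|]. nra. }
apply Cder_ext_loc with (f := fun w => (Cexp z * Cexp (w - z))%C) (d := 1); [lra| |].
{ intros w _. rewrite <- Cexp_plus. f_equal; ring. }
eapply Cder_eq.
- apply (Cder_mult (fun _ => Cexp z) (fun w => Cexp (w - z))); [apply Cder_const|].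
  apply (Cder_comp Cexp (fun w => (w - z)%C)).
  + replace (z - z)%C with (RtoC 0) by ring. exact H0.
  + apply Cder_minus; [apply Cder_id|apply Cder_const].
- ring.
Qed.

Lemma Cexp_2PI (z : C) : Cexp (z + RtoC (2 * PI) * Ci) = Cexp z.
Proof.
destruct z as [x y]. unfold Cexp; simpl.
replace (x + (2 * PI * 0 - 0 * 1)) with x by ring. replace (y + (2 * PI * 1 + 0 * 0)) with (y + 2 * INR 1 * PI) by (simpl; ring).
now rewrite cos_period, sin_period.
Qed.

Lemma Cexp_surj (c : C) : c <> RtoC 0 -> exists w, Cexp w = c.
Proof.
intros Hc. assert (P : 0 < Cmod c) by now apply Cmod_gt_0.
assert (E2 := Cmod2_alt c).
set (x := Re c / Cmod c). 
assert (Hx : -1 <= x <= 1).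
{ assert (A := re_le_Cmod c). apply Rabs_le_between in A. unfold x. split.
  - apply Rle_div_r; lra.
  - apply Rle_div_l; lra. }
assert (Es : sqrt (1 - x²) = Rabs (Im c) / Cmod c).
{ rewrite <- (sqrt_pow2 (Rabs (Im c) / Cmod c)).
  - f_equal. unfold x, Rsqr. unfold Rdiv. rewrite Rpow_mult_distr, pow2_abs. 
    apply (Rmult_eq_reg_r (Cmod c ^ 2)); [|nra]. field_simplify; [|lra|lra]. nra.
  - apply Rmult_le_pos; [apply Rabs_pos|apply Rlt_le, Rinv_0_lt_compat, P]. }
destruct (Rle_dec 0 (Im c)) as [Hs|Hs].
- exists (ln (Cmod c), acos x). unfold Cexp; simpl. rewrite exp_ln, cos_acos, sin_acos, Es, Rabs_right by lra.
  unfold x. destruct c as [a b]. simpl in *. f_equal; field; lra.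
- exists (ln (Cmod c), - acos x). unfold Cexp; simpl. rewrite cos_neg, sin_neg, exp_ln, cos_acos, sin_acos, Es, Rabs_left by lra.
  unfold x. destruct c as [a b]. simpl in *. f_equal; field; lra.
Qed.

(** * Goursat's lemma and primitives *)

Definition CInt (f : R -> C) (a b : R) : C := @RInt C_R_CompleteNormedModule f a b.
Notation ex_CInt := (@ex_RInt C_R_CompleteNormedModule).

(** If [P] failed, a nested sequence of bad quarters would shrink to a point, where the local
    hypothesis contradicts it. The principle is stated for any [P] because it yields both Goursat's
    lemma and the boundedness of continuous functions. *)
Lemma rect_bisection (P : R -> R -> R -> R -> Prop) (a b c d : R) :
  a <= b -> c <= d ->
  (forall a' b' c' d', a <= a' -> a' <= b' -> b' <= b -> c <= c' -> c' <= d' -> d' <= d ->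
     P a' ((a' + b') / 2) c' ((c' + d') / 2) -> P ((a' + b') / 2) b' c' ((c' + d') / 2) ->
     P a' ((a' + b') / 2) ((c' + d') / 2) d' -> P ((a' + b') / 2) b' ((c' + d') / 2) d' ->
     P a' b' c' d') ->
  (forall x y, a <= x <= b -> c <= y <= d -> exists del, 0 < del /\
     forall a' b' c' d', a <= a' -> a' <= x <= b' -> b' <= b -> c <= c' -> c' <= y <= d' -> d' <= d ->
       b' - a' < del -> d' - c' < del -> P a' b' c' d') ->
  P a b c d.
Proof.
intros Hab Hcd Hsub Hloc. apply NNPP. intros HN.
set (inv := fun s : (R * R) * (R * R) => let '((a', b'), (c', d')) := s in
  a <= a' /\ a' <= b' /\ b' <= b /\ c <= c' /\ c' <= d' /\ d' <= d /\ ~ P a' b' c' d').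
set (step := fun s s' : (R * R) * (R * R) =>
  let '((a1, b1), (c1, d1)) := s in let '((a2, b2), (c2, d2)) := s' in
  a1 <= a2 /\ b2 <= b1 /\ c1 <= c2 /\ d2 <= d1 /\ b2 - a2 = (b1 - a1) / 2 /\ d2 - c2 = (d1 - c1) / 2).
(* The choice of a bad quarter is made a function on rectangles known to be bad, so that it can be
   iterated by plain recursion. *)
assert (F : forall s : sig inv, {s' : sig inv | step (proj1_sig s) (proj1_sig s')}).
{ intros [s Hs]. apply constructive_indefinite_description. simpl.
  destruct s as [[a1 b1] [c1 d1]]. destruct Hs as (h1 & h2 & h3 & h4 & h5 & h6 & h7).
  apply NNPP. intros K. apply h7. apply Hsub; auto; apply NNPP; intros Q; apply K.
  - assert (I : inv ((a1, (a1 + b1) / 2), (c1, (c1 + d1) / 2))) by (repeat split; auto; lra).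
    exists (exist _ _ I). simpl. lra.
  - assert (I : inv (((a1 + b1) / 2, b1), (c1, (c1 + d1) / 2))) by (repeat split; auto; lra).
    exists (exist _ _ I). simpl. lra.
  - assert (I : inv ((a1, (a1 + b1) / 2), ((c1 + d1) / 2, d1))) by (repeat split; auto; lra).
    exists (exist _ _ I). simpl. lra.
  - assert (I : inv (((a1 + b1) / 2, b1), ((c1 + d1) / 2, d1))) by (repeat split; auto; lra).
    exists (exist _ _ I). simpl. lra. }
assert (I0 : inv ((a, b), (c, d))) by (repeat split; auto; lra).
set (u := fix u n := match n with O => exist inv _ I0 | S k => proj1_sig (F (u k)) end).
assert (Hstep : forall n, step (proj1_sig (u n)) (proj1_sig (u (S n)))).
{ intros n. simpl. exact (proj2_sig (F (u n))). }
assert (Hinv : forall n, inv (proj1_sig (u n))) by (intros n; exact (proj2_sig (u n))).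
set (A := fun n => fst (fst (proj1_sig (u n)))). set (B := fun n => snd (fst (proj1_sig (u n)))).
set (C1 := fun n => fst (snd (proj1_sig (u n)))). set (D := fun n => snd (snd (proj1_sig (u n)))).
assert (HI : forall n, a <= A n /\ A n <= B n /\ B n <= b /\ c <= C1 n /\ C1 n <= D n /\ D n <= d /\ ~ P (A n) (B n) (C1 n) (D n)).
{ intros n. specialize (Hinv n). unfold A, B, C1, D. destruct (proj1_sig (u n)) as [[? ?] [? ?]]. exact Hinv. }
assert (HS : forall n, A n <= A (S n) /\ B (S n) <= B n /\ C1 n <= C1 (S n) /\ D (S n) <= D n /\
   B (S n) - A (S n) = (B n - A n) / 2 /\ D (S n) - C1 (S n) = (D n - C1 n) / 2).
{ intros n. specialize (Hstep n). unfold A, B, C1, D. destruct (proj1_sig (u n)) as [[? ?] [? ?]], (proj1_sig (u (S n))) as [[? ?] [? ?]]. exact Hstep. }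
assert (N : forall (U V : nat -> R), (forall n, U n <= V n) -> (forall n, U n <= U (S n)) -> (forall n, V (S n) <= V n) ->
   exists x, forall n, U n <= x <= V n).
{ intros U V h1 h2 h3.
  assert (mU : forall n k, U n <= U (n + k)%nat).
  { intros n k; induction k; [rewrite Nat.add_0_r; lra|]. rewrite Nat.add_succ_r. eapply Rle_trans; [apply IHk|apply h2]. }
  assert (mV : forall n k, V (n + k)%nat <= V n).
  { intros n k; induction k; [rewrite Nat.add_0_r; lra|]. rewrite Nat.add_succ_r. eapply Rle_trans; [apply h3|apply IHk]. }
  assert (UV : forall n m, U n <= V m).
  { intros n m. eapply Rle_trans; [apply (mU n m)|]. eapply Rle_trans; [apply h1|]. rewrite Nat.add_comm. apply mV. }
  destruct (completeness (fun r => exists n, r = U n)) as [x [X1 X2]].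
  - exists (V O). intros r [n ->]. apply UV.
  - exists (U O). now exists O.
  - exists x. intros n. split; [apply X1; now exists n|]. apply X2. intros r [m ->]. apply UV. }
destruct (N A B) as [x Hx]; try (intros n; apply HI || apply HS).
destruct (N C1 D) as [y Hy]; try (intros n; apply HI || apply HS).
destruct (Hloc x y) as [del [Hdel HP]].
{ specialize (HI O). specialize (Hx O). lra. }
{ specialize (HI O). specialize (Hy O). lra. }
assert (Hw : forall n, B n - A n = (b - a) * (/ 2) ^ n /\ D n - C1 n = (d - c) * (/ 2) ^ n).
{ intros n. induction n as [|n IH].
  - unfold A, B, C1, D; simpl. lra.
  - destruct (HS n) as (_ & _ & _ & _ & E1 & E2). destruct IH as [I1 I2].
    rewrite E1, E2, I1, I2. simpl. split; field. }
assert (K : exists n, (b - a) * (/ 2) ^ n < del /\ (d - c) * (/ 2) ^ n < del).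
{ set (w := 1 + (b - a) + (d - c)).
  destruct (pow_lt_1_zero (/ 2)) with (y := del / w) as [n Hn].
  - rewrite Rabs_right; lra.
  - apply Rdiv_lt_0_compat; unfold w; lra.
  - exists n. specialize (Hn n (le_n n)).
    assert (P0 : 0 < (/2)^n) by (apply pow_lt; lra).
    rewrite Rabs_right in Hn by lra.
    assert (w * (/2)^n < del).
    { apply (Rmult_lt_compat_l w) in Hn; [|unfold w; lra].
      replace (w * (del / w)) with del in Hn by (field; unfold w; lra). exact Hn. }
    unfold w in *. split; nra. }
destruct K as [n [K1 K2]]. destruct (Hw n) as [W1 W2]. rewrite <- W1 in K1. rewrite <- W2 in K2.
destruct (HI n) as (h1 & h2 & h3 & h4 & h5 & h6 & h7). apply h7.
apply HP; auto.
Qed.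

Definition hint (f : C -> C) (a b y : R) : C := CInt (fun t => f (t, y)) a b.
(** The factor [Ci] is [dz / dt] on a vertical side. *)
Definition vint (f : C -> C) (x c d : R) : C := CInt (fun t => Ci * f (x, t))%C c d.
(** The boundary is traversed anticlockwise from the corner [(a, c)]. *)
Definition rect_int (f : C -> C) (a b c d : R) : C :=
  (hint f a b c + vint f b c d - hint f a b d - vint f a c d)%C.

(** The endpoints come in either order, as in an oriented integral; primitives are based at interior
    points, so all four directions occur. *)
Definition between (a b x : R) : Prop := Rmin a b <= x <= Rmax a b.

Lemma between_le a b x : a <= b -> between a b x -> a <= x <= b.
Proof. intros H. unfold between. rewrite Rmin_left, Rmax_right by lra. tauto. Qed.

Lemma continuous_hor (f : C -> C) (t y : R) : Ccont f (t, y) -> Rcont (fun s => f (s, y)) t.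
Proof.
intros H. apply (continuous_comp (fun s : R_UniformSpace => (s, y) : C_UniformSpace) f); [|exact H].
apply continuous_pairC; [apply continuous_id|apply continuous_const].
Qed.

Lemma continuous_ver (f : C -> C) (x t : R) : Ccont f (x, t) -> Rcont (fun s => Ci * f (x, s))%C t.
Proof.
intros H. apply continuous_Cmult; [apply continuous_const|].
apply (continuous_comp (fun s : R_UniformSpace => (x, s) : C_UniformSpace) f); [|exact H].
apply continuous_pairC; [apply continuous_const|apply continuous_id].
Qed.

Lemma ex_hint (f : C -> C) (a b y : R) :
  (forall t, between a b t -> Ccont f (t, y)) -> ex_CInt (fun t => f (t, y)) a b.
Proof. intros H. apply ex_RInt_continuous. intros t Ht. apply continuous_hor. now apply H. Qed.

Lemma ex_vint (f : C -> C) (x c d : R) :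
  (forall t, between c d t -> Ccont f (x, t)) -> ex_CInt (fun t => Ci * f (x, t))%C c d.
Proof. intros H. apply ex_RInt_continuous. intros t Ht. apply continuous_ver. now apply H. Qed.

Lemma CInt_bound (f : R -> C) (a b S : R) :
  a <= b -> (forall t, a <= t <= b -> Cmod (f t) <= S) -> ex_CInt f a b -> Cmod (CInt f a b) <= (b - a) * S.
Proof.
intros Hab HS Hex. rewrite Cmod_norm.
apply (norm_RInt_le_const (V := C_R_NormedModule) f a b (CInt f a b) S Hab).
- intros t Ht. rewrite <- Cmod_norm. auto.
- apply (RInt_correct (V := C_R_CompleteNormedModule)). exact Hex.
Qed.

Definition rcont (f : C -> C) (a b c d : R) : Prop :=
  forall x y, a <= x <= b -> c <= y <= d -> Ccont f (x, y).

Lemma rect_int_bound (f : C -> C) (a b c d S : R) :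
  a <= b -> c <= d -> rcont f a b c d ->
  (forall x y, a <= x <= b -> c <= y <= d -> Cmod (f (x, y)) <= S) ->
  Cmod (rect_int f a b c d) <= 2 * ((b - a) + (d - c)) * S.
Proof.
intros Hab Hcd Hc HS.
assert (B1 : forall y, c <= y <= d -> Cmod (hint f a b y) <= (b - a) * S).
{ intros y Hy. apply CInt_bound; auto. apply ex_hint. intros t Ht. apply between_le in Ht; try lra. apply Hc; lra. }
assert (B2 : forall x, a <= x <= b -> Cmod (vint f x c d) <= (d - c) * S).
{ intros x Hx. apply CInt_bound; auto.
  - intros t Ht. rewrite Cmod_mult, Cmod_Ci, Rmult_1_l. auto.
  - apply ex_vint. intros t Ht. apply between_le in Ht; try lra. apply Hc; lra. }
unfold rect_int, Cminus.
eapply Rle_trans; [apply Cmod_triangle|]. rewrite Cmod_opp.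
eapply Rle_trans; [apply Rplus_le_compat_r, Cmod_triangle|]. rewrite Cmod_opp.
eapply Rle_trans; [apply Rplus_le_compat_r, Rplus_le_compat_r, Cmod_triangle|].
generalize (B1 c ltac:(lra)) (B1 d ltac:(lra)) (B2 a ltac:(lra)) (B2 b ltac:(lra)). lra.
Qed.

Lemma hint_chasles (f : C -> C) (a b e y : R) :
  (forall t, between a b t -> Ccont f (t, y)) -> (forall t, between b e t -> Ccont f (t, y)) ->
  hint f a e y = (hint f a b y + hint f b e y)%C.
Proof.
intros H1 H2. symmetry. exact (RInt_Chasles (V := C_R_CompleteNormedModule) _ a b e (ex_hint _ _ _ _ H1) (ex_hint _ _ _ _ H2)).
Qed.

Lemma vint_chasles (f : C -> C) (x a b e : R) :
  (forall t, between a b t -> Ccont f (x, t)) -> (forall t, between b e t -> Ccont f (x, t)) ->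
  vint f x a e = (vint f x a b + vint f x b e)%C.
Proof.
intros H1 H2. symmetry. exact (RInt_Chasles (V := C_R_CompleteNormedModule) _ a b e (ex_vint _ _ _ _ H1) (ex_vint _ _ _ _ H2)).
Qed.

Lemma rect_split_x (f : C -> C) (a e b c d : R) :
  a <= e <= b -> c <= d -> rcont f a b c d ->
  rect_int f a b c d = (rect_int f a e c d + rect_int f e b c d)%C.
Proof.
intros He Hcd H. unfold rect_int.
rewrite (hint_chasles f a e b c), (hint_chasles f a e b d); [ring| | | |];
intros t Ht; apply between_le in Ht; try lra; apply H; lra.
Qed.

Lemma rect_split_y (f : C -> C) (a b c e d : R) :
  a <= b -> c <= e <= d -> rcont f a b c d ->
  rect_int f a b c d = (rect_int f a b c e + rect_int f a b e d)%C.
Proof.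
intros He Hcd H. unfold rect_int.
rewrite (vint_chasles f a c e d), (vint_chasles f b c e d); [ring| | | |];
intros t Ht; apply between_le in Ht; try lra; apply H; lra.
Qed.

Lemma rect_int_minus (f g : C -> C) (a b c d : R) :
  a <= b -> c <= d -> rcont f a b c d -> rcont g a b c d ->
  rect_int (fun z => f z - g z)%C a b c d = (rect_int f a b c d - rect_int g a b c d)%C.
Proof.
intros Hab Hcd Hf Hg.
assert (B1 : forall y, c <= y <= d -> hint (fun z => f z - g z)%C a b y = (hint f a b y - hint g a b y)%C).
{ intros y Hy.
  exact (RInt_minus (V := C_R_CompleteNormedModule) _ _ a b
    (ex_hint f a b y (fun t Ht => Hf t y (between_le _ _ _ Hab Ht) Hy))
    (ex_hint g a b y (fun t Ht => Hg t y (between_le _ _ _ Hab Ht) Hy))). }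
assert (B2 : forall x, a <= x <= b -> vint (fun z => f z - g z)%C x c d = (vint f x c d - vint g x c d)%C).
{ intros x Hx. unfold vint.
  rewrite (RInt_ext (V := C_R_CompleteNormedModule) _ (fun t => minus (Ci * f (x, t)) (Ci * g (x, t)))%C).
  - apply (RInt_minus (V := C_R_CompleteNormedModule)); apply ex_vint;
    intros t Ht; apply between_le in Ht; auto.
  - intros t _. change (Ci * (f (x, t) - g (x, t)) = Ci * f (x, t) - Ci * g (x, t))%C. ring. }
unfold rect_int. rewrite !B1, !B2 by lra. ring.
Qed.

Lemma hint_primitive (F f : C -> C) (a b y : R) :
  (forall t, between a b t -> Cder F (t, y) (f (t, y))) ->
  (forall t, between a b t -> Ccont f (t, y)) -> hint f a b y = (F (b, y) - F (a, y))%C.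
Proof.
intros HF Hf. apply (is_RInt_unique (V := C_R_CompleteNormedModule)).
apply (is_RInt_derive (V := C_R_CompleteNormedModule) (fun t => F (t, y))).
- intros t Ht. eapply Rder_eq.
  + apply (Rder_comp F (fun t => (t, y))); [apply HF, Ht|].
    apply (Rder_re_im _ _ (RtoC 1)); simpl; split; [apply (is_derive_id (K := R_AbsRing))|apply (is_derive_const (V := R_NormedModule))].
  + ring.
- intros t Ht. apply continuous_hor. now apply Hf.
Qed.

Lemma vint_primitive (F f : C -> C) (x c d : R) :
  (forall t, between c d t -> Cder F (x, t) (f (x, t))) ->
  (forall t, between c d t -> Ccont f (x, t)) -> vint f x c d = (F (x, d) - F (x, c))%C.
Proof.
intros HF Hf. apply (is_RInt_unique (V := C_R_CompleteNormedModule)).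
apply (is_RInt_derive (V := C_R_CompleteNormedModule) (fun t => F (x, t))).
- intros t Ht. apply (Rder_comp F (fun t => (x, t))); [apply HF, Ht|].
  apply Rder_re_im; simpl; split; [apply (is_derive_const (V := R_NormedModule))|apply (is_derive_id (K := R_AbsRing))].
- intros t Ht. apply continuous_ver. now apply Hf.
Qed.

Lemma rect_int_primitive (F f : C -> C) (a b c d : R) :
  a <= b -> c <= d -> rcont f a b c d ->
  (forall x y, a <= x <= b -> c <= y <= d -> Cder F (x, y) (f (x, y))) -> rect_int f a b c d = RtoC 0.
Proof.
intros Hab Hcd Hf HF. unfold rect_int.
rewrite !(hint_primitive F), !(vint_primitive F); [ring|..];
intros t Ht; apply between_le in Ht; try lra; first [apply HF; lra|apply Hf; lra].
Qed.

(** The bisected property is a bound by [eps * s^2], with [s] the half-perimeter. It is additive,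
    since [4 * (s / 2)^2 = s^2]. Near a point, [f] differs by at most [eps / 2 * s] from its affine
    part, which has a primitive, and the boundary has length [2 * s]. *)
Lemma goursat (f : C -> C) (a b c d : R) :
  a <= b -> c <= d ->
  (forall x y, a <= x <= b -> c <= y <= d -> @ex_derive C_AbsRing C_NormedModule f (x, y)) ->
  rect_int f a b c d = RtoC 0.
Proof.
intros Hab Hcd Hf.
assert (Hc : rcont f a b c d).
{ intros x y Hx Hy. destruct (Hf x y Hx Hy) as [l Hl]. exact (Cder_continuous _ _ _ Hl). }
assert (K : forall eps, 0 < eps -> Cmod (rect_int f a b c d) <= eps * ((b - a) + (d - c)) ^ 2).
{ intros eps He.
  apply (rect_bisection (fun a b c d => Cmod (rect_int f a b c d) <= eps * ((b - a) + (d - c)) ^ 2)); auto.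
  - intros a' b' c' d' h1 h2 h3 h4 h5 h6 E1 E2 E3 E4.
    assert (Hc' : rcont f a' b' c' d') by (intros x y Hx Hy; apply Hc; lra).
    rewrite (rect_split_x f a' ((a' + b') / 2)) by (auto; lra).
    rewrite (rect_split_y f a' _ c' ((c' + d') / 2)), (rect_split_y f _ b' c' ((c' + d') / 2));
      try lra; try (intros x y Hx Hy; apply Hc; lra).
    eapply Rle_trans; [apply Cmod_triangle|].
    eapply Rle_trans; [apply Rplus_le_compat; apply Cmod_triangle|].
    eapply Rle_trans; [exact (Rplus_le_compat _ _ _ _ (Rplus_le_compat _ _ _ _ E1 E3) (Rplus_le_compat _ _ _ _ E2 E4))|].
    right; field.
  - intros x y Hx Hy. destruct (Hf x y Hx Hy) as [l Hl].
    destruct (proj1 (Cder_eps _ _ _) Hl (eps / 2) ltac:(lra)) as [del [Hdel H]].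
    exists (del / 2). split; [lra|]. intros a' b' c' d' h1 h2 h3 h4 h5 h6 h7 h8.
    set (g := fun z : C => (f (x, y) + (z - (x, y)) * l)%C).
    assert (Hg : forall z, Ccont g z).
    { intros z. apply (Cder_continuous g z (0 + ((1 - 0) * l + (z - (x, y)) * 0))).
      apply Cder_plus; [apply Cder_const|]. apply (Cder_mult (fun z => z - (x, y))%C (fun _ => l)); [|apply Cder_const].
      apply Cder_minus; [apply Cder_id|apply Cder_const]. }
    assert (Hc' : rcont f a' b' c' d') by (intros u v Hu Hv; apply Hc; lra).
    assert (Hg' : rcont g a' b' c' d') by (intros u v Hu Hv; apply Hg).
    assert (G0 : rect_int g a' b' c' d' = RtoC 0).
    { apply rect_int_primitive with (F := fun z : C => (f (x, y) * z + (z - (x, y)) * (z - (x, y)) * (l / 2))%C); auto; try lra.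
      intros u v _ _.
      assert (W : Cder (fun z => z - (x, y))%C (u, v) (1 - 0)%C) by (apply Cder_minus; [apply Cder_id|apply Cder_const]).
      eapply Cder_eq.
      - apply Cder_plus.
        + apply (Cder_mult (fun _ => f (x, y)) (fun z => z)); [apply Cder_const|apply Cder_id].
        + apply (Cder_mult (fun z : C => (z - (x, y)) * (z - (x, y)))%C (fun _ => l / 2)%C); [|apply Cder_const].
          apply (Cder_mult (fun z => z - (x, y))%C (fun z => z - (x, y))%C); exact W.
      - unfold g. field. }
    assert (E : rect_int f a' b' c' d' = rect_int (fun z => f z - g z)%C a' b' c' d').
    { rewrite rect_int_minus, G0; auto; try lra. ring. }
    rewrite E. set (s := (b' - a') + (d' - c')).
    assert (Hs : 0 <= s) by (unfold s; lra).
    eapply Rle_trans; [apply (rect_int_bound _ a' b' c' d' (eps / 2 * s)); try lra|].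
    + intros u v Hu Hv. apply continuous_Cminus; auto.
    + intros u v Hu Hv. 
      assert (M : Cmod ((u, v) - (x, y)) <= s).
      { eapply Rle_trans; [apply Cmod_le_Rabs|]. simpl. unfold s.
        apply Rplus_le_compat; apply Rabs_le; lra. }
      replace (f (u, v) - g (u, v))%C with (f (u, v) - f (x, y) - ((u, v) - (x, y)) * l)%C by (unfold g; ring).
      eapply Rle_trans; [apply H; unfold s in M; lra|]. apply Rmult_le_compat_l; lra.
    + fold s. right; field. }
apply Cmod_eq_0. apply Rle_antisym; [|apply Cmod_ge_0].
apply le_epsilon. intros eps He. rewrite Rplus_0_l.
set (w := ((b - a) + (d - c)) ^ 2). assert (0 <= w) by apply pow2_ge_0.
eapply Rle_trans; [apply (K (eps / (1 + w)))|].
- apply Rdiv_lt_0_compat; lra.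
- fold w. apply Rle_trans with (eps / (1 + w) * (1 + w)).
  + apply Rmult_le_compat_l; [|lra]. apply Rlt_le, Rdiv_lt_0_compat; lra.
  + right; field; lra.
Qed.

Lemma rect_bounded (f : C -> C) (a b c d : R) :
  a <= b -> c <= d -> rcont f a b c d ->
  exists S, forall x y, a <= x <= b -> c <= y <= d -> Cmod (f (x, y)) <= S.
Proof.
intros Hab Hcd Hc.
apply (rect_bisection (fun a b c d => exists S, forall x y, a <= x <= b -> c <= y <= d -> Cmod (f (x, y)) <= S)); auto.
- intros a' b' c' d' h1 h2 h3 h4 h5 h6 [S1 E1] [S2 E2] [S3 E3] [S4 E4].
  exists (Rmax (Rmax S1 S2) (Rmax S3 S4)). intros x y Hx Hy.
  destruct (Rle_dec x ((a' + b') / 2)), (Rle_dec y ((c' + d') / 2)).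
  + eapply Rle_trans; [apply E1; lra|]. eapply Rle_trans; [|apply Rmax_l]. apply Rmax_l.
  + eapply Rle_trans; [apply E3; lra|]. eapply Rle_trans; [|apply Rmax_r]. apply Rmax_l.
  + eapply Rle_trans; [apply E2; lra|]. eapply Rle_trans; [|apply Rmax_l]. apply Rmax_r.
  + eapply Rle_trans; [apply E4; lra|]. eapply Rle_trans; [|apply Rmax_r]. apply Rmax_r.
- intros x y Hx Hy. destruct (proj1 (Ccont_eps _ _) (Hc x y Hx Hy) 1 Rlt_0_1) as [del [Hdel H]].
  exists (del / 2). split; [lra|]. intros a' b' c' d' h1 h2 h3 h4 h5 h6 h7 h8.
  exists (Cmod (f (x, y)) + 1). intros u v Hu Hv.
  assert (M : Cmod ((u, v) - (x, y)) < del).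
  { eapply Rle_lt_trans; [apply Cmod_le_Rabs|]. simpl.
    assert (Rabs (u + - x) <= b' - a') by (apply Rabs_le; lra).
    assert (Rabs (v + - y) <= d' - c') by (apply Rabs_le; lra). lra. }
  specialize (H _ M). replace (f (u, v)) with (f (x, y) + (f (u, v) - f (x, y)))%C by ring.
  eapply Rle_trans; [apply Cmod_triangle|]. lra.
Qed.

(** Any two points span a rectangle inside the set. Half-planes, squares and quadrants qualify, and
    any point can then serve as the base of a primitive. *)
Definition box (D : C -> Prop) : Prop :=
  @open C_UniformSpace D /\
  forall z w u : C, D z -> D w -> between (Re z) (Re w) (Re u) -> between (Im z) (Im w) (Im u) -> D u.

Lemma open_Cmod (D : C -> Prop) (z : C) :
  @open C_UniformSpace D -> D z -> exists d, 0 < d /\ forall w, Cmod (w - z) < d -> D w.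
Proof. intros H Hz. apply locally_C_Cmod. exact (H z Hz). Qed.

Lemma Cder_ext_open (D : C -> Prop) (f g : C -> C) (z l : C) :
  @open C_UniformSpace D -> D z -> (forall w, D w -> f w = g w) -> Cder f z l -> Cder g z l.
Proof.
intros HD Hz E. destruct (open_Cmod D z HD Hz) as [d [Hd H]]. apply (Cder_ext_loc f g z l d Hd).
intros w Hw; auto.
Qed.

Lemma rect_int_degenerate_x (f : C -> C) (a c d : R) : rect_int f a a c d = RtoC 0.
Proof.
unfold rect_int, hint. rewrite !(RInt_point (V := C_R_CompleteNormedModule)).
change (@zero C_R_CompleteNormedModule) with (RtoC 0). ring.
Qed.

Lemma rect_int_degenerate_y (f : C -> C) (a b c : R) : rect_int f a b c c = RtoC 0.
Proof.
unfold rect_int, vint. rewrite !(RInt_point (V := C_R_CompleteNormedModule)).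
change (@zero C_R_CompleteNormedModule) with (RtoC 0). ring.
Qed.

(** Meant for difference quotients, which are continuous at [p] but not yet known to be
    differentiable there. The rectangle is cut so that [p] lies in a piece too small to
    contribute. *)
Lemma goursat_except (f : C -> C) (p : C) (a b c d : R) :
  a <= b -> c <= d -> rcont f a b c d ->
  (forall x y, a <= x <= b -> c <= y <= d -> (x, y) <> p -> @ex_derive C_AbsRing C_NormedModule f (x, y)) ->
  rect_int f a b c d = RtoC 0.
Proof.
intros Hab Hcd Hc Hf. destruct p as [p q].
destruct (classic (a <= p <= b /\ c <= q <= d)) as [[Hp Hq]|Hout].
2: { apply goursat; auto. intros x y Hx Hy. apply Hf; auto. intros E; injection E; intros; subst. tauto. }
destruct (rect_bounded f a b c d Hab Hcd Hc) as [S HS].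
assert (S0 : 0 <= S) by (eapply Rle_trans; [apply Cmod_ge_0|apply (HS a c); lra]).
apply Cmod_eq_0. apply Rle_antisym; [|apply Cmod_ge_0].
apply le_epsilon. intros eps He. rewrite Rplus_0_l.
(* The middle piece has half-perimeter at most [4 * h], and this [h] turns [2 * (4 * h) * (S + 1)]
   into [eps]. *)
set (h := eps / (8 * (S + 1))).
assert (Hh : 0 < h) by (apply Rdiv_lt_0_compat; lra).
(* Each cut either falls on the original side, which makes the outer piece degenerate, or is
   strictly separated from [p], so that plain Goursat applies to the outer piece. *)
assert (K1 : exists a1, a <= a1 <= p /\ p - h <= a1 /\ (a1 = a \/ a1 < p)).
{ destruct (Rle_dec a (p - h)); [exists (p - h)|exists a]; repeat split; try lra; auto; right; lra. }
assert (K2 : exists b1, p <= b1 <= b /\ b1 <= p + h /\ (b1 = b \/ p < b1)).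
{ destruct (Rle_dec (p + h) b); [exists (p + h)|exists b]; repeat split; try lra; auto; right; lra. }
assert (K3 : exists c1, c <= c1 <= q /\ q - h <= c1 /\ (c1 = c \/ c1 < q)).
{ destruct (Rle_dec c (q - h)); [exists (q - h)|exists c]; repeat split; try lra; auto; right; lra. }
assert (K4 : exists d1, q <= d1 <= d /\ d1 <= q + h /\ (d1 = d \/ q < d1)).
{ destruct (Rle_dec (q + h) d); [exists (q + h)|exists d]; repeat split; try lra; auto; right; lra. }
destruct K1 as (a1 & A1 & A2 & A3), K2 as (b1 & B1 & B2 & B3), K3 as (c1 & C1 & C2 & C3), K4 as (d1 & D1 & D2 & D3).
rewrite (rect_split_x f a a1 b) by (auto; lra).
rewrite (rect_split_x f a1 b1 b); [|lra|lra|intros x y ? ?; apply Hc; lra].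
rewrite (rect_split_y f a1 b1 c c1 d); [|lra|lra|intros x y ? ?; apply Hc; lra].
rewrite (rect_split_y f a1 b1 c1 d1 d); [|lra|lra|intros x y ? ?; apply Hc; lra].
assert (Z1 : rect_int f a a1 c d = RtoC 0).
{ destruct A3 as [->|A3]; [apply rect_int_degenerate_x|]. apply goursat; try lra.
  intros x y Hx Hy; apply Hf; try lra. intros E; injection E; lra. }
assert (Z2 : rect_int f b1 b c d = RtoC 0).
{ destruct B3 as [->|B3]; [apply rect_int_degenerate_x|]. apply goursat; try lra.
  intros x y Hx Hy; apply Hf; try lra. intros E; injection E; lra. }
assert (Z3 : rect_int f a1 b1 c c1 = RtoC 0).
{ destruct C3 as [->|C3]; [apply rect_int_degenerate_y|]. apply goursat; try lra.
  intros x y Hx Hy; apply Hf; try lra. intros E; injection E; lra. }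
assert (Z4 : rect_int f a1 b1 d1 d = RtoC 0).
{ destruct D3 as [->|D3]; [apply rect_int_degenerate_y|]. apply goursat; try lra.
  intros x y Hx Hy; apply Hf; try lra. intros E; injection E; lra. }
rewrite Z1, Z2, Z3, Z4.
replace (0 + (0 + (rect_int f a1 b1 c1 d1 + 0) + 0))%C with (rect_int f a1 b1 c1 d1) by ring.
eapply Rle_trans; [apply (rect_int_bound f a1 b1 c1 d1 S); try lra|].
- intros x y ? ?; apply Hc; lra.
- intros x y ? ?; apply HS; lra.
- apply Rle_trans with (2 * (4 * h) * (S + 1)).
  + apply Rmult_le_compat; lra.
  + unfold h. right. field. lra.
Qed.

Lemma between_sym a b x : between a b x -> between b a x.
Proof. unfold between. rewrite Rmin_comm, Rmax_comm. auto. Qed.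

Lemma hint_swap (f : C -> C) (a b y : R) :
  (forall t, between a b t -> Ccont f (t, y)) -> hint f b a y = (- hint f a b y)%C.
Proof. intros H. symmetry. exact (opp_RInt_swap (V := C_R_CompleteNormedModule) _ a b (ex_hint _ _ _ _ H)). Qed.

Lemma vint_swap (f : C -> C) (x c d : R) :
  (forall t, between c d t -> Ccont f (x, t)) -> vint f x d c = (- vint f x c d)%C.
Proof. intros H. symmetry. exact (opp_RInt_swap (V := C_R_CompleteNormedModule) _ c d (ex_vint _ _ _ _ H)). Qed.

(** Reversing the order of [a, b] or of [c, d] only changes the sign; the base point of a primitive
    can thus be any corner of the rectangle. *)
Lemma goursat_signed (f : C -> C) (p : C) (a b c d : R) :
  (forall x y, between a b x -> between c d y -> Ccont f (x, y)) ->
  (forall x y, between a b x -> between c d y -> (x, y) <> p -> @ex_derive C_AbsRing C_NormedModule f (x, y)) ->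
  rect_int f a b c d = RtoC 0.
Proof.
assert (H1 : forall a b c d, a <= b ->
  (forall x y, between a b x -> between c d y -> Ccont f (x, y)) ->
  (forall x y, between a b x -> between c d y -> (x, y) <> p -> @ex_derive C_AbsRing C_NormedModule f (x, y)) ->
  rect_int f a b c d = RtoC 0).
{ clear a b c d; intros a b c d Hab Hc Hd.
  assert (E : forall c d, c <= d -> (forall x y, between a b x -> between c d y -> Ccont f (x, y)) ->
  (forall x y, between a b x -> between c d y -> (x, y) <> p -> @ex_derive C_AbsRing C_NormedModule f (x, y)) ->
  rect_int f a b c d = RtoC 0).
  { clear c d Hc Hd; intros c d Hcd Hc Hd. apply (goursat_except f p); auto.
    - intros x y Hx Hy; apply Hc; unfold between; rewrite Rmin_left, Rmax_right; lra.
    - intros x y Hx Hy; apply Hd; unfold between; rewrite Rmin_left, Rmax_right; lra. }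
  assert (Ba : between a b a) by (unfold between; rewrite Rmin_left, Rmax_right; lra).
  assert (Bb : between a b b) by (unfold between; rewrite Rmin_left, Rmax_right; lra).
  destruct (Rle_dec c d) as [Hcd|Hcd]; [now apply E|].
  assert (Hdc : d <= c) by lra.
  assert (E2 := E d c Hdc (fun x y Hx Hy => Hc x y Hx (between_sym _ _ _ Hy)) (fun x y Hx Hy => Hd x y Hx (between_sym _ _ _ Hy))).
  transitivity (- rect_int f a b d c)%C; [|rewrite E2; ring].
  unfold rect_int. rewrite (vint_swap f b c d), (vint_swap f a c d); auto. ring. }
intros Hc Hd. destruct (Rle_dec a b) as [Hab|Hab]; [now apply H1|].
assert (Hba : b <= a) by lra.
assert (E2 := H1 b a c d Hba (fun x y Hx Hy => Hc x y (between_sym _ _ _ Hx) Hy) (fun x y Hx Hy => Hd x y (between_sym _ _ _ Hx) Hy)).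
assert (Bc : between c d c) by (unfold between; split; [apply Rmin_l|apply Rmax_l]).
assert (Bd : between c d d) by (unfold between; split; [apply Rmin_r|apply Rmax_r]).
transitivity (- rect_int f b a c d)%C; [|rewrite E2; ring].
unfold rect_int. rewrite (hint_swap f a b c), (hint_swap f a b d); auto. ring.
Qed.

Lemma CInt_bound_signed (f : R -> C) (a b S : R) :
  (forall t, between a b t -> Cmod (f t) <= S) -> ex_CInt f a b -> Cmod (CInt f a b) <= Rabs (b - a) * S.
Proof.
intros HS Hex. destruct (Rle_dec a b) as [Hab|Hab].
- rewrite Rabs_right by lra. apply CInt_bound; auto. intros t Ht; apply HS. unfold between. rewrite Rmin_left, Rmax_right; lra.
- rewrite <- (opp_RInt_swap (V := C_R_CompleteNormedModule)) by (now apply ex_RInt_swap).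
  change (Cmod (- CInt f b a) <= Rabs (b - a) * S). rewrite Cmod_opp, Rabs_left by lra.
  replace (- (b - a)) with (a - b) by ring. apply CInt_bound; [lra| |now apply ex_RInt_swap].
  intros t Ht; apply HS. unfold between. rewrite Rmin_right, Rmax_left; lra.
Qed.

Lemma hint_near (f : C -> C) (k : C) (a b y e : R) :
  (forall t, between a b t -> Ccont f (t, y)) -> (forall t, between a b t -> Cmod (f (t, y) - k) <= e) ->
  Cmod (hint f a b y - RtoC (b - a) * k) <= Rabs (b - a) * e.
Proof.
intros Hc He.
assert (Hk : forall t, between a b t -> Ccont (fun _ => k) (t, y)) by (intros; apply continuous_const).
assert (E : (hint f a b y - RtoC (b - a) * k)%C = CInt (fun t => f (t, y) - k)%C a b).
{ transitivity (hint f a b y - hint (fun _ => k) a b y)%C.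
  - rewrite (hint_primitive (fun z => k * z)%C (fun _ => k)); auto.
    + apply f_equal. apply injective_projections; simpl; ring.
    + intros t _. eapply Cder_eq; [apply (Cder_mult (fun _ => k) (fun z => z)); [apply Cder_const|apply Cder_id]|ring].
  - symmetry. exact (RInt_minus (V := C_R_CompleteNormedModule) _ _ a b (ex_hint f a b y Hc) (ex_hint _ a b y Hk)). }
rewrite E. apply CInt_bound_signed; auto.
apply ex_RInt_continuous. intros t Ht. apply continuous_Cminus; [apply continuous_hor; auto|apply continuous_const].
Qed.

Lemma vint_near (f : C -> C) (k : C) (x c d e : R) :
  (forall t, between c d t -> Ccont f (x, t)) -> (forall t, between c d t -> Cmod (f (x, t) - k) <= e) ->
  Cmod (vint f x c d - RtoC (d - c) * (Ci * k)) <= Rabs (d - c) * e.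
Proof.
intros Hc He.
assert (Hk : forall t, between c d t -> Ccont (fun _ => k) (x, t)) by (intros; apply continuous_const).
assert (E : (vint f x c d - RtoC (d - c) * (Ci * k))%C = CInt (fun t => Ci * f (x, t) - Ci * k)%C c d).
{ transitivity (vint f x c d - vint (fun _ => k) x c d)%C.
  - rewrite (vint_primitive (fun z => k * z)%C (fun _ => k)); auto.
    + apply f_equal. apply injective_projections; simpl; ring.
    + intros t _. eapply Cder_eq; [apply (Cder_mult (fun _ => k) (fun z => z)); [apply Cder_const|apply Cder_id]|ring].
  - symmetry. exact (RInt_minus (V := C_R_CompleteNormedModule) _ _ c d (ex_vint f x c d Hc) (ex_vint _ x c d Hk)). }
rewrite E. apply CInt_bound_signed; auto.
- intros t Ht. replace (Ci * f (x, t) - Ci * k)%C with (Ci * (f (x, t) - k))%C by ring.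
  rewrite Cmod_mult, Cmod_Ci, Rmult_1_l. auto.
- apply ex_RInt_continuous. intros t Ht. apply continuous_Cminus; [apply continuous_ver; auto|apply continuous_const].
Qed.

Lemma between_l a b : between a b a.
Proof. split; [apply Rmin_l|apply Rmax_l]. Qed.
Lemma between_r a b : between a b b.
Proof. split; [apply Rmin_r|apply Rmax_r]. Qed.

Lemma between_Rabs a b x : between a b x -> Rabs (x - a) <= Rabs (b - a).
Proof.
intros [H1 H2]. destruct (Rle_dec a b).
- rewrite Rmin_left in H1 by lra. rewrite Rmax_right in H2 by lra. rewrite !Rabs_right; lra.
- rewrite Rmin_right in H1 by lra. rewrite Rmax_left in H2 by lra. rewrite !Rabs_left1; lra.
Qed.

(** Only the rectangles with one corner at [p] are required. Unlike [box], this admits the discs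
    centred at [p]. *)
Definition rstar (p : C) (D : C -> Prop) : Prop :=
  @open C_UniformSpace D /\ D p /\
  forall w u : C, D w -> between (Re p) (Re w) (Re u) -> between (Im p) (Im w) (Im u) -> D u.

Lemma box_rstar (D : C -> Prop) (p : C) : box D -> D p -> rstar p D.
Proof. intros [HO HB] Hp. repeat split; auto. intros w u; now apply HB. Qed.

(** [F] integrates from [p] first horizontally, then vertically. Goursat's lemma on the rectangle
    spanned by [p] and the point allows the opposite order, so that both horizontal and vertical
    increments of [F] are single integrals of [f]. The exceptional point is [p] itself, for the sake
    of [dq f p]. *)
Lemma rstar_primitive (D : C -> Prop) (f : C -> C) (p : C) :
  rstar p D -> (forall z, D z -> Ccont f z) ->
  (forall z, D z -> z <> p -> @ex_derive C_AbsRing C_NormedModule f z) ->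
  exists F, forall z, D z -> Cder F z (f z).
Proof.
intros (HO & Hp & HB) Hc Hd. destruct p as [p q].
exists (fun z => hint f p (Re z) q + vint f (Re z) q (Im z))%C.
set (F := fun z : C => (hint f p (Re z) q + vint f (Re z) q (Im z))%C).
assert (HR : forall x y x' y', D (x, y) -> between p x x' -> between q y y' -> D (x', y')).
{ intros x y x' y' H h1 h2. exact (HB (x, y) (x', y') H h1 h2). }
assert (HF : forall x y, D (x, y) -> F (x, y) = (vint f p q y + hint f p x y)%C).
{ intros x y Hxy. assert (G : rect_int f p x q y = RtoC 0).
  { apply (goursat_signed f (p, q)); intros x' y' Hx Hy; [apply Hc|apply Hd]; eapply HR; eauto. }
  unfold rect_int in G. unfold F; simpl.
  replace (hint f p x q + vint f x q y)%C with
   ((hint f p x q + vint f x q y - hint f p x y - vint f p q y) + (vint f p q y + hint f p x y))%C by ring.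
  rewrite G. ring. }
intros [x y] Hz. apply Cder_eps. intros eps He.
destruct (open_Cmod D (x, y) HO Hz) as [d1 [Hd1 H1]].
destruct (proj1 (Ccont_eps _ _) (Hc _ Hz) (eps / 2) ltac:(lra)) as [d2 [Hd2 H2]].
exists (Rmin d1 d2 / 2). assert (M0 : 0 < Rmin d1 d2) by (now apply Rmin_pos).
split; [lra|]. intros [x' y'] Hw. fold (F (x', y')). fold (F (x, y)).
set (m := Cmod ((x', y') - (x, y))) in *.
assert (m1 : Rabs (x' - x) <= m) by (apply (re_le_Cmod ((x', y') - (x, y)))).
assert (m2 : Rabs (y' - y) <= m) by (apply (im_le_Cmod ((x', y') - (x, y)))).
assert (N : forall u v, between x x' u -> between y y' v -> Cmod ((u, v) - (x, y)) < Rmin d1 d2).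
{ intros u v Hu Hv. eapply Rle_lt_trans; [apply Cmod_le_Rabs|]. simpl.
  apply between_Rabs in Hu. apply between_Rabs in Hv. unfold Rminus in *. lra. }
assert (ND : forall u v, between x x' u -> between y y' v -> D (u, v)).
{ intros u v Hu Hv. apply H1. eapply Rlt_le_trans; [apply N; auto|apply Rmin_l]. }
assert (NE : forall u v, between x x' u -> between y y' v -> Cmod (f (u, v) - f (x, y)) <= eps / 2).
{ intros u v Hu Hv. apply Rlt_le, H2. eapply Rlt_le_trans; [apply N; auto|apply Rmin_r]. }
assert (Dxy' : D (x, y')) by (apply ND; [apply between_l|apply between_r]).
assert (Dx'y' : D (x', y')) by (apply ND; apply between_r).
assert (E1 : F (x', y') = (F (x, y') + hint f x x' y')%C).
{ rewrite !HF by auto. rewrite (hint_chasles f p x x' y').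
  - ring.
  - intros t Ht. apply Hc. apply (HR x y'); auto. apply between_r.
  - intros t Ht. apply Hc. apply ND; auto. apply between_r. }
assert (E2 : F (x, y') = (F (x, y) + vint f x y y')%C).
{ unfold F; simpl. rewrite (vint_chasles f x q y y').
  - ring.
  - intros t Ht. apply Hc. apply (HR x y); auto. apply between_r.
  - intros t Ht. apply Hc. apply ND; auto. apply between_l. }
rewrite E1, E2.
replace (F (x, y) + vint f x y y' + hint f x x' y' - F (x, y) - ((x', y') - (x, y)) * f (x, y))%C with
  ((hint f x x' y' - RtoC (x' - x) * f (x, y)) + (vint f x y y' - RtoC (y' - y) * (Ci * f (x, y))))%C.
2: { replace ((x', y') - (x, y))%C with (RtoC (x' - x) + RtoC (y' - y) * Ci)%C
      by (apply injective_projections; simpl; ring). ring. }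
eapply Rle_trans; [apply Cmod_triangle|].
assert (B1 := hint_near f (f (x, y)) x x' y' (eps / 2)
  (fun t Ht => Hc _ (ND t y' Ht (between_r _ _))) (fun t Ht => NE t y' Ht (between_r _ _))).
assert (B2 := vint_near f (f (x, y)) x y y' (eps / 2)
  (fun t Ht => Hc _ (ND x t (between_l _ _) Ht)) (fun t Ht => NE x t (between_l _ _) Ht)).
nra.
Qed.

(** * Cauchy's integral formula *)

(** The integral is that of a real vector space while [k] is complex; differentiation in the upper
    limit makes up the difference. *)
Lemma CInt_scal (f : R -> C) (k : C) (a b : R) :
  (forall t, Rcont f t) -> CInt (fun t => k * f t)%C a b = (k * CInt f a b)%C.
Proof.
intros Hf.
assert (Hex : forall u v, ex_CInt f u v) by (intros; apply ex_RInt_continuous; auto).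
transitivity (k * CInt f a b - k * CInt f a a)%C.
- apply (is_RInt_unique (V := C_R_CompleteNormedModule)).
  apply (is_RInt_derive (V := C_R_CompleteNormedModule) (fun t => k * CInt f a t)%C).
  + intros t _. apply Rder_scal.
      apply (is_derive_RInt (V := C_R_NormedModule) f _ a t); [|apply Hf].
      apply filter_forall. intros u. apply (RInt_correct (V := C_R_CompleteNormedModule)). apply Hex.
  + intros t _. apply continuous_Cmult; [apply continuous_const|apply Hf].
- rewrite (RInt_point (V := C_R_CompleteNormedModule)).
  change (@zero C_R_CompleteNormedModule) with (RtoC 0). ring.
Qed.

Lemma CInt_ext (f g : R -> C) (a b : R) : (forall t, f t = g t) -> CInt f a b = CInt g a b.
Proof. intros E. apply (RInt_ext (V := C_R_CompleteNormedModule)). intros t _. apply E. Qed.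

Lemma CInt_minus (f g : R -> C) (a b : R) :
  (forall t, Rcont f t) -> (forall t, Rcont g t) ->
  CInt (fun t => f t - g t)%C a b = (CInt f a b - CInt g a b)%C.
Proof.
intros Hf Hg.
exact (RInt_minus (V := C_R_CompleteNormedModule) f g a b
  (ex_RInt_continuous (V := C_R_CompleteNormedModule) f a b (fun t _ => Hf t))
  (ex_RInt_continuous (V := C_R_CompleteNormedModule) g a b (fun t _ => Hg t))).
Qed.

Lemma CInt_derive (F f : R -> C) (a b : R) :
  (forall t, Rder F t (f t)) -> (forall t, Rcont f t) -> CInt f a b = (F b - F a)%C.
Proof.
intros HF Hf. apply (is_RInt_unique (V := C_R_CompleteNormedModule)).
apply (is_RInt_derive (V := C_R_CompleteNormedModule) F f a b); auto.
Qed.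

Lemma CInt_const (k : C) (a b : R) : CInt (fun _ => k) a b = (RtoC (b - a) * k)%C.
Proof.
rewrite (CInt_derive (fun t => RtoC t * k)%C).
- rewrite RtoC_minus. ring.
- intros t. eapply Rder_eq.
  + apply (Rder_mult (fun t => RtoC t) (fun _ => k)); [|apply Rder_const].
    apply (Rder_RtoC (fun t => t)). apply (is_derive_id (K := R_AbsRing)).
  + change (@one R_AbsRing) with 1. ring.
- intros t. apply continuous_const.
Qed.

Definition circ (z0 : C) (r t : R) : C := (z0 + RtoC r * Cexp (Ci * RtoC t))%C.
Definition dcirc (r t : R) : C := (Ci * (RtoC r * Cexp (Ci * RtoC t)))%C.

Lemma Rder_circ (z0 : C) (r t : R) : Rder (circ z0 r) t (dcirc r t).
Proof.
unfold circ, dcirc. eapply Rder_eq.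
- apply Rder_plus; [apply Rder_const|].
  apply (Rder_mult (fun _ => RtoC r) (fun t => Cexp (Ci * RtoC t))); [apply Rder_const|].
  apply (Rder_comp Cexp (fun t => Ci * RtoC t)%C); [apply Cder_Cexp|].
  apply (Rder_mult (fun _ => Ci) (fun t => RtoC t)); [apply Rder_const|].
  apply (Rder_RtoC (fun t => t)). apply (is_derive_id (K := R_AbsRing)).
- change (@one R_AbsRing) with 1. ring.
Qed.

Lemma Rcont_circ (z0 : C) (r t : R) : Rcont (circ z0 r) t.
Proof. eapply Rder_continuous, Rder_circ. Qed.

Lemma dcirc_circ (z0 : C) (r t : R) : dcirc r t = (Ci * (circ z0 r t - z0))%C.
Proof. unfold dcirc, circ. ring. Qed.

Lemma Rcont_dcirc (r t : R) : Rcont (dcirc r) t.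
Proof.
apply (continuous_ext (fun t => Ci * (circ 0 r t - 0))%C).
- intros s. symmetry. apply dcirc_circ.
- apply continuous_Cmult; [apply continuous_const|]. apply continuous_Cminus; [apply Rcont_circ|apply continuous_const].
Qed.

Lemma Cmod_circ (z0 : C) (r t : R) : 0 <= r -> Cmod (circ z0 r t - z0) = r.
Proof.
intros Hr. unfold circ. replace (z0 + RtoC r * Cexp (Ci * RtoC t) - z0)%C with (RtoC r * Cexp (Ci * RtoC t))%C by ring.
rewrite Cmod_mult, Cmod_R, Cmod_Cexp. replace (Re (Ci * RtoC t)) with 0 by (simpl; ring).
rewrite exp_0, Rabs_right; lra.
Qed.

Lemma circ_2PI (z0 : C) (r : R) : circ z0 r (2 * PI) = circ z0 r 0.
Proof.
unfold circ. replace (Ci * RtoC (2 * PI))%C with (Ci * RtoC 0 + RtoC (2 * PI) * Ci)%C by ring.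
now rewrite Cexp_2PI.
Qed.

Lemma circle_integral_primitive (F f : C -> C) (z0 : C) (r : R) :
  0 <= r ->
  (forall z, Cmod (z - z0) = r -> Cder F z (f z)) -> (forall z, Cmod (z - z0) = r -> Ccont f z) ->
  CInt (fun t => dcirc r t * f (circ z0 r t))%C 0 (2 * PI) = RtoC 0.
Proof.
intros Hr HF Hf. rewrite (CInt_derive (fun t => F (circ z0 r t))).
- rewrite circ_2PI. ring.
- intros t. apply Rder_comp; [|apply Rder_circ]. apply HF. now apply Cmod_circ.
- intros t. apply continuous_Cmult; [apply Rcont_dcirc|].
  apply (continuous_comp (circ z0 r) f); [apply Rcont_circ|]. apply Hf. now apply Cmod_circ.
Qed.

Lemma Rcont_bounded (h : R -> C) (a b : R) : a <= b -> (forall t, Rcont h t) ->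
  exists S, forall t, a <= t <= b -> Cmod (h t) <= S.
Proof.
intros Hab Hh.
(* The curve is read as a function on a rectangle of height zero. *)
destruct (rect_bounded (fun z => h (Re z)) a b 0 0) as [S HS]; try lra.
- intros x y _ _. apply (continuous_comp (fun z : C_UniformSpace => Re z) h); [apply continuous_fst|apply Hh].
- exists S. intros t Ht. apply (HS t 0); lra.
Qed.

Lemma Cmod_triangle_inv (x y : C) : Cmod x - Cmod y <= Cmod (x - y).
Proof.
assert (H := Cmod_triangle (x - y) y). replace (x - y + y)%C with x in H by ring. lra.
Qed.

Lemma Cmod_sub_sym (x y : C) : Cmod (x - y) = Cmod (y - x).
Proof. rewrite <- Cmod_opp. f_equal. ring. Qed.

(** The Cauchy transform without the factor [1 / (2 pi i)]. The density [h] already contains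
    [dcirc], so one differentiation under the integral sign serves every density. *)
Definition cauchy_int (h : R -> C) (z0 : C) (r : R) (n : nat) (z : C) : C :=
  CInt (fun t => h t * / (circ z0 r t - z) ^ n)%C 0 (2 * PI).

Lemma circ_sub_lower (z0 : C) (r t : R) (z : C) : 0 <= r -> r - Cmod (z - z0) <= Cmod (circ z0 r t - z).
Proof.
intros Hr. replace (circ z0 r t - z)%C with ((circ z0 r t - z0) - (z - z0))%C by ring.
rewrite <- (Cmod_circ z0 r t Hr) at 1. apply Cmod_triangle_inv.
Qed.

Lemma circ_sub_neq0 (z0 : C) (r t : R) (z : C) : Cmod (z - z0) < r -> (circ z0 r t - z)%C <> RtoC 0.
Proof.
intros H. apply Cmod_gt_0. assert (P := Cmod_ge_0 (z - z0)).
eapply Rlt_le_trans; [|apply circ_sub_lower]; lra.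
Qed.

Lemma Rcont_Cinv (f : R -> C) (t : R) : Rcont f t -> f t <> RtoC 0 -> Rcont (fun s => / f s)%C t.
Proof.
intros Hf H0. apply (continuous_comp f Cinv); [exact Hf|]. eapply Cder_continuous, Cder_inv, H0.
Qed.

Lemma Rcont_cauchy (h : R -> C) (z0 : C) (r : R) (n : nat) (z : C) (t : R) :
  (forall t, Rcont h t) -> Cmod (z - z0) < r -> Rcont (fun t => h t * / (circ z0 r t - z) ^ n)%C t.
Proof.
intros Hh Hz. apply continuous_Cmult; [apply Hh|].
apply (Rcont_Cinv (fun t => (circ z0 r t - z) ^ n)%C); [|now apply Cpow_nz, circ_sub_neq0].
induction n as [|n IH]; [apply continuous_const|].
apply (continuous_Cmult _ (fun t => circ z0 r t - z)%C (fun t => (circ z0 r t - z) ^ n)%C); [|exact IH].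
apply continuous_Cminus; [apply Rcont_circ|apply continuous_const].
Qed.

(* Only the first two powers are needed: they give f' and the existence of f''. *)
Lemma Cder_cauchy_int (h : R -> C) (z0 : C) (r : R) (n : nat) (z : C) :
  (forall t, Rcont h t) -> n = 1%nat \/ n = 2%nat -> Cmod (z - z0) < r ->
  Cder (cauchy_int h z0 r n) z (RtoC (INR n) * cauchy_int h z0 r (S n) z)%C.
Proof.
intros Hh Hn Hz. assert (Hr : 0 < r) by (eapply Rle_lt_trans; [apply Cmod_ge_0|exact Hz]).
assert (P2 := PI_RGT_0).
destruct (Rcont_bounded h 0 (2 * PI)) as [H HH]; [lra|exact Hh|].
assert (H0 : 0 <= H) by (eapply Rle_trans; [apply Cmod_ge_0|apply (HH 0); lra]).
set (d := r - Cmod (z - z0)). assert (Hd : 0 < d) by (unfold d; lra).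
(* Second-order Taylor remainder of the inverse power, used with [u = circ z0 r t - z] and
   [v = circ z0 r t - w]; then [u - v = w - z], and [d] bounds the distance from [z] to the circle
   from below. *)
assert (Q : exists K, 0 <= K /\ forall u v : C, u <> RtoC 0 -> v <> RtoC 0 -> d <= Cmod u -> d / 2 <= Cmod v -> 
   Cmod (/ v ^ n - / u ^ n - (u - v) * (RtoC (INR n) * / u ^ (S n))) <= K * Cmod (u - v) ^ 2).
{ assert (IB : forall w e, 0 < e -> e <= Cmod w -> Cmod (/ w) <= / e).
  { intros w e He Hw. rewrite Cmod_inv by (apply Cmod_gt_0; lra). apply Rinv_le_contravar; lra. }
  destruct Hn as [->| ->].
  - exists (/ (d / 2) * (/ d * / d)). split.
    { repeat apply Rmult_le_pos; apply Rlt_le, Rinv_0_lt_compat; lra. }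
    intros u v Hu Hv Lu Lv.
    replace (/ v ^ 1 - / u ^ 1 - (u - v) * (RtoC (INR 1) * / u ^ 2))%C with ((u - v) ^ 2 * (/ v * (/ u * / u)))%C.
    2: { simpl INR. field. auto. }
    rewrite Cmod_mult, Cmod_pow, Rmult_comm. apply Rmult_le_compat_r; [apply pow2_ge_0|].
    rewrite !Cmod_mult. apply Rmult_le_compat; try (repeat apply Rmult_le_pos; apply Cmod_ge_0); [apply IB; lra|].
    apply Rmult_le_compat; try apply Cmod_ge_0; apply IB; lra.
  - exists (/ (d / 2) * (/ (d / 2) * / d * / d) + 2 * (/ (d / 2) * / d * / d * / d)). split.
    { assert (I1 : 0 < / d) by (apply Rinv_0_lt_compat; lra). assert (I2 : 0 < / (d / 2)) by (apply Rinv_0_lt_compat; lra).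
      apply Rlt_le, Rplus_lt_0_compat; repeat apply Rmult_lt_0_compat; lra. }
    intros u v Hu Hv Lu Lv.
    replace (/ v ^ 2 - / u ^ 2 - (u - v) * (RtoC (INR 2) * / u ^ 3))%C with
     ((u - v) ^ 2 * (/ v * (/ v * / u * / u) + RtoC 2 * (/ v * / u * / u * / u)))%C.
    2: { simpl INR. replace (1 + 1)%R with 2 by ring. field. auto. }
    rewrite Cmod_mult, Cmod_pow, Rmult_comm. apply Rmult_le_compat_r; [apply pow2_ge_0|].
    eapply Rle_trans; [apply Cmod_triangle|]. rewrite !Cmod_mult, Cmod_R, Rabs_right by lra.
    assert (Iu := IB u d Hd Lu). assert (Iv := IB v (d / 2) ltac:(lra) Lv).
    assert (Nu := Cmod_ge_0 (/ u)). assert (Nv := Cmod_ge_0 (/ v)).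
    apply Rplus_le_compat; [|apply Rmult_le_compat_l; [lra|]]; repeat (apply Rmult_le_compat; try (repeat apply Rmult_le_pos; assumption); try assumption). }
destruct Q as [K [HK0 HK]].
apply Cder_eps. intros eps He.
set (L := 2 * PI * (H * K)). assert (L0 : 0 <= L) by (unfold L; apply Rmult_le_pos; [lra|now apply Rmult_le_pos]).
exists (Rmin (d / 2) (eps / (1 + L))). split; [apply Rmin_pos; [lra|apply Rdiv_lt_0_compat; lra]|].
intros w Hw.
assert (W1 := Rlt_le_trans _ _ _ Hw (Rmin_l _ _)). assert (W2 := Rlt_le_trans _ _ _ Hw (Rmin_r _ _)).
assert (Hwr : Cmod (w - z0) < r).
{ replace (w - z0)%C with ((w - z) + (z - z0))%C by ring. eapply Rle_lt_trans; [apply Cmod_triangle|]. unfold d in *; lra. }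
set (g := fun t => (h t * (/ (circ z0 r t - w) ^ n - / (circ z0 r t - z) ^ n - (w - z) * (RtoC (INR n) * / (circ z0 r t - z) ^ (S n))))%C).
set (A := fun t => (h t * / (circ z0 r t - w) ^ n)%C). set (B := fun t => (h t * / (circ z0 r t - z) ^ n)%C).
set (E := fun t => (h t * / (circ z0 r t - z) ^ (S n))%C).
assert (cA : forall t, Rcont A t) by (intros t; apply Rcont_cauchy; auto).
assert (cB : forall t, Rcont B t) by (intros t; apply Rcont_cauchy; auto).
assert (cE : forall t, Rcont E t) by (intros t; apply Rcont_cauchy; auto).
assert (cE' : forall t, Rcont (fun t => (w - z) * RtoC (INR n) * E t)%C t).
{ intros t; apply continuous_Cmult; [apply continuous_const|apply cE]. }
assert (cAB : forall t, Rcont (fun t => A t - B t)%C t) by (intros t; apply continuous_Cminus; auto).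
assert (EG : (cauchy_int h z0 r n w - cauchy_int h z0 r n z - (w - z) * (RtoC (INR n) * cauchy_int h z0 r (S n) z))%C = CInt g 0 (2 * PI)).
{ unfold cauchy_int. fold A. fold B. fold E.
  rewrite (CInt_ext g (fun t => A t - B t - (w - z) * RtoC (INR n) * E t)%C).
  - rewrite CInt_minus, CInt_minus, CInt_scal; auto. ring.
  - intros t. unfold g, A, B, E. ring. }
rewrite EG.
eapply Rle_trans; [apply (CInt_bound g 0 (2 * PI) (H * (K * Cmod (w - z) ^ 2)))|].
- lra.
- intros t Ht. unfold g. rewrite Cmod_mult. apply Rmult_le_compat; try apply Cmod_ge_0; auto.
  replace (w - z)%C with ((circ z0 r t - z) - (circ z0 r t - w))%C by ring.
  assert (L1 := circ_sub_lower z0 r t z ltac:(lra)). assert (L2 := circ_sub_lower z0 r t w ltac:(lra)).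
  apply HK; try (apply circ_sub_neq0; auto); [exact L1|].
  assert (Cmod (w - z0) <= Cmod (w - z) + Cmod (z - z0)).
  { replace (w - z0)%C with ((w - z) + (z - z0))%C by ring. apply Cmod_triangle. }
  unfold d in *; lra.
- apply ex_RInt_continuous. intros t _.
  apply (continuous_ext (fun t => A t - B t - (w - z) * RtoC (INR n) * E t)%C).
  + intros s. change ((A s - B s - (w - z) * RtoC (INR n) * E s)%C = g s). unfold g, A, B, E. ring.
  + apply continuous_Cminus; auto.
- replace ((2 * PI - 0) * (H * (K * Cmod (w - z) ^ 2))) with (L * Cmod (w - z) * Cmod (w - z)) by (unfold L; ring).
  apply Rmult_le_compat_r; [apply Cmod_ge_0|].
  apply Rlt_le in W2. apply (Rmult_le_compat_l (1 + L)) in W2; [|lra].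
  replace ((1 + L) * (eps / (1 + L))) with eps in W2 by (field; lra).
  assert (N := Cmod_ge_0 (w - z)). nra.
Qed.

Lemma two_PI_i_neq0 : (RtoC (2 * PI) * Ci)%C <> RtoC 0.
Proof. intros E. apply (f_equal Cmod) in E. rewrite Cmod_mult, Cmod_R, Cmod_Ci, Cmod_0 in E.
generalize PI_RGT_0. rewrite Rabs_right in E; generalize PI_RGT_0; lra. Qed.

(** At the centre the integrand is the constant [Ci]. The derivative in [z] is the integral of
    [1 / (u - z)^2], which has the primitive [- 1 / (u - z)] and so vanishes. No winding number is
    involved. *)
Lemma cauchy_int_one (z0 : C) (r : R) (z : C) : Cmod (z - z0) < r ->
  cauchy_int (dcirc r) z0 r 1 z = (RtoC (2 * PI) * Ci)%C.
Proof.
intros Hz. assert (P := Cmod_ge_0 (z - z0)).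
assert (Hr : 0 < r) by lra.
assert (H0 : cauchy_int (dcirc r) z0 r 1 z0 = (RtoC (2 * PI) * Ci)%C).
{ unfold cauchy_int. rewrite (CInt_ext _ (fun _ => Ci)).
  - now rewrite CInt_const, Rminus_0_r.
  - intros t. rewrite (dcirc_circ z0). field. simpl.
    apply circ_sub_neq0. replace (z0 - z0)%C with (RtoC 0) by ring. rewrite Cmod_0; lra. }
rewrite <- H0.
assert (Z2 : forall w, Cmod (w - z0) < r -> cauchy_int (dcirc r) z0 r 2 w = RtoC 0).
{ intros w Hw. apply (circle_integral_primitive (fun u => - / (u - w))%C (fun u => / (u - w) ^ 2)%C); [lra| |].
  - intros u Hu. assert (Hn : (u - w)%C <> RtoC 0).
    { intros E. replace u with w in Hu; [lra|]. replace u with ((u - w) + w)%C by ring. rewrite E; ring. }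
    eapply Cder_eq.
    + apply (Cder_comp (fun v => - / v)%C (fun u => u - w)%C).
      * apply Cder_opp. now apply Cder_inv.
      * apply Cder_minus; [apply Cder_id|apply Cder_const].
    + field; auto.
  - intros u Hu. assert (Hn : (u - w)%C <> RtoC 0).
    { intros E. replace u with w in Hu; [lra|]. replace u with ((u - w) + w)%C by ring. rewrite E; ring. }
    assert (c1 : Ccont (fun u => / (u - w))%C u).
    { eapply Cder_continuous. apply (Cder_comp Cinv (fun u => u - w)%C); [now apply Cder_inv|].
      apply Cder_minus; [apply Cder_id|apply Cder_const]. }
    apply (continuous_ext_loc _ (fun u => / (u - w) * / (u - w))%C); [|now apply continuous_Cmult].
    apply locally_C_Cmod. exists (Cmod (u - w)). split; [now apply Cmod_gt_0|].
    intros v Hv. change (/ (v - w) * / (v - w) = / (v - w) ^ 2 :> C)%C. field. intros E. replace v with w in Hv; [rewrite Cmod_sub_sym in Hv; lra|].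
    replace v with ((v - w) + w)%C by ring. rewrite E; ring. }
replace (cauchy_int (dcirc r) z0 r 1 z) with
  (cauchy_int (dcirc r) z0 r 1 z0 + (cauchy_int (dcirc r) z0 r 1 z - cauchy_int (dcirc r) z0 r 1 z0))%C by ring.
enough (E : (cauchy_int (dcirc r) z0 r 1 z - cauchy_int (dcirc r) z0 r 1 z0)%C = RtoC 0) by (rewrite E; ring).
apply Cmod_eq_0, Rle_antisym; [|apply Cmod_ge_0].
replace 0 with (0 * Cmod (z - z0)) by ring.
assert (S : forall t, 0 <= t <= 1 -> Cmod (seg z0 z t - z0) < r).
{ intros t Ht. unfold seg. replace (z0 + RtoC t * (z - z0) - z0)%C with (RtoC t * (z - z0))%C by ring.
  rewrite Cmod_mult, Cmod_R, Rabs_right by lra. nra. }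
apply (seg_mean_value _ (fun w => RtoC (INR 1) * cauchy_int (dcirc r) z0 r 2 w)%C).
- intros t Ht. apply Cder_cauchy_int; auto. intros; apply Rcont_dcirc.
- intros t Ht. rewrite Z2 by auto. rewrite Cmod_mult, Cmod_0. lra.
Qed.

(** The value at [p] makes the quotient continuous there, so that [rstar_primitive] applies with [p]
    as its exceptional point. *)
Definition dq (f : C -> C) (p z : C) : C :=
  if excluded_middle_informative (z = p) then C_derive f p else ((f z - f p) / (z - p))%C.

Lemma dq_same (f : C -> C) (p : C) : dq f p p = C_derive f p.
Proof. unfold dq. destruct (excluded_middle_informative (p = p)); tauto. Qed.

Lemma dq_diff (f : C -> C) (p z : C) : z <> p -> dq f p z = ((f z - f p) / (z - p))%C.
Proof. intros H. unfold dq. destruct (excluded_middle_informative (z = p)); tauto. Qed.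

Lemma Cminus_neq0 (z w : C) : z <> w -> (z - w)%C <> RtoC 0.
Proof. intros H E. apply H. replace z with ((z - w) + w)%C by ring. rewrite E; ring. Qed.

Lemma dq_mult (f : C -> C) (p z : C) : (dq f p z * (z - p))%C = (f z - f p)%C.
Proof.
destruct (classic (z = p)) as [->|H]; [ring|]. rewrite dq_diff by auto. field. now apply Cminus_neq0.
Qed.

Lemma dq_ex_derive (f : C -> C) (p z : C) : z <> p -> @ex_derive C_AbsRing C_NormedModule f z ->
  @ex_derive C_AbsRing C_NormedModule (dq f p) z.
Proof.
intros H [l Hl]. eapply Cder_ex.
apply (Cder_ext_loc (fun w => (f w - f p) / (w - p))%C _ z) with (d := Cmod (z - p)).
- now apply Cmod_gt_0, Cminus_neq0.
- intros w Hw. symmetry. apply dq_diff. intros ->. rewrite Cmod_sub_sym in Hw. lra.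
- apply Cder_div; [apply Cder_minus; [exact Hl|apply Cder_const]|apply Cder_minus; [apply Cder_id|apply Cder_const]|].
  now apply Cminus_neq0.
Qed.

Lemma dq_continuous (f : C -> C) (p : C) : @ex_derive C_AbsRing C_NormedModule f p -> Ccont (dq f p) p.
Proof.
intros H. assert (Hd := C_derive_correct f p p H).
apply Ccont_eps. intros eps He.
destruct (proj1 (Cder_eps _ _ _) Hd (eps / 2) ltac:(lra)) as [d [Hd0 Hd1]].
exists d; split; auto. intros w Hw. rewrite dq_same.
destruct (classic (w = p)) as [->|Hn].
- rewrite dq_same. replace (C_derive f p - C_derive f p)%C with (RtoC 0) by ring. rewrite Cmod_0; lra.
- rewrite dq_diff by auto. assert (Hn' := Cminus_neq0 _ _ Hn). assert (P := proj1 (Cmod_gt_0 _) Hn').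
  replace ((f w - f p) / (w - p) - C_derive f p)%C with ((f w - f p - (w - p) * C_derive f p) / (w - p))%C by (field; auto).
  rewrite Cmod_div by auto. apply Rle_lt_trans with (eps / 2); [|lra]. apply Rle_div_l; auto.
Qed.

Lemma dq_primitive (D : C -> Prop) (f : C -> C) (p : C) :
  rstar p D -> holomorphic_on D f -> exists F, forall z, D z -> Cder F z (dq f p z).
Proof.
intros HD Hf. assert (Hp : D p) by apply HD. apply (rstar_primitive D (dq f p) p); auto.
- intros z Hz. destruct (classic (z = p)) as [->|Hn]; [apply dq_continuous; auto|].
  destruct (dq_ex_derive f p z Hn (Hf z Hz)) as [l Hl]. exact (Cder_continuous _ _ _ Hl).
- intros z Hz Hn. apply dq_ex_derive; auto.
Qed.

Lemma dq_circle (D : C -> Prop) (f : C -> C) (p z0 : C) (r : R) :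
  rstar p D -> holomorphic_on D f -> 0 <= r -> (forall z, Cmod (z - z0) = r -> D z) ->
  CInt (fun t => dcirc r t * dq f p (circ z0 r t))%C 0 (2 * PI) = RtoC 0.
Proof.
intros HD Hf Hr HC. assert (Hp : D p) by apply HD. destruct (dq_primitive D f p HD Hf) as [F HF].
apply (circle_integral_primitive F); auto.
intros z Hz. specialize (HC z Hz). destruct (classic (z = p)) as [->|Hn]; [apply dq_continuous; auto|].
destruct (dq_ex_derive f p z Hn (Hf z HC)) as [l Hl]. exact (Cder_continuous _ _ _ Hl).
Qed.

Lemma Rcont_on_circ (D : C -> Prop) (f : C -> C) (z0 : C) (r t : R) :
  holomorphic_on D f -> 0 <= r -> (forall z, Cmod (z - z0) = r -> D z) -> Rcont (fun t => f (circ z0 r t)) t.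
Proof.
intros Hf Hr HC. apply (continuous_comp (circ z0 r) f); [apply Rcont_circ|].
apply (hol_cont D); auto. apply HC. now apply Cmod_circ.
Qed.

(** The circle integral of [dq f z] vanishes; splitting the quotient leaves [f z] times the integral
    computed in [cauchy_int_one]. The base point of the primitive is [z] and not the centre, which
    is why [D] is a box. *)
Lemma cauchy_formula (D : C -> Prop) (f : C -> C) (z0 : C) (r : R) (z : C) :
  box D -> holomorphic_on D f -> (forall z, Cmod (z - z0) <= r -> D z) -> Cmod (z - z0) < r ->
  f z = (/ (RtoC (2 * PI) * Ci) * cauchy_int (fun t => dcirc r t * f (circ z0 r t))%C z0 r 1 z)%C.
Proof.
intros HD Hf HC Hz. assert (P := Cmod_ge_0 (z - z0)).
assert (HC' : forall z, Cmod (z - z0) = r -> D z) by (intros; apply HC; lra).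
assert (H0 := dq_circle D f z z0 r (box_rstar D z HD (HC z (Rlt_le _ _ Hz))) Hf ltac:(lra) HC').
set (A := fun t => (dcirc r t * f (circ z0 r t) * / (circ z0 r t - z) ^ 1)%C).
set (B := fun t => (dcirc r t * / (circ z0 r t - z) ^ 1)%C).
assert (cf : forall t, Rcont (fun t => dcirc r t * f (circ z0 r t))%C t).
{ intros t. apply continuous_Cmult; [apply Rcont_dcirc|]. apply (Rcont_on_circ D); auto; lra. }
assert (cA : forall t, Rcont A t) by (intros t; apply Rcont_cauchy; auto).
assert (cB : forall t, Rcont B t) by (intros t; apply Rcont_cauchy; auto; apply Rcont_dcirc).
assert (cB' : forall t, Rcont (fun t => f z * B t)%C t) by (intros; apply continuous_Cmult; [apply continuous_const|auto]).
rewrite (CInt_ext _ (fun t => A t - f z * B t)%C) in H0.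
- rewrite CInt_minus, CInt_scal in H0 by auto.
  change (CInt A 0 (2 * PI)) with (cauchy_int (fun t => dcirc r t * f (circ z0 r t))%C z0 r 1 z) in H0.
  change (CInt B 0 (2 * PI)) with (cauchy_int (dcirc r) z0 r 1 z) in H0.
  rewrite cauchy_int_one in H0 by auto.
  set (X := cauchy_int _ z0 r 1 z) in *.
  replace X with ((X - f z * (RtoC (2 * PI) * Ci)) + f z * (RtoC (2 * PI) * Ci))%C by ring. rewrite H0.
  assert (N := two_PI_i_neq0). set (k := (RtoC (2 * PI) * Ci)%C) in *. field. auto.
- intros t. unfold A, B. assert (Hn := circ_sub_neq0 z0 r t z Hz). rewrite dq_diff.
  + field. auto.
  + intros E. apply Hn. rewrite E. ring.
Qed.

(** Cauchy's formula off the centre asks for a box; squares stand in for discs there. *)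
Definition sq (z0 : C) (s : R) (z : C) : Prop := Rabs (Re z - Re z0) < s /\ Rabs (Im z - Im z0) < s.

Lemma sq_box (z0 : C) (s : R) : box (sq z0 s).
Proof.
split.
- intros z [H1 H2]. apply locally_C_Cmod.
  exists (Rmin (s - Rabs (Re z - Re z0)) (s - Rabs (Im z - Im z0))). split; [apply Rmin_pos; lra|].
  intros w Hw. assert (A1 := Rlt_le_trans _ _ _ Hw (Rmin_l _ _)). assert (A2 := Rlt_le_trans _ _ _ Hw (Rmin_r _ _)).
  assert (B1 := re_le_Cmod (w - z)). assert (B2 := im_le_Cmod (w - z)).
  change (Re (w - z)) with (Re w - Re z) in B1. change (Im (w - z)) with (Im w - Im z) in B2.
  split.
  + replace (Re w - Re z0) with ((Re w - Re z) + (Re z - Re z0)) by ring. eapply Rle_lt_trans; [apply Rabs_triang|]. lra.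
  + replace (Im w - Im z0) with ((Im w - Im z) + (Im z - Im z0)) by ring. eapply Rle_lt_trans; [apply Rabs_triang|]. lra.
- assert (K : forall a b x x0, Rabs (a - x0) < s -> Rabs (b - x0) < s -> between a b x -> Rabs (x - x0) < s).
  { intros a b x x0 H1 H2 [H3 H4]. apply Rabs_def2 in H1. apply Rabs_def2 in H2.
    apply Rabs_def1; unfold Rmin, Rmax in *; destruct (Rle_dec a b); lra. }
  intros z w u [H1 H2] [H3 H4] H5 H6. split; [exact (K _ _ _ _ H1 H3 H5)|exact (K _ _ _ _ H2 H4 H6)].
Qed.

Lemma disc_sq (z0 : C) (s : R) (z : C) : Cmod (z - z0) < s -> sq z0 s z.
Proof.
intros H. split; [apply Rle_lt_trans with (2 := H); apply (re_le_Cmod (z - z0))|apply Rle_lt_trans with (2 := H); apply (im_le_Cmod (z - z0))].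
Qed.

Lemma sq_disc (z0 : C) (s : R) (z : C) : sq z0 s z -> Cmod (z - z0) < 2 * s.
Proof.
intros [H1 H2]. eapply Rle_lt_trans; [apply Cmod_le_Rabs|].
change (Re (z - z0)) with (Re z - Re z0). change (Im (z - z0)) with (Im z - Im z0). lra.
Qed.

Lemma hol_subset (D E : C -> Prop) (f : C -> C) : (forall z, E z -> D z) -> holomorphic_on D f -> holomorphic_on E f.
Proof. intros H Hf z Hz. auto. Qed.

(** Locally [f] is a Cauchy integral with exponent 1, its derivative one with exponent 2, and the
    latter is differentiable in turn. *)
Lemma hol_derive (D : C -> Prop) (f : C -> C) :
  @open C_UniformSpace D -> holomorphic_on D f -> holomorphic_on D (C_derive f).
Proof.
intros HO Hf z0 Hz0. destruct (open_Cmod D z0 HO Hz0) as [d [Hd HD]].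
assert (Hsq : forall z, sq z0 (d / 2) z -> D z) by (intros z Hz; apply HD; apply sq_disc in Hz; lra).
assert (Hf' := hol_subset _ _ _ Hsq Hf).
(* The square of half-side [d / 2] fits in the disc of radius [d], and the closed disc of radius
   [d / 4] fits in the square. *)
set (r := d / 4). set (h := fun t => (dcirc r t * f (circ z0 r t))%C).
assert (Hr : 0 < r) by (unfold r; lra).
assert (Hdisc : forall z, Cmod (z - z0) <= r -> sq z0 (d / 2) z) by (intros z Hz; apply disc_sq; unfold r in Hz; lra).
assert (ch : forall t, Rcont h t).
{ intros t. apply continuous_Cmult; [apply Rcont_dcirc|]. apply (Rcont_on_circ (sq z0 (d / 2))); auto; try lra.
  intros z Hz; apply Hdisc; lra. }
set (k := (/ (RtoC (2 * PI) * Ci))%C).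
assert (F1 : forall z, Cmod (z - z0) < r -> Cder f z (k * (RtoC (INR 1) * cauchy_int h z0 r 2 z))%C).
{ intros z Hz. apply (Cder_ext_loc (fun z => k * cauchy_int h z0 r 1 z)%C f z _ (r - Cmod (z - z0))); [lra| |].
  - intros w Hw. symmetry. apply (cauchy_formula (sq z0 (d / 2))); auto; [apply sq_box|].
    replace (w - z0)%C with ((w - z) + (z - z0))%C by ring. eapply Rle_lt_trans; [apply Cmod_triangle|]. lra.
  - apply Cder_scal. apply Cder_cauchy_int; auto. }
eapply Cder_ex.
apply (Cder_ext_loc (fun z => k * (RtoC (INR 1) * cauchy_int h z0 r 2 z))%C _ z0 _ r Hr).
- intros w Hw. symmetry. apply Cder_derive. now apply F1.
- apply Cder_scal, Cder_scal, Cder_cauchy_int; auto. replace (z0 - z0)%C with (RtoC 0) by ring. rewrite Cmod_0; auto.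
Qed.

(** The removable singularity: [dq f p] has a primitive, is therefore the derivative of a
    holomorphic function, and so is holomorphic at [p] as well. *)
Lemma hol_dq (D : C -> Prop) (f : C -> C) (p : C) :
  rstar p D -> holomorphic_on D f -> holomorphic_on D (dq f p).
Proof.
intros HD Hf. destruct (dq_primitive D f p HD Hf) as [F HF].
assert (H : holomorphic_on D (C_derive F)).
{ apply hol_derive; [apply HD|]. intros z Hz. eapply Cder_ex; eauto. }
intros z Hz. eapply Cder_ex. eapply (Cder_ext_open D (C_derive F)); [apply HD|exact Hz| |eapply hol_Cder; eauto].
intros w Hw. apply Cder_derive. auto.
Qed.

(** On a circle about [z0], [dcirc] is [Ci * (z - z0)], so the vanishing integral of [dq f z0] says
    that [f z0] is the mean of [f]. Only one turn of the parameter is constrained, as bounds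
    obtained by compactness cover no more. *)
Lemma mean_value_bound_circ (D : C -> Prop) (f : C -> C) (z0 : C) (r S : R) :
  rstar z0 D -> holomorphic_on D f -> 0 < r -> (forall z, Cmod (z - z0) <= r -> D z) ->
  (forall t, 0 <= t <= 2 * PI -> Cmod (f (circ z0 r t)) <= S) -> Cmod (f z0) <= S.
Proof.
intros HD Hf Hr HC HS.
assert (P := PI_RGT_0).
assert (Hz0 : D z0) by (apply HC; replace (z0 - z0)%C with (RtoC 0) by ring; rewrite Cmod_0; lra).
assert (HC' : forall z, Cmod (z - z0) = r -> D z) by (intros; apply HC; lra).
assert (H0 := dq_circle D f z0 z0 r HD Hf ltac:(lra) HC').
assert (cf : forall t, Rcont (fun t => f (circ z0 r t)) t) by (intros; apply (Rcont_on_circ D); auto; lra).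
assert (cf' : forall t, Rcont (fun t => Ci * f (circ z0 r t))%C t) by (intros; apply continuous_Cmult; [apply continuous_const|auto]).
rewrite (CInt_ext _ (fun t => Ci * f (circ z0 r t) - Ci * f z0)%C) in H0.
2: { intros t. rewrite (dcirc_circ z0).
  transitivity (Ci * (dq f z0 (circ z0 r t) * (circ z0 r t - z0)))%C; [ring|]. rewrite dq_mult. ring. }
rewrite CInt_minus, CInt_scal, CInt_const in H0; auto; [|intros; apply continuous_const].
set (X := CInt (fun t => f (circ z0 r t)) 0 (2 * PI)) in *.
assert (E : X = (RtoC (2 * PI) * f z0)%C).
{ replace X with (- Ci * (Ci * X - RtoC (2 * PI - 0) * (Ci * f z0)) + (RtoC (2 * PI) * f z0))%C.
  - rewrite H0. ring.
  - rewrite Rminus_0_r. assert (CC : (Ci * Ci)%C = (- (1))%C) by (apply injective_projections; simpl; ring).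
    transitivity (- (Ci * Ci) * X + (Ci * Ci) * (RtoC (2 * PI) * f z0) + RtoC (2 * PI) * f z0)%C; [ring|].
    rewrite CC. ring. }
assert (B : Cmod X <= (2 * PI - 0) * S).
{ apply CInt_bound; [lra| |apply ex_RInt_continuous; intros; auto]. auto. }
rewrite E, Cmod_mult, Cmod_R, Rabs_right in B by lra.
apply (Rmult_le_reg_l (2 * PI)); lra.
Qed.

Lemma mean_value_bound (D : C -> Prop) (f : C -> C) (z0 : C) (r S : R) :
  rstar z0 D -> holomorphic_on D f -> 0 < r -> (forall z, Cmod (z - z0) <= r -> D z) ->
  (forall z, Cmod (z - z0) = r -> Cmod (f z) <= S) -> Cmod (f z0) <= S.
Proof.
intros HD Hf Hr HC HS. apply (mean_value_bound_circ D f z0 r S); auto.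
intros t _. apply HS. apply Cmod_circ; lra.
Qed.

(** The mean value bound for [dq f z0], whose value at the centre is the derivative. The factor 2
    comes from bounding [f z - f z0] by the triangle inequality. *)
Lemma cauchy_estimate (D : C -> Prop) (f : C -> C) (z0 : C) (r S : R) :
  rstar z0 D -> holomorphic_on D f -> 0 < r -> (forall z, Cmod (z - z0) <= r -> D z) ->
  (forall z, Cmod (z - z0) <= r -> Cmod (f z) <= S) -> Cmod (C_derive f z0) <= 2 * S / r.
Proof.
intros HD Hf Hr HC HS. rewrite <- dq_same.
assert (E0 : Cmod (z0 - z0) = 0) by (replace (z0 - z0)%C with (RtoC 0) by ring; apply Cmod_0).
assert (Hz0 : D z0) by (apply HC; lra).
apply (mean_value_bound D (dq f z0) z0 r); auto; [now apply hol_dq|].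
intros z Hz. assert (Hn : z <> z0) by (intros ->; lra).
rewrite dq_diff, Cmod_div, Hz by (auto; now apply Cminus_neq0).
apply Rmult_le_compat_r; [apply Rlt_le, Rinv_0_lt_compat; lra|].
unfold Cminus. eapply Rle_trans; [apply Cmod_triangle|]. rewrite Cmod_opp.
generalize (HS z ltac:(lra)) (HS z0 ltac:(lra)). lra.
Qed.

Definition Cdisc (z0 : C) (r : R) (z : C) : Prop := Cmod (z - z0) < r.

Lemma disc_open (z0 : C) (r : R) : @open C_UniformSpace (Cdisc z0 r).
Proof.
intros z Hz. apply locally_C_Cmod. unfold Cdisc in *. exists (r - Cmod (z - z0)). split; [lra|]. intros w Hw.
replace (w - z0)%C with ((w - z) + (z - z0))%C by ring. eapply Rle_lt_trans; [apply Cmod_triangle|]. lra.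
Qed.

Lemma disc_center (z0 : C) (r : R) : 0 < r -> Cdisc z0 r z0.
Proof. intros Hr. unfold Cdisc. replace (z0 - z0)%C with (RtoC 0) by ring. now rewrite Cmod_0. Qed.

Lemma Cmod_le_parts (z w : C) : Rabs (Re z) <= Rabs (Re w) -> Rabs (Im z) <= Rabs (Im w) -> Cmod z <= Cmod w.
Proof.
intros H1 H2. apply Rsqr_incr_0_var; [|apply Cmod_ge_0]. rewrite !Rsqr_pow2, !Cmod2_alt, <- !Rsqr_pow2.
apply Rplus_le_compat; now apply Rsqr_le_abs_1.
Qed.

Lemma disc_rstar (z0 : C) (r : R) : 0 < r -> rstar z0 (Cdisc z0 r).
Proof.
intros Hr. split; [apply disc_open|]. split; [now apply disc_center|].
intros w u Hw H1 H2. apply Rle_lt_trans with (2 := Hw).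
apply between_Rabs in H1. apply between_Rabs in H2.
change (Rabs (Re (u - z0)) <= Rabs (Re (w - z0))) in H1. change (Rabs (Im (u - z0)) <= Rabs (Im (w - z0))) in H2.
now apply Cmod_le_parts.
Qed.

(* If [f] missed [w] on the disc, the mean value bound for [1 / (f - w)] would fail at the centre. *)
Lemma disc_covering (f : C -> C) (z0 : C) (r s d : R) (w : C) :
  0 < r < s -> holomorphic_on (Cdisc z0 s) f ->
  (forall z, Cmod (z - z0) = r -> d <= Cmod (f z - f z0)) -> Cmod (w - f z0) < d / 2 ->
  exists z, Cdisc z0 s z /\ f z = w.
Proof.
intros Hr Hf Hd Hw. apply NNPP. intros N.
assert (P := Cmod_ge_0 (w - f z0)).
assert (Hd0 : 0 < d) by lra.
assert (HD := disc_rstar z0 s ltac:(lra)).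
assert (NZ : forall z, Cdisc z0 s z -> (f z - w)%C <> RtoC 0).
{ intros z Hz E. apply N. exists z; split; auto. replace (f z) with ((f z - w) + w)%C by ring. rewrite E; ring. }
assert (Hfw : holomorphic_on (Cdisc z0 s) (fun z => 1 / (f z - w))%C).
{ apply hol_div; auto; [apply hol_const|]. apply hol_minus; auto; apply hol_const. }
assert (B := mean_value_bound _ _ z0 r (2 / d) HD Hfw ltac:(lra) (fun z Hz => Rle_lt_trans _ _ _ Hz (proj2 Hr))).
assert (Hz0 := NZ z0 ltac:(apply disc_center; lra)).
assert (B' : Cmod (1 / (f z0 - w)) <= 2 / d).
{ apply B. intros z Hz. assert (Hzd : Cdisc z0 s z) by (unfold Cdisc; lra). specialize (NZ z Hzd).
  rewrite Cmod_div, Cmod_1 by auto. specialize (Hd z Hz).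
  assert (T := Cmod_triangle_inv (f z - f z0) (w - f z0)).
  replace ((f z - f z0) - (w - f z0))%C with (f z - w)%C in T by ring.
  replace (2 / d) with (1 / (d / 2)) by (field; lra).
  apply Rmult_le_compat_l; [lra|]. apply Rinv_le_contravar; lra. }
rewrite Cmod_div, Cmod_1, Cmod_sub_sym in B' by auto. assert (Q : 0 < Cmod (w - f z0)) by (rewrite Cmod_sub_sym; now apply Cmod_gt_0).
assert (B2 : 1 <= 2 / d * Cmod (w - f z0)) by (apply Rle_div_l; auto).
apply (Rmult_le_compat_r (d / 2)) in B2; [|lra].
replace (2 / d * Cmod (w - f z0) * (d / 2)) with (Cmod (w - f z0)) in B2 by (field; lra). lra.
Qed.

(** * Injective holomorphic functions and Bloch's bound *)

Lemma rstar_seg (p : C) (D : C -> Prop) (z : C) (t : R) : rstar p D -> D z -> 0 <= t <= 1 -> D (seg p z t).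
Proof.
intros (_ & _ & H) Hz Ht.
assert (K : forall a b, between a b (a + t * (b - a))).
{ intros a b. unfold between, Rmin, Rmax. destruct (Rle_dec a b); nra. }
apply (H z); auto.
- replace (Re (seg p z t)) with (Re p + t * (Re z - Re p)); [apply K|]. unfold seg; destruct p, z; simpl; ring.
- replace (Im (seg p z t)) with (Im p + t * (Im z - Im p)); [apply K|]. unfold seg; destruct p, z; simpl; ring.
Qed.

Lemma rstar_const (p : C) (D : C -> Prop) (f : C -> C) :
  rstar p D -> (forall z, D z -> Cder f z (RtoC 0)) -> forall z, D z -> f z = f p.
Proof.
intros HD Hf z Hz. replace (f z) with (f p + (f z - f p))%C by ring.
enough (E : (f z - f p)%C = RtoC 0) by (rewrite E; ring).
apply Cmod_eq_0, Rle_antisym; [|apply Cmod_ge_0].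
replace 0 with (0 * Cmod (z - p)) by ring.
apply (seg_mean_value f (fun _ => RtoC 0)).
- intros t Ht. apply Hf. now apply rstar_seg.
- intros t Ht. rewrite Cmod_0; lra.
Qed.

(* Were [f' z1 = 0], the mean value bound for [1 / dq f a], with [a] close to [z1] and [f' a <> 0], would keep
   [dq f a z1 = dq f z1 a] away from [0], whereas it tends to [f' z1]. *)
Lemma injective_derive_neq0 (D : C -> Prop) (f : C -> C) (z1 : C) :
  @open C_UniformSpace D -> holomorphic_on D f -> (forall z w, D z -> D w -> f z = f w -> z = w) ->
  D z1 -> C_derive f z1 <> RtoC 0.
Proof.
intros HO Hf Hinj Hz1 H0.
destruct (open_Cmod D z1 HO Hz1) as [s [Hs HsD]].
set (r := s / 4). assert (Hr : 0 < r) by (unfold r; lra).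
assert (HB := sq_box z1 (s / 2)). set (B := sq z1 (s / 2)) in *.
assert (HBD : forall z, B z -> D z) by (intros z Hz; apply HsD; apply sq_disc in Hz; lra).
assert (HfB := hol_subset _ _ _ HBD Hf).
assert (HrB : forall z, Cmod (z - z1) <= r -> B z) by (intros z Hz; apply disc_sq; unfold r in Hz; lra).
assert (E0 : Cmod (z1 - z1) = 0) by (replace (z1 - z1)%C with (RtoC 0) by ring; apply Cmod_0).
assert (HBz1 : B z1) by (apply HrB; lra).
assert (Hcirc : forall t, B (circ z1 r t)) by (intros t; apply HrB; rewrite Cmod_circ; lra).
assert (Hne : forall t, (f (circ z1 r t) - f z1)%C <> RtoC 0).
{ intros t. apply Cminus_neq0. intros E. apply Hinj in E; auto. 
  assert (Q := Cmod_circ z1 r t ltac:(lra)). rewrite E in Q. lra. }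
(* Compactness is applied to the reciprocal: its upper bound [S] is a positive lower bound [d = / S]
   for [|f - f z1|] on the circle. *)
destruct (Rcont_bounded (fun t => / (f (circ z1 r t) - f z1))%C 0 (2 * PI)) as [S HS].
{ generalize PI_RGT_0; lra. }
{ intros t. apply Rcont_Cinv; [|apply Hne]. apply continuous_Cminus; [|apply continuous_const].
  apply (Rcont_on_circ B); auto; try lra. intros z Hz; apply HrB; lra. }
assert (HS0 : 0 < S).
{ eapply Rlt_le_trans; [|apply (HS 0); generalize PI_RGT_0; lra].
  rewrite Cmod_inv by auto. apply Rinv_0_lt_compat. now apply Cmod_gt_0. }
set (d := / S). assert (Hd : 0 < d) by now apply Rinv_0_lt_compat.
assert (Hlow : forall t, 0 <= t <= 2 * PI -> d <= Cmod (f (circ z1 r t) - f z1)).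
{ intros t Ht. specialize (HS t Ht). rewrite Cmod_inv in HS by auto. unfold d.
  rewrite <- (Rinv_inv (Cmod (f (circ z1 r t) - f z1))). apply Rinv_le_contravar; auto.
  apply Rinv_0_lt_compat. now apply Cmod_gt_0. }
destruct (proj1 (Ccont_eps _ _) (hol_cont B f z1 HfB HBz1) (d / 2) ltac:(lra)) as [e1 [He1 K1]].
(* Half of the lower bound [d / (4 * r)] for [|dq f z1 a|] that the mean value bound will impose. *)
assert (Hq : 0 < d / (8 * r)) by (apply Rdiv_lt_0_compat; lra).
destruct (proj1 (Ccont_eps _ _) (dq_continuous f z1 (Hf z1 Hz1)) (d / (8 * r)) Hq) as [e2 [He2 K2]].
set (e := Rmin r (Rmin e1 e2)). assert (He : 0 < e) by (repeat apply Rmin_pos; auto).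
(* Were the derivative zero throughout a disc, [f] would be constant there, against injectivity. *)
assert (Ha : exists a, Cmod (a - z1) < e /\ C_derive f a <> RtoC 0).
{ apply NNPP. intros N.
  assert (Z : forall a, Cdisc z1 e a -> C_derive f a = RtoC 0).
  { intros a Ha. apply NNPP. intros Hn. apply N. now exists a. }
  assert (Hde : forall a, Cdisc z1 e a -> B a).
  { intros a Ha. apply HrB. apply Rlt_le, Rlt_le_trans with (1 := Ha). apply Rmin_l. }
  assert (HC := rstar_const z1 (Cdisc z1 e) f (disc_rstar z1 e He)).
  assert (Hc : forall z, Cdisc z1 e z -> Cder f z (RtoC 0)).
  { intros z Hz. rewrite <- (Z z Hz). apply (hol_Cder B); auto. }
  assert (W : Cdisc z1 e (z1 + RtoC (e / 2))%C).
  { unfold Cdisc. replace (z1 + RtoC (e / 2) - z1)%C with (RtoC (e / 2)) by ring. rewrite Cmod_R, Rabs_right; lra. }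
  specialize (HC Hc _ W). apply Hinj in HC; auto.
  apply (f_equal Re) in HC. change (Re z1 + e / 2 = Re z1) in HC. lra. }
destruct Ha as [a [Ha1 Ha2]].
assert (A1 : Cmod (a - z1) < r) by (apply Rlt_le_trans with (1 := Ha1), Rmin_l).
assert (A2 : Cmod (f a - f z1) < d / 2).
{ apply K1. apply Rlt_le_trans with (1 := Ha1). eapply Rle_trans; [apply Rmin_r|apply Rmin_l]. }
assert (A3 : Cmod (dq f z1 a) < d / (8 * r)).
{ replace (dq f z1 a) with (dq f z1 a - dq f z1 z1)%C by (rewrite dq_same, H0; ring).
  apply K2. apply Rlt_le_trans with (1 := Ha1). eapply Rle_trans; [apply Rmin_r|apply Rmin_r]. }
assert (Hane : a <> z1) by (intros ->; auto).
assert (HBa : B a) by (apply HrB; lra).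
assert (NZ : forall z, B z -> dq f a z <> RtoC 0).
{ intros z Hz. destruct (classic (z = a)) as [->|Hn]; [now rewrite dq_same|].
  intros E. assert (M := dq_mult f a z). rewrite E in M.
  apply Hn. apply Hinj; auto. replace (f z) with ((f z - f a) + f a)%C by ring. rewrite <- M. ring. }
assert (HG : holomorphic_on B (fun z => 1 / dq f a z)%C).
{ apply hol_div; [apply hol_const|apply hol_dq; auto; now apply box_rstar|exact NZ]. }
assert (MB : Cmod (1 / dq f a z1) <= 4 * r / d).
{ apply (mean_value_bound_circ B (fun z => 1 / dq f a z)%C z1 r); auto; [now apply box_rstar|].
  intros t Ht. rewrite Cmod_div, Cmod_1 by auto.
  assert (Hca : circ z1 r t <> a).
  { intros E. assert (Q := Cmod_circ z1 r t ltac:(lra)). rewrite E in Q. lra. }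
  rewrite dq_diff, Cmod_div by (auto; now apply Cminus_neq0).
  assert (L1 : d / 2 <= Cmod (f (circ z1 r t) - f a)).
  { replace (f (circ z1 r t) - f a)%C with ((f (circ z1 r t) - f z1) - (f a - f z1))%C by ring.
    eapply Rle_trans; [|apply Cmod_triangle_inv]. specialize (Hlow t Ht). lra. }
  assert (L2 : Cmod (circ z1 r t - a) <= 2 * r).
  { replace (circ z1 r t - a)%C with ((circ z1 r t - z1) + - (a - z1))%C by ring.
    eapply Rle_trans; [apply Cmod_triangle|]. rewrite Cmod_opp, Cmod_circ; lra. }
  assert (L3 : 0 < Cmod (circ z1 r t - a)) by now apply Cmod_gt_0, Cminus_neq0.
  replace (1 / (Cmod (f (circ z1 r t) - f a) / Cmod (circ z1 r t - a))) with
    (Cmod (circ z1 r t - a) / Cmod (f (circ z1 r t) - f a)) by (field; lra).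
  replace (4 * r / d) with (2 * r * / (d / 2)) by (field; lra).
  apply Rmult_le_compat; [lra|apply Rlt_le, Rinv_0_lt_compat; lra|exact L2|apply Rinv_le_contravar; lra]. }
assert (Sym : dq f a z1 = dq f z1 a).
{ rewrite !dq_diff by auto. assert (Q := Cminus_neq0 _ _ Hane). assert (Q' := Cminus_neq0 z1 a (not_eq_sym Hane)). field; auto. }
assert (NZ1 := NZ z1 HBz1).
rewrite Cmod_div, Cmod_1, Sym in MB by auto. rewrite Sym in NZ1. apply Cmod_gt_0 in NZ1.
set (X := Cmod (dq f z1 a)) in *.
assert (1 <= 4 * r / d * X) by (apply Rle_div_l; auto).
assert (4 * r / d * X < 4 * r / d * (d / (8 * r))).
{ apply Rmult_lt_compat_l; auto. apply Rdiv_lt_0_compat; lra. }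
assert (4 * r / d * (d / (8 * r)) = 1 / 2) by (field; lra). lra.
Qed.

(** With [l0] a primitive of [h' / h], the product [h * Cexp (- l0)] has derivative 0; its constant
    value is an exponential, whose exponent is added to [l0]. *)
Lemma holomorphic_log (D : C -> Prop) (h : C -> C) (p : C) :
  rstar p D -> holomorphic_on D h -> (forall z, D z -> h z <> RtoC 0) ->
  exists l, forall z, D z -> Cder l z (C_derive h z / h z)%C /\ Cexp (l z) = h z.
Proof.
intros HD Hh Hn.
assert (Hq : holomorphic_on D (fun z => C_derive h z / h z)%C) by (apply hol_div; auto; apply hol_derive; auto; apply HD).
destruct (rstar_primitive D (fun z => C_derive h z / h z)%C p HD) as [l0 Hl0].
{ intros z Hz. now apply (hol_cont D). }
{ intros z Hz _. now apply Hq. }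
assert (HC : forall z, D z -> (h z * Cexp (- l0 z))%C = (h p * Cexp (- l0 p))%C).
{ apply (rstar_const p D (fun z => h z * Cexp (- l0 z))%C HD). intros z Hz. eapply Cder_eq.
  - apply (Cder_mult h (fun z => Cexp (- l0 z))); [apply (hol_Cder D); auto|].
    apply (Cder_comp Cexp (fun z => - l0 z)%C); [apply Cder_Cexp|]. apply Cder_opp. now apply Hl0.
  - cbv beta. field. now apply Hn. }
assert (Hp : D p) by apply HD.
destruct (Cexp_surj (h p * Cexp (- l0 p))%C) as [w Hw].
{ apply Cmult_neq_0; [auto|apply Cexp_neq_0]. }
exists (fun z => l0 z + w)%C. intros z Hz. split.
- eapply Cder_eq; [apply Cder_plus; [apply Hl0, Hz|apply Cder_const]|]. ring.
- rewrite Cexp_plus, Hw, <- (HC z Hz), Cexp_opp. field. apply Cexp_neq_0.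
Qed.

(* Bloch's argument: near a point that almost maximises [|k'| (r - |z - z0|)] the function [k] is
   almost linear, hence covers a Cdisc of radius proportional to that maximum. *)
Lemma bloch_bound (k : C -> C) (z0 : C) (R0 : R) :
  0 < R0 -> holomorphic_on (Cdisc z0 R0) k ->
  (forall u v, Cdisc z0 R0 u -> Cdisc z0 R0 v -> k u <> (k v + RtoC (2 * PI) * Ci)%C) ->
  Cmod (C_derive k z0) * R0 <= 8192 * PI.
Proof.
intros HR Hk Hom. assert (HPI := PI_RGT_0).
assert (Hdk := hol_derive _ k (disc_open z0 R0) Hk).
assert (Hddk := hol_derive _ _ (disc_open z0 R0) Hdk).
(* The closed square of half-side [r] about [z0] lies in the disc, so the derivative of [k] is
   bounded on it and the supremum taken below is finite. *)
set (r := R0 / 4). assert (Hr : 0 < r) by (unfold r; lra).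
assert (E0 : Cmod (z0 - z0) = 0) by (replace (z0 - z0)%C with (RtoC 0) by ring; apply Cmod_0).
destruct (rect_bounded (C_derive k) (Re z0 - r) (Re z0 + r) (Im z0 - r) (Im z0 + r)) as [M HM]; try lra.
{ intros x y Hx Hy. apply (hol_cont (Cdisc z0 R0)); auto. unfold Cdisc. eapply Rle_lt_trans; [apply Cmod_le_Rabs|]. simpl.
  change (fst z0) with (Re z0). change (snd z0) with (Im z0).
  apply Rle_lt_trans with (r + r); [apply Rplus_le_compat; apply Rabs_le; lra|unfold r; lra]. }
assert (HM' : forall z, Cmod (z - z0) <= r -> Cmod (C_derive k z) <= M).
{ intros z Hz. assert (Q1 := Rle_trans _ _ _ (re_le_Cmod _) Hz). assert (Q2 := Rle_trans _ _ _ (im_le_Cmod _) Hz).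
  apply Rabs_le_between in Q1. apply Rabs_le_between in Q2. destruct z as [x y]. simpl in Q1, Q2. 
  change (fst z0) with (Re z0) in *. change (snd z0) with (Im z0) in *. apply HM; lra. }
assert (HM0 : 0 <= M) by (eapply Rle_trans; [apply Cmod_ge_0|apply (HM' z0); lra]).
destruct (completeness (fun x => exists v, Cmod (v - z0) <= r /\ x = Cmod (C_derive k v) * (r - Cmod (v - z0)))) as [S [HS1 HS2]].
{ exists (M * r). intros x [v [Hv ->]]. assert (P := Cmod_ge_0 (v - z0)). apply Rmult_le_compat; try apply Cmod_ge_0; auto; lra. }
{ exists (Cmod (C_derive k z0) * (r - Cmod (z0 - z0))). exists z0. split; [lra|reflexivity]. }
assert (HS : forall v, Cmod (v - z0) <= r -> Cmod (C_derive k v) * (r - Cmod (v - z0)) <= S).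
{ intros v Hv. apply HS1. now exists v. }
assert (HSz0 : Cmod (C_derive k z0) * r <= S).
{ specialize (HS z0 ltac:(lra)). rewrite E0, Rminus_0_r in HS. exact HS. }
(* Since [R0 = 4 * r], the quantity to be bounded is at most [4 * S]. *)
enough (S <= 2048 * PI) by (unfold r in HSz0; lra).
apply Rnot_lt_le. intros HSbig.
assert (Hv : exists v, Cmod (v - z0) <= r /\ S / 2 < Cmod (C_derive k v) * (r - Cmod (v - z0))).
{ apply NNPP. intros N. assert (S <= S / 2); [|lra]. apply HS2. intros x [v [Hv ->]].
  apply Rnot_lt_le. intros Hlt. apply N. now exists v. }
(* Within [rho] of [v1] the weight [r - |v - z0|] is still at least [rho], and near-maximality gives
   [S < 4 * T * rho]; hence the bound [4 * T] for the derivative there. *)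
destruct Hv as [v1 [Hv1 HT]]. set (T := Cmod (C_derive k v1)) in *. set (rho := (r - Cmod (v1 - z0)) / 2).
assert (HT0 : 0 <= T) by apply Cmod_ge_0.
assert (HTr : S / 2 < 2 * T * rho) by (unfold rho; lra).
assert (Hrho : 0 < rho).
{ apply Rnot_le_lt. intros Hle. assert (T * rho <= 0) by nra. lra. }
assert (HTp : 0 < T).
{ apply Rnot_le_lt. intros Hle. assert (T * rho <= 0) by nra. lra. }
assert (Tri : forall v e, Cmod (v - v1) <= e -> Cmod (v - z0) <= r - 2 * rho + e).
{ intros v e He. replace (v - z0)%C with ((v - v1) + (v1 - z0))%C by ring. eapply Rle_trans; [apply Cmod_triangle|]. unfold rho; lra. }
assert (B1 : forall v, Cmod (v - v1) <= rho -> Cmod (C_derive k v) <= 4 * T).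
{ intros v Hv. assert (Q := Tri v rho Hv). assert (Q2 := HS v ltac:(lra)).
  assert (P := Cmod_ge_0 (C_derive k v)).
  apply (Rmult_le_reg_r rho); auto. nra. }
assert (InD : forall v e, e <= rho -> Cmod (v - v1) <= e -> Cdisc z0 R0 v).
{ intros v e He Hv. assert (Q := Tri v e Hv). unfold Cdisc, r in *. lra. }
assert (B2 : forall v, Cmod (v - v1) <= rho / 2 -> Cmod (C_derive (C_derive k) v) <= 16 * T / rho).
{ intros v Hv. assert (Q : forall z, Cmod (z - v) < rho / 2 + rho / 4 -> Cmod (z - v1) <= 5 / 4 * rho).
  { intros z Hz. replace (z - v1)%C with ((z - v) + (v - v1))%C by ring. eapply Rle_trans; [apply Cmod_triangle|]. lra. }
  replace (16 * T / rho) with (2 * (4 * T) / (rho / 2)) by (field; lra).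
  apply (cauchy_estimate (Cdisc v (rho / 2 + rho / 4))).
  - apply disc_rstar; lra.
  - intros z Hz. apply Hdk. assert (Q1 := Tri z _ (Q z Hz)). unfold Cdisc, r in *. lra.
  - lra.
  - intros z Hz. unfold Cdisc. lra.
  - intros z Hz. apply B1. replace (z - v1)%C with ((z - v) + (v - v1))%C by ring. eapply Rle_trans; [apply Cmod_triangle|]. lra. }
assert (Seg : forall v t, 0 <= t <= 1 -> Cmod (seg v1 v t - v1) <= Cmod (v - v1)).
{ intros v t Ht. unfold seg. replace (v1 + RtoC t * (v - v1) - v1)%C with (RtoC t * (v - v1))%C by ring.
  rewrite Cmod_mult, Cmod_R, Rabs_right by lra. assert (P := Cmod_ge_0 (v - v1)). nra. }
assert (B3 : forall v, Cmod (v - v1) <= rho / 32 -> Cmod (C_derive k v - C_derive k v1) <= T / 2).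
{ intros v Hv. apply Rle_trans with (16 * T / rho * Cmod (v - v1)).
  - apply (seg_mean_value (C_derive k) (C_derive (C_derive k))); intros t Ht; specialize (Seg v t Ht).
    + apply (hol_Cder (Cdisc z0 R0)); auto. apply (InD _ rho); lra.
    + apply B2. lra.
  - apply Rle_trans with (16 * T / rho * (rho / 32)).
    + apply Rmult_le_compat_l; auto. apply Rlt_le, Rdiv_lt_0_compat; lra.
    + right; field; lra. }
set (sg := rho / 64).
assert (B4 : forall v, Cmod (v - v1) = sg -> T * sg / 2 <= Cmod (k v - k v1)).
{ intros v Hv.
  assert (Q : Cmod ((k v - C_derive k v1 * v) - (k v1 - C_derive k v1 * v1)) <= T / 2 * Cmod (v - v1)).
  { apply (seg_mean_value (fun z => k z - C_derive k v1 * z)%C (fun z => C_derive k z - C_derive k v1)%C);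
      intros t Ht; specialize (Seg v t Ht); rewrite Hv in Seg; unfold sg in Seg.
    - eapply Cder_eq.
      + apply Cder_minus; [apply (hol_Cder (Cdisc z0 R0)); auto; apply (InD _ rho); lra|apply Cder_scal, Cder_id].
      + ring.
    - apply B3. lra. }
  replace (k v - k v1)%C with (C_derive k v1 * (v - v1) - - ((k v - C_derive k v1 * v) - (k v1 - C_derive k v1 * v1)))%C by ring.
  eapply Rle_trans; [|apply Cmod_triangle_inv]. rewrite Cmod_mult, Cmod_opp. fold T. rewrite Hv in *. lra. }
(* From [S > 2048 * PI] follows [T * rho > 512 * PI], so the covered radius [T * sg / 4] exceeds
   [2 * PI] and [k] attains the forbidden value. *)
destruct (disc_covering k v1 sg (rho / 32) (T * sg / 2) (k v1 + RtoC (2 * PI) * Ci)%C) as [u [Hu1 Hu2]].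
- unfold sg; lra.
- intros z Hz. apply Hk. apply (InD _ rho); [lra|]. unfold Cdisc in Hz; lra.
- exact B4.
- replace (k v1 + RtoC (2 * PI) * Ci - k v1)%C with (RtoC (2 * PI) * Ci)%C by ring.
  rewrite Cmod_mult, Cmod_R, Cmod_Ci, Rabs_right by lra. unfold sg. nra.
- apply (Hom u v1); auto.
  + apply (InD _ rho); [lra|]. unfold Cdisc in Hu1; lra.
  + apply (InD _ rho); [lra|]. replace (v1 - v1)%C with (RtoC 0) by ring. rewrite Cmod_0; lra.
Qed.

(** * Connectedness of discs and openness of components *)

Lemma seg_dist (a b : C) (s t : R) : Cmod (seg a b s - seg a b t) = Rabs (s - t) * Cmod (b - a).
Proof.
rewrite <- Cmod_R, <- Cmod_mult. f_equal. unfold seg. rewrite RtoC_minus. ring.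
Qed.

(** On the segment from a point of [U] to a point of [V], take the supremum of the parameters in
    [U]. Whichever of the two sets contains that point, openness yields a common point or
    contradicts the supremum. *)
Lemma Cdisc_connected (z0 : C) (r : R) : connected_set (Cdisc z0 r).
Proof.
intros U V HU HV Hcov [a [Ha Ua]] [b [Hb Vb]]. apply NNPP. intros N.
assert (Hseg : forall t, 0 <= t <= 1 -> Cdisc z0 r (seg a b t)).
{ intros t Ht. unfold Cdisc, seg in *.
  replace (a + RtoC t * (b - a) - z0)%C with (RtoC (1 - t) * (a - z0) + RtoC t * (b - z0))%C by (rewrite RtoC_minus; ring).
  eapply Rle_lt_trans; [apply Cmod_triangle|]. rewrite !Cmod_mult, !Cmod_R, !Rabs_right by lra.
  assert (Q1 := Rmax_l (Cmod (a - z0)) (Cmod (b - z0))). assert (Q2 := Rmax_r (Cmod (a - z0)) (Cmod (b - z0))).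
  apply Rle_lt_trans with (Rmax (Cmod (a - z0)) (Cmod (b - z0))); [nra|now apply Rmax_lub_lt]. }
assert (Hop : forall (W : C -> Prop) t, @open C_UniformSpace W -> W (seg a b t) ->
   exists d, 0 < d /\ forall s, Rabs (s - t) < d -> W (seg a b s)).
{ intros W t HW Wt. destruct (open_Cmod W _ HW Wt) as [d [Hd H]].
  assert (P := Cmod_ge_0 (b - a)).
  exists (d / (1 + Cmod (b - a))). split; [apply Rdiv_lt_0_compat; lra|].
  intros s Hs. apply H. rewrite seg_dist.
  apply Rle_lt_trans with (Rabs (s - t) * (1 + Cmod (b - a))).
  - apply Rmult_le_compat_l; [apply Rabs_pos|lra].
  - apply Rlt_div_r; lra. }
assert (S0 : seg a b 0 = a) by (unfold seg; ring). assert (S1 : seg a b 1 = b) by (unfold seg; ring).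
destruct (completeness (fun t => 0 <= t <= 1 /\ U (seg a b t))) as [t [T1 T2]].
{ exists 1. intros t [Ht _]. lra. }
{ exists 0. rewrite S0. split; [lra|exact Ua]. }
assert (Ht : 0 <= t <= 1).
{ split; [apply T1; rewrite S0; split; [lra|exact Ua]|]. apply T2. intros s [Hs _]; lra. }
destruct (Hcov _ (Hseg t Ht)) as [HUt|HVt].
- destruct (Hop U t HU HUt) as [d [Hd H]].
  destruct (Req_dec t 1) as [->|Hn].
  + apply N. exists (seg a b 1). repeat split; auto. now rewrite S1.
  + assert (Q : Rmin 1 (t + d / 2) <= t); [|unfold Rmin in Q; destruct (Rle_dec 1 (t + d / 2)); lra].
    apply T1. split.
    * unfold Rmin; destruct (Rle_dec 1 (t + d / 2)); lra.
    * apply H. unfold Rmin; destruct (Rle_dec 1 (t + d / 2)); apply Rabs_def1; lra.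
- destruct (Hop V t HV HVt) as [d [Hd H]].
  assert (Q : t <= t - d / 2); [|lra].
  apply T2. intros s [Hs Us]. apply Rnot_lt_le. intros Hlt. apply N. exists (seg a b s).
  repeat split; auto. apply H. assert (s <= t) by (apply T1; auto). apply Rabs_def1; lra.
Qed.

(** A disc in [S] about a point of [Om] can be adjoined without losing connectedness, so maximality
    puts it inside [Om]. *)
Lemma component_open (S Om : C -> Prop) : @open C_UniformSpace S -> is_component S Om -> @open C_UniformSpace Om.
Proof.
intros HS (_ & H1 & H2 & H3) z Hz. apply locally_C_Cmod.
destruct (open_Cmod S z HS (H1 z Hz)) as [d [Hd HdS]]. exists d. split; auto.
intros w Hw. apply (H3 (fun u => Om u \/ Cdisc z d u)).
- assert (HC := Cdisc_connected z d). assert (Hzd := disc_center z d Hd).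
  intros U V HU HV Hcov HexU HexV.
  assert (K : forall U V : C -> Prop, @open C_UniformSpace U -> @open C_UniformSpace V ->
    (forall u, Om u \/ Cdisc z d u -> U u \/ V u) -> U z -> (exists u, (Om u \/ Cdisc z d u) /\ V u) ->
    exists u, (Om u \/ Cdisc z d u) /\ U u /\ V u).
  { clear U V HU HV Hcov HexU HexV. intros U V HU HV Hcov Uz [p [[Hp|Hp] Vp]].
    - destruct (H2 U V HU HV) as [u [A1 A2]]; eauto.
    - destruct (HC U V HU HV) as [u [A1 A2]]; eauto. }
  destruct (Hcov z (or_introl Hz)) as [Uz|Vz]; [now apply K|].
  destruct (K V U HV HU) as [u [A1 [A2 A3]]]; auto.
  + intros u Hu. destruct (Hcov u Hu); auto.
  + exists u; auto.
- auto.
- intros u [Hu|Hu]; auto.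
- auto.
Qed.

(** * Inverses of injective holomorphic functions *)

(** In this form the derivative of an inverse function becomes a matter of continuity of the
    inverse. *)
Lemma Cder_caratheodory (f g : C -> C) (v : C) (d : R) :
  0 < d -> (forall w, Cmod (w - v) < d -> f w = (f v + (w - v) * g w)%C) -> Ccont g v -> Cder f v (g v).
Proof.
intros Hd E Hg. apply Cder_eps. intros eps He.
destruct (proj1 (Ccont_eps _ _) Hg eps He) as [e [He0 He1]].
exists (Rmin d e). split; [now apply Rmin_pos|]. intros w Hw.
assert (W1 := Rlt_le_trans _ _ _ Hw (Rmin_l _ _)). assert (W2 := Rlt_le_trans _ _ _ Hw (Rmin_r _ _)).
rewrite (E w W1) at 1. replace (f v + (w - v) * g w - f v - (w - v) * g v)%C with ((w - v) * (g w - g v))%C by ring.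
rewrite Cmod_mult, Rmult_comm. apply Rmult_le_compat_r; [apply Cmod_ge_0|]. now apply Rlt_le, He1.
Qed.

(** Total by choice; only the values on the image of [D] carry meaning. *)
Definition inv_on (D : C -> Prop) (f : C -> C) (w : C) : C :=
  epsilon (inhabits (RtoC 0)) (fun z => D z /\ f z = w).

Lemma inv_on_spec (D : C -> Prop) (f : C -> C) (w : C) :
  (exists z, D z /\ f z = w) -> D (inv_on D f w) /\ f (inv_on D f w) = w.
Proof. intros H. unfold inv_on. apply epsilon_spec. exact H. Qed.

(** The nonzero derivative keeps [|f z - f z0|] above a multiple of [|z - z0|], so by
    [disc_covering] arbitrarily small discs about [z0] cover neighbourhoods of [f z0]. This is the
    continuity of the inverse, and its difference quotient is the reciprocal of [dq f z0]. *)
Lemma Cder_inv_on (D : C -> Prop) (f : C -> C) (z0 : C) :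
  @open C_UniformSpace D -> holomorphic_on D f -> (forall z w, D z -> D w -> f z = f w -> z = w) -> D z0 ->
  Cder (inv_on D f) (f z0) (/ C_derive f z0)%C.
Proof.
intros HO Hf Hinj Hz0. set (phi := inv_on D f).
assert (Hphi : forall z, D z -> phi (f z) = z).
{ intros z Hz. destruct (inv_on_spec D f (f z)) as [A1 A2]; [now exists z|]. apply Hinj; auto. }
assert (Hn := injective_derive_neq0 D f z0 HO Hf Hinj Hz0).
destruct (open_Cmod D z0 HO Hz0) as [s [Hs HsD]].
set (m := Cmod (C_derive f z0)). assert (Hm : 0 < m) by now apply Cmod_gt_0.
destruct (proj1 (Cder_eps _ _ _) (hol_Cder D f z0 Hf Hz0) (m / 2) ltac:(lra)) as [e1 [He1 K1]].
assert (Hlow : forall z, Cmod (z - z0) < e1 -> m / 2 * Cmod (z - z0) <= Cmod (f z - f z0)).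
{ intros z Hz. specialize (K1 z Hz).
  replace (f z - f z0)%C with ((z - z0) * C_derive f z0 - - (f z - f z0 - (z - z0) * C_derive f z0))%C by ring.
  eapply Rle_trans; [|apply Cmod_triangle_inv]. rewrite Cmod_mult, Cmod_opp. fold m. lra. }
assert (Hcov : forall e, 0 < e -> exists d, 0 < d /\ forall w, Cmod (w - f z0) < d -> exists z, D z /\ Cmod (z - z0) < e /\ f z = w).
{ intros e He. set (s' := Rmin e (Rmin s e1)). assert (Hs' : 0 < s') by (repeat apply Rmin_pos; auto).
  assert (M1 : s' <= e) by apply Rmin_l.
  assert (M2 : s' <= s) by (eapply Rle_trans; [apply Rmin_r|apply Rmin_l]).
  assert (M3 : s' <= e1) by (eapply Rle_trans; [apply Rmin_r|apply Rmin_r]).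
  exists (m / 2 * (s' / 2) / 2). split; [assert (0 < m * s') by (now apply Rmult_lt_0_compat); lra|].
  intros w Hw. destruct (disc_covering f z0 (s' / 2) s' (m / 2 * (s' / 2)) w) as [z [Z1 Z2]].
  - lra.
  - intros z Hz. apply Hf, HsD. unfold Cdisc in Hz. lra.
  - intros z Hz. specialize (Hlow z ltac:(lra)). rewrite Hz in Hlow. exact Hlow.
  - exact Hw.
  - unfold Cdisc in Z1. exists z. split; [apply HsD; lra|]. split; [lra|auto]. }
destruct (Hcov s Hs) as [d [Hd Hdc]].
assert (Hc : Ccont phi (f z0)).
{ apply Ccont_eps. intros eps He. destruct (Hcov eps He) as [d' [Hd' Hdc']]. exists d'. split; auto.
  intros w Hw. destruct (Hdc' w Hw) as [z [Z1 [Z2 <-]]]. now rewrite !Hphi. }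
assert (G := Cder_caratheodory phi (fun w => / dq f z0 (phi w))%C (f z0) d Hd).
cbv beta in G. rewrite (Hphi z0 Hz0), dq_same in G. apply G.
- intros w Hw. destruct (Hdc w Hw) as [z [Z1 [Z2 <-]]]. rewrite Hphi by auto.
  rewrite <- dq_mult. assert (dq f z0 z <> RtoC 0); [|field; auto].
  destruct (classic (z = z0)) as [->|Hne]; [now rewrite dq_same|]. intros E.
  assert (Q := dq_mult f z0 z). rewrite E in Q. apply Hne, Hinj; auto.
  replace (f z) with ((f z - f z0) + f z0)%C by ring. rewrite <- Q. ring.
- apply (continuous_comp (fun w => dq f z0 (phi w)) Cinv).
  + apply (continuous_comp phi (dq f z0)); [exact Hc|]. rewrite Hphi by auto. apply dq_continuous. now apply Hf.
  + rewrite (Hphi z0 Hz0), dq_same. eapply Cder_continuous. apply Cder_inv. exact Hn.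
Qed.

(** * Distortion of univalent functions on a half-plane *)

Definition halfplane (c : R) (v : C) : Prop := c < Re v.

Lemma halfplane_box (c : R) : box (halfplane c).
Proof.
split.
- intros z Hz. apply locally_C_Cmod. unfold halfplane in *. exists (Re z - c). split; [lra|]. intros w Hw.
  assert (B := re_le_Cmod (w - z)). change (Re (w - z)) with (Re w - Re z) in B. 
  assert (B' := Rle_lt_trans _ _ _ B Hw). apply Rabs_def2 in B'. lra.
- intros z w u Hz Hw [H _] _. unfold halfplane in *. unfold Rmin in H. destruct (Rle_dec (Re z) (Re w)); lra.
Qed.

Lemma disc_halfplane (c : R) (v0 v : C) : Cdisc v0 (Re v0 - c) v -> halfplane c v.
Proof.
unfold Cdisc, halfplane. intros H. assert (B := re_le_Cmod (v - v0)). change (Re (v - v0)) with (Re v - Re v0) in B.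
assert (B' := Rle_lt_trans _ _ _ B H). apply Rabs_def2 in B'. lra.
Qed.

(* A weak form of Koebe's one-quarter theorem: a branch of [log (phi - zeta)] never takes two values
   differing by [2 pi i], so Bloch's bound applies to it. *)
Lemma univalent_omitted (c : R) (phi : C -> C) (zeta v0 : C) :
  holomorphic_on (halfplane c) phi ->
  (forall u v, halfplane c u -> halfplane c v -> phi u = phi v -> u = v) ->
  (forall v, halfplane c v -> phi v <> zeta) -> halfplane c v0 ->
  Cmod (C_derive phi v0) * (Re v0 - c) <= 8192 * PI * Cmod (phi v0 - zeta).
Proof.
intros Hphi Hinj Hom Hv0.
assert (Hh : forall v, halfplane c v -> Cder (fun v => phi v - zeta)%C v (C_derive phi v)).
{ intros v Hv. eapply Cder_eq; [apply Cder_minus; [eapply hol_Cder; eauto|apply Cder_const]|ring]. }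
destruct (holomorphic_log (halfplane c) (fun v => phi v - zeta)%C v0) as [l Hl].
- apply box_rstar; auto. apply halfplane_box.
- intros v Hv. eapply Cder_ex; eauto.
- intros v Hv. apply Cminus_neq0. auto.
- assert (HR : 0 < Re v0 - c) by (unfold halfplane in Hv0; lra).
  assert (B := bloch_bound l v0 (Re v0 - c) HR).
  assert (Hne : (phi v0 - zeta)%C <> RtoC 0) by (apply Cminus_neq0; auto).
  assert (P : 0 < Cmod (phi v0 - zeta)) by now apply Cmod_gt_0.
  assert (Dl : C_derive l v0 = (C_derive phi v0 / (phi v0 - zeta))%C).
  { rewrite (Cder_derive _ _ _ (proj1 (Hl v0 Hv0))). f_equal. apply Cder_derive. now apply Hh. }
  rewrite Dl, Cmod_div in B by auto.
  replace (Cmod (C_derive phi v0) * (Re v0 - c)) with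
    (Cmod (C_derive phi v0) / Cmod (phi v0 - zeta) * (Re v0 - c) * Cmod (phi v0 - zeta)) by (field; lra).
  apply Rmult_le_compat_r; [lra|]. apply B.
  + intros v Hv. apply disc_halfplane in Hv. eapply Cder_ex. exact (proj1 (Hl v Hv)).
  + intros u v Hu Hv E. apply disc_halfplane in Hu. apply disc_halfplane in Hv.
    assert (E2 : u = v).
    { apply Hinj; auto. replace (phi u) with ((phi u - zeta) + zeta)%C by ring.
      rewrite <- (proj2 (Hl u Hu)), E, Cexp_2PI, (proj2 (Hl v Hv)). ring. }
    subst v. apply two_PI_i_neq0. replace (RtoC (2 * PI) * Ci)%C with ((l u + RtoC (2 * PI) * Ci) - l u)%C by ring.
    rewrite <- E. ring.
Qed.

(* The inverse [L] is defined on a disc of radius comparable with [(Re v0 - c) |phi' v0|] and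
   [exp (- (L - v0) / (Re v0 - c))] is bounded there; Cauchy's estimate then controls [L'']. *)
Lemma univalent_distortion (c : R) (Om : C -> Prop) (L : C -> C) :
  @open C_UniformSpace Om -> holomorphic_on Om L ->
  (forall z w, Om z -> Om w -> L z = L w -> z = w) ->
  (forall w, halfplane c w <-> exists z, Om z /\ L z = w) ->
  exists K, 0 < K /\ forall v, halfplane c v ->
    Cmod (C_derive (C_derive (inv_on Om L)) v) * (Re v - c) <= K * Cmod (C_derive (inv_on Om L) v).
Proof.
intros HO HL Hinj Hsurj. set (phi := inv_on Om L).
assert (Hphi : forall v, halfplane c v -> Om (phi v) /\ L (phi v) = v).
{ intros v Hv. apply inv_on_spec. now apply Hsurj. }
assert (HdL := hol_derive Om L HO HL).
assert (Dphi : forall v, halfplane c v -> Cder phi v (/ C_derive L (phi v))%C).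
{ intros v Hv. destruct (Hphi v Hv) as [A1 A2]. rewrite <- A2 at 1. apply Cder_inv_on; auto. }
assert (Hne : forall z, Om z -> C_derive L z <> RtoC 0) by (intros z Hz; apply (injective_derive_neq0 Om); auto).
set (K1 := 8192 * PI). assert (HK1 : 0 < K1) by (unfold K1; generalize PI_RGT_0; lra).
(* The summand [192 * K1 ^ 2] comes from the Cauchy estimate at scale [rho], the summand 1 from the
   square of [L'] in the second derivative of [B]. *)
exists (192 * K1 ^ 2 + 1). split; [assert (0 <= K1 ^ 2) by apply pow2_ge_0; lra|].
intros v0 Hv0. destruct (Hphi v0 Hv0) as [A1 A2]. set (z0 := phi v0) in *.
set (X := C_derive L z0). assert (HX : X <> RtoC 0) by now apply Hne.
assert (HXp : 0 < Cmod X) by now apply Cmod_gt_0.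
set (Rr := Re v0 - c). assert (HR : 0 < Rr) by (unfold Rr, halfplane in *; lra).
assert (E1 : C_derive phi v0 = (/ X)%C) by (apply Cder_derive; now apply Dphi).
(* The classical [phi'' = - L'' / L'^3], which turns the claim into a bound for [L''] at [z0]. *)
assert (D2 : Cder (C_derive phi) v0 (- (C_derive (C_derive L) z0) / (X * X * X))%C).
{ apply (Cder_ext_open (halfplane c) (fun v => / C_derive L (phi v))%C); auto.
  - apply halfplane_box.
  - intros w Hw. symmetry. apply Cder_derive. now apply Dphi.
  - eapply Cder_eq.
    + apply (Cder_comp Cinv (fun v => C_derive L (phi v))); [apply Cder_inv; now apply Hne|].
      apply (Cder_comp (C_derive L) phi); [apply (hol_Cder Om); auto|now apply Dphi].
    + fold z0. fold X. field. auto. }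
set (rho := Rr / (K1 * Cmod X)).
assert (Hrho : 0 < rho) by (apply Rdiv_lt_0_compat; auto; now apply Rmult_lt_0_compat).
assert (HOm : forall z, Cdisc z0 rho z -> Om z).
{ intros z Hz. apply NNPP. intros N.
  assert (Q : Cmod (C_derive phi v0) * (Re v0 - c) <= K1 * Cmod (phi v0 - z)).
  { apply univalent_omitted; auto.
    - intros v Hv. eapply Cder_ex; eauto.
    - intros u v Hu Hv E. rewrite <- (proj2 (Hphi u Hu)), <- (proj2 (Hphi v Hv)). now rewrite E.
    - intros v Hv E. apply N. rewrite <- E. apply Hphi; auto. }
  fold z0 in Q. fold Rr in Q. rewrite E1, Cmod_inv, Cmod_sub_sym in Q by auto.
  unfold Cdisc in Hz. apply (Rmult_lt_compat_l K1) in Hz; auto.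
  replace (K1 * rho) with (/ Cmod X * Rr) in Hz by (unfold rho; field; lra). lra. }
(* As [Re (L z) > c], the real part of the exponent stays below 1; moreover [B z0 = 1]. *)
set (B := fun z => Cexp (- / RtoC Rr * (L z - v0))%C).
assert (HRC : RtoC Rr <> RtoC 0) by (intros E; injection E; lra).
set (kk := (- / RtoC Rr)%C).
assert (DB : forall z, Om z -> Cder B z (kk * (C_derive L z * B z))%C).
{ intros z Hz. unfold B. fold kk. eapply Cder_eq.
  - apply (Cder_comp Cexp (fun z => kk * (L z - v0))%C); [apply Cder_Cexp|].
    apply Cder_scal. apply Cder_minus; [apply (hol_Cder Om); auto|apply Cder_const].
  - ring. }
assert (HB : holomorphic_on Om B) by (intros z Hz; eapply Cder_ex; eauto).
assert (HdB := hol_derive Om B HO HB).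
assert (BB : forall z, Om z -> Cmod (B z) <= 3).
{ intros z Hz. unfold B. rewrite Cmod_Cexp. apply Rle_trans with (exp 1); [|apply exp_le_3].
  replace (Re (- / RtoC Rr * (L z - v0))) with ((Re v0 - Re (L z)) / Rr).
  2: { rewrite <- RtoC_inv by lra. destruct (L z), v0; simpl. field. lra. }
  assert (Q : halfplane c (L z)) by (apply Hsurj; now exists z). unfold halfplane in Q.
  assert (Q2 : (Re v0 - Re (L z)) / Rr < 1) by (apply Rlt_div_l; unfold Rr in *; lra).
  destruct (Rle_lt_or_eq_dec _ _ (Rlt_le _ _ Q2)) as [Q3| ->]; [apply Rlt_le, exp_increasing, Q3|lra]. }
assert (Tri : forall z w a b, Cmod (z - w) <= a -> Cmod (w - z0) <= b -> Cmod (z - z0) <= a + b).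
{ intros z w a b Ha Hb. replace (z - z0)%C with ((z - w) + (w - z0))%C by ring. eapply Rle_trans; [apply Cmod_triangle|]. lra. }
(* Two Cauchy estimates, each over a circle of radius [rho / 4]: the factor [2 * 4 / rho] applied
   twice to the bound 3 gives [192 / rho ^ 2]. *)
assert (C1 : forall z, Cmod (z - z0) <= rho / 4 -> Cmod (C_derive B z) <= 24 / rho).
{ intros z Hz. replace (24 / rho) with (2 * 3 / (rho / 4)) by (field; lra).
  assert (In : forall w, Cmod (w - z) <= rho / 2 -> Om w).
  { intros w Hw. apply HOm. assert (Q := Tri w z _ _ Hw Hz). unfold Cdisc. lra. }
  apply (cauchy_estimate (Cdisc z (rho / 2))).
  - apply disc_rstar; lra.
  - intros w Hw. apply HB, In. unfold Cdisc in Hw; lra.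
  - lra.
  - intros w Hw. unfold Cdisc; lra.
  - intros w Hw. apply BB, In. lra. }
assert (C2 : Cmod (C_derive (C_derive B) z0) <= 192 / rho ^ 2).
{ replace (192 / rho ^ 2) with (2 * (24 / rho) / (rho / 4)) by (field; lra).
  apply (cauchy_estimate (Cdisc z0 rho)).
  - apply disc_rstar; lra.
  - intros w Hw. apply HdB, HOm, Hw.
  - lra.
  - intros w Hw. unfold Cdisc; lra.
  - exact C1. }
assert (E2 : C_derive (C_derive B) z0 = (kk * C_derive (C_derive L) z0 + kk * kk * (X * X))%C).
{ apply Cder_derive. apply (Cder_ext_open Om (fun z => kk * (C_derive L z * B z))%C); auto.
  - intros w Hw. symmetry. apply Cder_derive. auto.
  - eapply Cder_eq.
    + apply Cder_scal. apply (Cder_mult (C_derive L) B); [apply (hol_Cder Om); auto|apply DB; auto].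
    + assert (B0 : B z0 = RtoC 1).
      { unfold B. rewrite A2. replace (- / RtoC Rr * (v0 - v0))%C with (RtoC 0) by ring. apply Cexp_0. }
      rewrite B0. fold X. ring. }
rewrite E2 in C2.
(* [L''] is solved for in [B'' = kk * L'' + kk^2 * L'^2], where [kk = - 1 / Rr]. *)
assert (C3 : Cmod (C_derive (C_derive L) z0) <= Rr * (192 / rho ^ 2) + Cmod X ^ 2 / Rr).
{ replace (C_derive (C_derive L) z0) with
   (- RtoC Rr * (kk * C_derive (C_derive L) z0 + kk * kk * (X * X)) + (X * X) / RtoC Rr)%C by (unfold kk; field; auto).
  eapply Rle_trans; [apply Cmod_triangle|]. rewrite Cmod_mult, Cmod_opp, Cmod_div, Cmod_mult, Cmod_R, Rabs_right by (auto; lra).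
  apply Rplus_le_compat; [apply Rmult_le_compat_l; lra|]. right; simpl; field; lra. }
rewrite (Cder_derive _ _ _ D2), E1, Cmod_div, Cmod_opp, !Cmod_mult, Cmod_inv by (auto; repeat apply Cmult_neq_0; auto).
fold Rr. set (Y := Cmod (C_derive (C_derive L) z0)) in *. set (x := Cmod X) in *.
apply Rle_trans with ((Rr * (192 / rho ^ 2) + x ^ 2 / Rr) / (x * x * x) * Rr).
- apply Rmult_le_compat_r; [lra|]. apply Rmult_le_compat_r; [|exact C3].
  apply Rlt_le, Rinv_0_lt_compat. repeat apply Rmult_lt_0_compat; auto.
- right. unfold rho. field. repeat split; lra.
Qed.

(** * The path *)

Definition quadrant (u : C) : Prop := 0 < Re u /\ 0 < Im u.

Lemma quadrant_box : box quadrant.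
Proof.
split.
- intros z [H1 H2]. apply locally_C_Cmod. exists (Rmin (Re z) (Im z)). split; [now apply Rmin_pos|]. intros w Hw.
  assert (W1 := Rlt_le_trans _ _ _ Hw (Rmin_l _ _)). assert (W2 := Rlt_le_trans _ _ _ Hw (Rmin_r _ _)).
  assert (B := Rle_lt_trans _ _ _ (re_le_Cmod (w - z)) W1). assert (B' := Rle_lt_trans _ _ _ (im_le_Cmod (w - z)) W2).
  change (Re (w - z)) with (Re w - Re z) in B. change (Im (w - z)) with (Im w - Im z) in B'.
  apply Rabs_def2 in B. apply Rabs_def2 in B'. split; lra.
- intros z w u [Z1 Z2] [W1 W2] [H1 _] [H2 _]. split; unfold Rmin in *.
  + destruct (Rle_dec (Re z) (Re w)); lra.
  + destruct (Rle_dec (Im z) (Im w)); lra.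
Qed.

(* Along the segment [log |q|] has derivative at least [Re w / 4], so the derivative of [Z - 2 q] is dominated by
   that of [16 del |q|]. *)
Lemma primitive_near_2q (c1 del : R) (q Z : C -> C) (v0 w : C) :
  0 < del <= 1 / 8 ->
  (forall v, halfplane c1 v -> Cder Z v (q v)) ->
  holomorphic_on (halfplane c1) q -> (forall v, halfplane c1 v -> q v <> RtoC 0) ->
  (forall v, halfplane c1 v -> Cmod (C_derive q v - q v / 2) <= del * Cmod (q v)) ->
  halfplane c1 v0 -> Z v0 = (2 * q v0)%C -> 0 < Re w -> Cmod w <= 2 * Re w ->
  Cmod (Z (v0 + w)%C - 2 * q (v0 + w)%C) <= 16 * del * Cmod (q (v0 + w)%C).
Proof.
intros Hdel HZ Hq Hn Hd Hv0 E0 Hw0 Hw.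
(* With a logarithm [l] of [q], the majorant [|q| = exp (Re l)] is differentiable along the
   segment. *)
destruct (holomorphic_log (halfplane c1) q v0) as [l Hl]; auto.
{ apply box_rstar; auto. apply halfplane_box. }
set (x := fun s : R => (v0 + RtoC s * w)%C).
assert (Hx : forall s, 0 <= s <= 1 -> halfplane c1 (x s)).
{ intros s Hs. unfold halfplane, x in *. replace (Re (v0 + RtoC s * w)) with (Re v0 + s * Re w) by (destruct v0, w; simpl; ring). nra. }
assert (Dx : forall s, Rder x s w).
{ intros s. unfold x. eapply Rder_eq.
  - apply Rder_plus; [apply Rder_const|]. apply (Rder_mult (fun s => RtoC s) (fun _ => w)); [apply Rder_id_RtoC|apply Rder_const].
  - ring. }
assert (M : Cmod ((Z (x 1) - 2 * q (x 1)) - (Z (x 0) - 2 * q (x 0))) <= 16 * del * exp (Re (l (x 1))) - 16 * del * exp (Re (l (x 0)))).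
{ apply (mean_value_le (fun s => Z (x s) - 2 * q (x s))%C (fun s => w * (q (x s) - 2 * C_derive q (x s)))%C
    (fun s => 16 * del * exp (Re (l (x s)))) (fun s => 16 * del * (exp (Re (l (x s))) * Re (w * (C_derive q (x s) / q (x s)))))); [lra| | |].
  - intros s Hs. specialize (Hx s Hs). apply (Rder_comp (fun v => Z v - 2 * q v)%C x); [|apply Dx].
    apply Cder_minus; [now apply HZ|]. apply Cder_scal. now apply (hol_Cder (halfplane c1)).
  - intros s Hs. specialize (Hx s Hs).
    assert (Q := Rder_comp l x s _ _ (proj1 (Hl _ Hx)) (Dx s)). apply Rder_re_im in Q. destruct Q as [Q _].
    apply (is_derive_scal (fun s => exp (Re (l (x s)))) s (16 * del)).
    rewrite Rmult_comm. apply (is_derive_comp (K := R_AbsRing) (V := R_NormedModule) exp (fun s => Re (l (x s)))); [apply is_derive_exp|exact Q].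
  - intros s Hs. specialize (Hx s Hs). specialize (Hd _ Hx). specialize (Hn _ Hx).
    rewrite <- Cmod_Cexp, (proj2 (Hl _ Hx)).
    set (Q := q (x s)) in *. set (Q' := C_derive q (x s)) in *.
    assert (P : 0 < Cmod Q) by now apply Cmod_gt_0.
    rewrite Cmod_mult. replace (Q - 2 * Q')%C with (- (2) * (Q' - Q / 2))%C by field.
    rewrite Cmod_mult, Cmod_opp, Cmod_R, (Rabs_right 2) by lra.
    (* The cone condition enters here: [Re w / 2 - Cmod w * del] is at least
       [Re w / 2 - 2 * Re w / 8]. *)
    assert (L : Re w / 4 <= Re (w * (Q' / Q))).
    { assert (T : Cmod (Q' / Q - / 2) <= del).
      { replace (Q' / Q - / 2)%C with ((Q' - Q / 2) / Q)%C by (field; auto).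
        rewrite Cmod_div by auto. apply Rle_div_l; auto. }
      replace (Re (w * (Q' / Q))) with (Re w / 2 + Re (w * (Q' / Q - / 2))).
      2: { rewrite <- (RtoC_inv 2) by lra. destruct w, (Q' / Q)%C; simpl; field. }
      assert (T2 : Rabs (Re (w * (Q' / Q - / 2))) <= Cmod w * del).
      { eapply Rle_trans; [apply re_le_Cmod|]. rewrite Cmod_mult. apply Rmult_le_compat_l; [apply Cmod_ge_0|auto]. }
      apply Rabs_le_between in T2. assert (N := Cmod_ge_0 w). nra. }
    apply Rle_trans with (2 * Re w * (2 * (del * Cmod Q))).
    + apply Rmult_le_compat; auto using Cmod_ge_0; [|lra]. apply Rmult_le_pos; [lra|apply Cmod_ge_0].
    + apply Rle_trans with (16 * del * (Cmod Q * (Re w / 4))); [right; field|].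
      apply Rmult_le_compat_l; [lra|]. apply Rmult_le_compat_l; lra. }
assert (X0 : x 0 = v0) by (unfold x; ring). assert (X1 : x 1 = (v0 + w)%C) by (unfold x; ring).
assert (H1 : halfplane c1 (x 1)) by (apply Hx; lra).
rewrite <- !Cmod_Cexp, (proj2 (Hl _ H1)), X0, X1, E0 in M.
assert (G := Cmod_ge_0 (Cexp (l v0))).
replace (Z (v0 + w) - 2 * q (v0 + w) - (2 * q v0 - 2 * q v0))%C with (Z (v0 + w) - 2 * q (v0 + w))%C in M by ring.
eapply Rle_trans; [exact M|]. assert (0 <= 16 * del * Cmod (Cexp (l v0))) by (apply Rmult_le_pos; lra). lra.
Qed.

Lemma quadrant_seg (u u' : C) (t : R) : quadrant u -> quadrant u' -> 0 <= t <= 1 -> quadrant (seg u u' t).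
Proof. intros Hu Hu' Ht. apply rstar_seg; auto. now apply box_rstar; [apply quadrant_box|]. Qed.

(** [f] differs from the linear map of slope [(1 - Ci) / 2], of modulus [1 / sqrt 2], by a function
    with Lipschitz constant [1 / 64]; so it expands distances by at least [1 / 2] and covers discs
    of proportional radius. The lower bound on [Re u + Im u] later yields the rate at which the path
    moves to the right. *)
Lemma quadrant_chart (f : C -> C) :
  holomorphic_on quadrant f ->
  (forall u, quadrant u -> Cmod (C_derive f u - (1 - Ci) / 2) <= 1 / 64) ->
  (forall u u', quadrant u -> quadrant u' -> f u = f u' -> u = u') /\
  exists s0, 0 < s0 /\ forall s, s0 < s -> exists u, quadrant u /\ f u = RtoC s /\ s <= Re u + Im u.
Proof.
intros Hf Hd. set (al := ((1 - Ci) / 2)%C) in *.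
assert (Hal2 : Cmod al ^ 2 = 1 / 2).
{ rewrite Cmod2_alt. unfold al. replace ((1 - Ci) / 2)%C with (1 / 2, - (1 / 2)) by (apply injective_projections; simpl; field).
  simpl; field. }
assert (Hal : 7 / 10 <= Cmod al <= 1) by (assert (P := Cmod_ge_0 al); split; nra).
assert (Lin : forall u u', quadrant u -> quadrant u' -> Cmod ((f u' - f u) - al * (u' - u)) <= 1 / 64 * Cmod (u' - u)).
{ intros u u' Hu Hu'. replace ((f u' - f u) - al * (u' - u))%C with ((f u' - al * u') - (f u - al * u))%C by ring.
  apply (seg_mean_value (fun u => f u - al * u)%C (fun u => C_derive f u - al)%C).
  - intros t Ht. eapply Cder_eq; [apply Cder_minus; [apply (hol_Cder quadrant); auto; now apply quadrant_seg|apply Cder_scal, Cder_id]|ring].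
  - intros t Ht. apply Hd. now apply quadrant_seg. }
assert (Low : forall u u', quadrant u -> quadrant u' -> 1 / 2 * Cmod (u' - u) <= Cmod (f u' - f u)).
{ intros u u' Hu Hu'. specialize (Lin u u' Hu Hu').
  replace (f u' - f u)%C with (al * (u' - u) - - ((f u' - f u) - al * (u' - u)))%C by ring.
  eapply Rle_trans; [|apply Cmod_triangle_inv]. rewrite Cmod_opp, Cmod_mult.
  assert (P := Cmod_ge_0 (u' - u)). nra. }
split.
- intros u u' Hu Hu' E. specialize (Low u' u Hu' Hu). rewrite E in Low.
  replace (f u' - f u')%C with (RtoC 0) in Low by ring. rewrite Cmod_0 in Low.
  assert (P := Cmod_ge_0 (u - u')). assert (Z : Cmod (u - u') = 0) by lra. apply Cmod_eq_0 in Z.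
  replace u with ((u - u') + u')%C by ring. rewrite Z. ring.
- set (d1 := (1 + Ci)%C). assert (Hd1 : quadrant d1) by (unfold d1, quadrant; simpl; lra).
  set (kap := Cmod (f d1)). assert (Hk : 0 <= kap) by apply Cmod_ge_0.
  (* [f us] misses [s] by at most [s / 32 + 1 + kap], which is then below the covered radius
     [s / 16]. *)
  exists (64 * (kap + 1)). split; [lra|]. intros s Hs.
  set (us := (RtoC s * d1)%C).
  assert (Hus : Re us = s /\ Im us = s) by (unfold us, d1; simpl; split; ring). destruct Hus as [Hus1 Hus2].
  assert (InQ : forall u, Cdisc us (s / 2) u -> quadrant u /\ s <= Re u + Im u).
  { intros u Hu. unfold Cdisc in Hu.
    assert (B := Rle_lt_trans _ _ _ (re_le_Cmod (u - us)) Hu). assert (B' := Rle_lt_trans _ _ _ (im_le_Cmod (u - us)) Hu).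
    change (Re (u - us)) with (Re u - Re us) in B. change (Im (u - us)) with (Im u - Im us) in B'.
    apply Rabs_def2 in B. apply Rabs_def2 in B'. unfold quadrant. lra. }
  assert (Hus : quadrant us) by (unfold quadrant; lra).
  destruct (disc_covering f us (s / 4) (s / 2) (s / 8) (RtoC s)) as [u [U1 U2]].
  + lra.
  + intros u Hu. apply Hf. now apply InQ.
  + intros u Hu. apply Rle_trans with (1 / 2 * Cmod (u - us)); [rewrite Hu; lra|].
    apply Low; auto. apply InQ. unfold Cdisc. lra.
  + specialize (Lin d1 us Hd1 Hus).
    assert (N1 : Cmod (us - d1) <= 2 * s).
    { eapply Rle_trans; [apply Cmod_le_Rabs|]. change (Re (us - d1)) with (Re us - Re d1). change (Im (us - d1)) with (Im us - Im d1).
      rewrite Hus1, Hus2. unfold d1; simpl. rewrite !Rabs_right; lra. }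
    assert (E1 : (al * (us - d1))%C = RtoC (s - 1)).
    { unfold al, us, d1. apply injective_projections; simpl; field. }
    rewrite E1 in Lin.
    replace (RtoC s - f us)%C with (- ((f us - f d1) - RtoC (s - 1)) + (1 - f d1))%C by (rewrite RtoC_minus; ring).
    eapply Rle_lt_trans; [apply Cmod_triangle|]. rewrite Cmod_opp.
    assert (N2 : Cmod (1 - f d1) <= 1 + kap).
    { unfold Cminus. eapply Rle_trans; [apply Cmod_triangle|]. rewrite Cmod_opp, Cmod_1. unfold kap; lra. }
    lra.
  + exists u. destruct (InQ u U1). auto.
Qed.

(* The path is a real level line of the primitive [Z] of [q], parametrised by [Z = t]. *)
Lemma real_trajectory (c K : R) (q : C -> C) :
  0 < K -> holomorphic_on (halfplane c) q -> (forall v, halfplane c v -> q v <> RtoC 0) ->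
  (forall v, halfplane c v -> Cmod (C_derive q v - q v / 2) * (Re v - c) <= K * Cmod (q v)) ->
  exists (v : R -> C) (t0 : R), 0 < t0 /\
    (forall t, t0 < t -> halfplane c (v t) /\ Rder v t (/ q (v t))%C /\ t <= 4 * Cmod (q (v t)) /\
       Cmod (C_derive q (v t)) <= Cmod (q (v t)) /\ ln t + c <= Re (v t)).
Proof.
intros HK Hq Hn Hd.
(* Beyond [c1] the quotient [q' / q] is within [1 / 1024] of [1 / 2]; the factor 16 lost in
   [primitive_near_2q] leaves the [1 / 64] that [quadrant_chart] tolerates. *)
set (c1 := c + 1024 * K). set (v0 := (c1 + 1, 0) : C).
assert (Hsub : forall v, halfplane c1 v -> halfplane c v) by (unfold halfplane, c1; intros; lra).
assert (Hd1 : forall v, halfplane c1 v -> Cmod (C_derive q v - q v / 2) <= 1 / 1024 * Cmod (q v)).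
{ intros v Hv. specialize (Hd v (Hsub v Hv)). unfold halfplane, c1 in Hv.
  assert (P := Cmod_ge_0 (C_derive q v - q v / 2)).
  apply (Rmult_le_reg_r (1024 * K)); [lra|]. nra. }
assert (Hq1 := hol_subset _ _ _ Hsub Hq).
assert (Hv0 : halfplane c1 v0) by (unfold halfplane; simpl; lra).
destruct (rstar_primitive (halfplane c) q v0) as [Z0 HZ0].
{ apply box_rstar; [apply halfplane_box|]. auto. }
{ intros z Hz. now apply (hol_cont (halfplane c)). }
{ intros z Hz _. auto. }
(* The constant of integration makes the difference [Z - 2 * q] start from 0 at [v0]. *)
set (Z := fun v => (Z0 v + (2 * q v0 - Z0 v0))%C).
assert (HZ : forall v, halfplane c v -> Cder Z v (q v)).
{ intros v Hv. eapply Cder_eq; [apply Cder_plus; [apply HZ0, Hv|apply Cder_const]|ring]. }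
assert (EZ : Z v0 = (2 * q v0)%C) by (unfold Z; ring).
(* [v0 + (1 - i) u], with [u] in the first quadrant, runs over the cone [|arg (v - v0)| < pi / 4]: this makes the cone a box. *)
set (om := fun u : C => ((1 - Ci) * u)%C).
assert (Hom : forall u, Re (om u) = Re u + Im u /\ Im (om u) = Im u - Re u).
{ intros [a b]. unfold om; simpl. split; ring. }
assert (Hcone : forall u, quadrant u -> 0 < Re (om u) /\ Cmod (om u) <= 2 * Re (om u)).
{ intros u [H1 H2]. destruct (Hom u) as [E1 E2]. rewrite E1. split; [lra|].
  eapply Rle_trans; [apply Cmod_le_Rabs|]. rewrite E1, E2. rewrite (Rabs_right (Re u + Im u)) by lra.
  assert (Rabs (Im u - Re u) <= Re u + Im u) by (apply Rabs_le; lra). lra. }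
set (x := fun u => (v0 + om u)%C).
assert (Hx1 : forall u, quadrant u -> halfplane c1 (x u) /\ Re (x u) = c1 + 1 + (Re u + Im u)).
{ intros u Hu. assert (E : Re (x u) = c1 + 1 + (Re u + Im u)).
  { unfold x. destruct (Hom u) as [E1 E2]. rewrite <- E1. reflexivity. }
  split; auto. unfold halfplane. rewrite E. destruct Hu. lra. }
assert (Dx : forall u, Cder x u (1 - Ci)%C).
{ intros u. unfold x, om. eapply Cder_eq; [apply Cder_plus; [apply Cder_const|apply Cder_scal, Cder_id]|ring]. }
assert (Near : forall u, quadrant u -> Cmod (Z (x u) - 2 * q (x u)) <= 1 / 64 * Cmod (q (x u))).
{ intros u Hu. destruct (Hcone u Hu) as [C1 C2]. replace (1 / 64) with (16 * (1 / 1024)) by field.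
  apply (primitive_near_2q c1 (1 / 1024) q Z v0 (om u)); auto; lra. }
assert (Comp : forall u, quadrant u -> 0 < Cmod (q (x u)) /\ Cmod (q (x u)) <= Cmod (Z (x u)) <= 4 * Cmod (q (x u))).
{ intros u Hu. specialize (Near u Hu). destruct (Hx1 u Hu) as [X1 _].
  assert (P : 0 < Cmod (q (x u))) by (apply Cmod_gt_0; auto).
  assert (T1 : Cmod (2 * q (x u)) = 2 * Cmod (q (x u))) by (rewrite Cmod_mult, Cmod_R, Rabs_right; lra).
  assert (T2 := Cmod_triangle_inv (Z (x u)) (2 * q (x u))). assert (T3 := Cmod_triangle_inv (2 * q (x u)) (Z (x u))).
  rewrite Cmod_sub_sym in T3. repeat split; lra. }
assert (ZN : forall u, quadrant u -> Z (x u) <> RtoC 0).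
{ intros u Hu. apply Cmod_gt_0. destruct (Comp u Hu). lra. }
assert (DZ : forall u, quadrant u -> Cder (fun u => Z (x u)) u ((1 - Ci) * q (x u))%C).
{ intros u Hu. apply (Cder_comp Z x); [|apply Dx]. apply HZ. apply Hsub, Hx1, Hu. }
(* [f] is [log Z] in the coordinate [u]; its derivative [(1 - i) q / Z] is close to [(1 - i) / 2]
   because [Z] is close to [2 * q]. *)
destruct (holomorphic_log quadrant (fun u => Z (x u)) (1 + Ci)%C) as [f Hf]; auto.
{ apply box_rstar; [apply quadrant_box|]. split; simpl; lra. }
{ intros u Hu. eapply Cder_ex; eauto. }
assert (Df : forall u, quadrant u -> C_derive f u = ((1 - Ci) * q (x u) / Z (x u))%C).
{ intros u Hu. rewrite (Cder_derive _ _ _ (proj1 (Hf u Hu))). f_equal. apply Cder_derive. now apply DZ. }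
assert (holf : holomorphic_on quadrant f) by (intros u Hu; eapply Cder_ex; apply Hf, Hu).
destruct (quadrant_chart f holf) as [Hinj [s0 [Hs0 Hcov]]].
{ intros u Hu. rewrite Df by auto. specialize (Near u Hu). specialize (ZN u Hu). destruct (Comp u Hu) as [P1 [P2 _]].
  replace ((1 - Ci) * q (x u) / Z (x u) - (1 - Ci) / 2)%C with (- ((1 - Ci) / 2) * ((Z (x u) - 2 * q (x u)) / Z (x u)))%C by (field; auto).
  rewrite Cmod_mult, Cmod_opp, (Cmod_div (Z (x u) - 2 * q (x u))) by auto.
  assert (A1 : Cmod ((1 - Ci) / 2) <= 1).
  { eapply Rle_trans; [apply Cmod_le_Rabs|]. replace ((1 - Ci) / 2)%C with (1 / 2, - (1 / 2)) by (apply injective_projections; simpl; field).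
    simpl. rewrite Rabs_right, Rabs_left; lra. }
  assert (A2 : Cmod (Z (x u) - 2 * q (x u)) / Cmod (Z (x u)) <= 1 / 64).
  { apply Rle_div_l; [lra|]. apply Rle_trans with (1 := Near). apply Rmult_le_compat_l; lra. }
  assert (A3 : 0 <= Cmod (Z (x u) - 2 * q (x u)) / Cmod (Z (x u))).
  { apply Rmult_le_pos; [apply Cmod_ge_0|apply Rlt_le, Rinv_0_lt_compat; lra]. }
  assert (A4 := Cmod_ge_0 ((1 - Ci) / 2)). nra. }
(* [f u = ln t] means [Z = t] on the path. *)
set (U := fun t : R => inv_on quadrant f (RtoC (ln t))).
assert (HU : forall t, exp s0 < t -> quadrant (U t) /\ f (U t) = RtoC (ln t) /\ ln t <= Re (U t) + Im (U t)).
{ intros t Ht. assert (Hs : s0 < ln t).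
  { rewrite <- (ln_exp s0). apply ln_increasing; [apply exp_pos|auto]. }
  destruct (Hcov _ Hs) as [u [U1 [U2 U3]]].
  destruct (inv_on_spec quadrant f (RtoC (ln t))) as [V1 V2]; [now exists u|]. fold (U t) in V1, V2.
  repeat split; auto; try apply V1. replace (U t) with u; auto. apply Hinj; auto. now rewrite U2, V2. }
exists (fun t => x (U t)), (exp s0). split; [apply exp_pos|].
intros t Ht. destruct (HU t Ht) as [U1 [U2 U3]]. assert (Ht0 : 0 < t) by (generalize (exp_pos s0); lra).
destruct (Hx1 _ U1) as [X1 X2]. destruct (Comp _ U1) as [P1 [P2 P3]].
assert (EZt : Z (x (U t)) = RtoC t).
{ rewrite <- (proj2 (Hf _ U1)), U2. unfold Cexp. simpl. rewrite cos_0, sin_0, exp_ln by auto.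
  apply injective_projections; simpl; ring. }
split; [auto|]. split; [|split; [|split]].
- assert (Hne := Hn _ (Hsub _ X1)).
  assert (Htc : RtoC t <> RtoC 0) by (intros E; injection E; lra).
  assert (H1i : (1 - Ci)%C <> RtoC 0) by (intros E; apply (f_equal Re) in E; simpl in E; lra).
  assert (Dln : Rder (fun t => RtoC (ln t)) t (RtoC (/ t))).
  { apply Rder_RtoC. now apply is_derive_ln. }
  (* The factor [1 / t] cancels the [Z = t] in [1 / f'], which leaves velocity [1 / q] for the
     path. *)
  assert (DU : Rder U t (RtoC (/ t) * / C_derive f (U t))%C).
  { unfold U at 1. apply (Rder_comp (inv_on quadrant f) (fun t => RtoC (ln t))); [|exact Dln].
    rewrite <- U2. apply Cder_inv_on; auto. apply quadrant_box. }
  eapply Rder_eq; [apply (Rder_comp x U); [apply Dx|exact DU]|].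
  rewrite Df, EZt, RtoC_inv by (auto; lra). field. auto.
- rewrite EZt, Cmod_R, Rabs_right in P3; lra.
- specialize (Hd1 _ X1). replace (C_derive q (x (U t))) with ((C_derive q (x (U t)) - q (x (U t)) / 2) + q (x (U t)) / 2)%C by ring.
  eapply Rle_trans; [apply Cmod_triangle|].
  rewrite Cmod_div, Cmod_R, Rabs_right by (try lra; intros E; injection E; lra). lra.
- rewrite X2. unfold c1. lra.
Qed.

(** * Liouville's transformation and the energy bound *)

Lemma Rder_Cmod2 (p : R -> C) (t : R) (l : C) : Rder p t l ->
  is_derive (fun t => Cmod (p t) ^ 2) t (2 * (Re (p t) * Re l + Im (p t) * Im l)).
Proof.
intros H. apply Rder_re_im in H. destruct H as [H1 H2].
apply (is_derive_ext (fun t => Re (p t) * Re (p t) + Im (p t) * Im (p t))).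
- intros s. rewrite Cmod2_alt. change (Re (p s) * Re (p s) + Im (p s) * Im (p s) = Re (p s) ^ 2 + Im (p s) ^ 2). ring.
- replace (2 * (Re (p t) * Re l + Im (p t) * Im l)) with
   ((Re l * Re (p t) + Re (p t) * Re l) + (Im l * Im (p t) + Im (p t) * Im l)) by ring.
  exact (is_derive_plus (V := R_NormedModule) _ _ _ _ _
    (is_derive_mult _ _ _ _ _ H1 H1 Rmult_comm) (is_derive_mult _ _ _ _ _ H2 H2 Rmult_comm)).
Qed.

(* Gronwall for the energy [|p|^2 + |p'|^2]. *)
Lemma perturbed_oscillator_bounded (p p' psi : R -> C) (k t1 : R) :
  0 < t1 -> 0 <= k ->
  (forall t, t1 <= t -> Rder p t (p' t)) ->
  (forall t, t1 <= t -> Rder p' t (p t * (psi t - 1))%C) ->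
  (forall t, t1 <= t -> Cmod (psi t) <= k / t ^ 2) ->
  exists B, 0 < B /\ forall t, t1 <= t -> Cmod (p t) <= B.
Proof.
intros Ht1 Hk Hp Hp' Hpsi.
set (E := fun t => Cmod (p t) ^ 2 + Cmod (p' t) ^ 2).
set (dE := fun t => 2 * (Re (p t) * Re (p' t) + Im (p t) * Im (p' t)) +
  2 * (Re (p' t) * Re (p t * (psi t - 1)) + Im (p' t) * Im (p t * (psi t - 1)))).
assert (DE : forall t, t1 <= t -> is_derive E t (dE t)).
{ intros t Ht. apply (is_derive_plus (V := R_NormedModule)); apply Rder_Cmod2; auto. }
assert (BE : forall t, t1 <= t -> dE t <= k / t ^ 2 * E t).
{ intros t Ht.
  (* The unperturbed oscillator conserves the energy, so only the term with [psi] survives. *)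
  assert (Q : dE t = 2 * Re (Cconj (p' t) * (p t * psi t))).
  { unfold dE. destruct (p t), (p' t), (psi t); simpl; ring. }
  rewrite Q. apply Rle_trans with (2 * (Cmod (p' t) * (Cmod (p t) * Cmod (psi t)))).
  - apply Rmult_le_compat_l; [lra|]. eapply Rle_trans; [apply Rle_abs|]. eapply Rle_trans; [apply re_le_Cmod|].
    rewrite !Cmod_mult, Cmod_conj. lra.
  - specialize (Hpsi t Ht). unfold E. set (a := Cmod (p t)) in *. set (b := Cmod (p' t)) in *. set (m := Cmod (psi t)) in *.
    assert (A0 : 0 <= a) by apply Cmod_ge_0. assert (B0 : 0 <= b) by apply Cmod_ge_0. assert (M0 : 0 <= m) by apply Cmod_ge_0.
    apply Rle_trans with (m * (a ^ 2 + b ^ 2)).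
    + assert (0 <= (a - b) ^ 2) by apply pow2_ge_0. nra.
    + apply Rmult_le_compat_r; auto. assert (0 <= a ^ 2) by apply pow2_ge_0. assert (0 <= b ^ 2) by apply pow2_ge_0. lra. }
(* [exp (k / t)] is the integrating factor; it stays bounded because [1 / t^2] is integrable at
   infinity. *)
assert (Hmono : forall t, t1 <= t -> E t * exp (k / t) <= E t1 * exp (k / t1)).
{ intros t Ht.
  apply (is_derive_le_incr (fun t => E t * exp (k / t)) (fun t => dE t * exp (k / t) + E t * (exp (k / t) * (- k / t ^ 2)))); auto.
  - intros s Hs. assert (Dx : is_derive (fun s => exp (k / s)) s (exp (k / s) * (- k / s ^ 2))) by (auto_derive; [lra|unfold Rdiv; field; lra]).
    exact (is_derive_mult (K := R_AbsRing) E (fun s => exp (k / s)) s _ _ (DE s (proj1 Hs)) Dx Rmult_comm).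
  - intros s Hs. specialize (BE s ltac:(lra)). assert (P := exp_pos (k / s)).
    replace (dE s * exp (k / s) + E s * (exp (k / s) * (- k / s ^ 2))) with (exp (k / s) * (dE s - k / s ^ 2 * E s)) by (field; lra).
    assert (dE s - k / s ^ 2 * E s <= 0) by lra. nra. }
set (B := E t1 * exp (k / t1)).
assert (E0 : forall t, 0 <= E t) by (intros t; unfold E; assert (P1 := pow2_ge_0 (Cmod (p t))); assert (P2 := pow2_ge_0 (Cmod (p' t))); lra).
assert (B0 : 0 <= B) by (apply Rmult_le_pos; [apply E0|apply Rlt_le, exp_pos]).
(* [|p|^2 <= B] implies [|p| <= 1 + B]. *)
exists (1 + B). split; [lra|]. intros t Ht.
assert (HE : E t <= B).
{ apply Rle_trans with (2 := Hmono t Ht). rewrite <- (Rmult_1_r (E t)) at 1. apply Rmult_le_compat_l; auto.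
  rewrite <- exp_0. assert (0 <= k / t) by (apply Rmult_le_pos; [lra|apply Rlt_le, Rinv_0_lt_compat; lra]).
  destruct (Req_dec 0 (k / t)) as [<-|Hn]; [lra|]. apply Rlt_le, exp_increasing. lra. }
assert (P2 := pow2_ge_0 (Cmod (p' t))). unfold E in HE. assert (P := Cmod_ge_0 (p t)). nra.
Qed.

Lemma Rder_div (f g : R -> C) (t : R) (a b : C) :
  Rder f t a -> Rder g t b -> g t <> RtoC 0 ->
  Rder (fun s => f s / g s)%C t ((a * g t - f t * b) / (g t * g t))%C.
Proof.
intros Hf Hg H0. eapply Rder_eq.
- apply (Rder_mult f (fun s => / g s)%C); [exact Hf|].
  apply (Rder_comp Cinv g); [apply Cder_inv, H0|exact Hg].
- field; auto.
Qed.

(* Liouville's transformation: with [q = A^(1/2) dz/dv] and time [t] the real parameter [\int A^(1/2) dz],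
   the function [p = A^(1/4) y] satisfies [p'' = p (g^2 + g' - 1)], where [g = 1 / (4 q)]. *)
Lemma liouville_bound (A phi q : C -> C) (c t0 : R) (v : R -> C) (y : C -> C) :
  0 < t0 ->
  (forall w, halfplane c w -> A (phi w) = Cexp w /\ Cder phi w (q w / Cexp (w / 2))%C) ->
  holomorphic_on (halfplane c) q -> (forall w, halfplane c w -> q w <> RtoC 0) ->
  (forall t, t0 < t -> halfplane c (v t) /\ Rder v t (/ q (v t))%C /\ t <= 4 * Cmod (q (v t)) /\
     Cmod (C_derive q (v t)) <= Cmod (q (v t))) ->
  solves_ode A y ->
  exists B, 0 < B /\ forall t, t0 + 1 <= t -> Cmod (y (phi (v t))) <= B * exp (- Re (v t) / 4).
Proof.
intros Ht0 Hphi Hq Hqn Hv [Hy [Hdy Hode]].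
assert (F4 : RtoC 4 <> RtoC 0) by (intros E; injection E; lra).
assert (F2 : RtoC 2 <> RtoC 0) by (intros E; injection E; lra).
(* The branch of [A^(1/4)] along the path that the variable [v] provides, since
   [A (phi v) = exp v]. *)
set (e := fun t => Cexp (v t / 4)).
set (g := fun t => (/ (4 * q (v t)))%C).
set (Y := fun t => y (phi (v t))). set (Y1 := fun t => C_derive y (phi (v t))).
(* This is [g^2 + g'], with [g' = - q' / (4 q^3)] computed from [v' = 1 / q]; [g] is the logarithmic
   derivative of [e]. *)
set (psi := fun t => (g t * g t - C_derive q (v t) / (4 * (q (v t) * q (v t) * q (v t))))%C).
assert (en : forall t, e t <> RtoC 0) by (intros; apply Cexp_neq_0).
assert (e2 : forall t, Cexp (v t / 2) = (e t * e t)%C).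
{ intros t. unfold e. rewrite <- Cexp_plus. f_equal. field; auto. }
assert (e4 : forall t, Cexp (v t) = (e t * e t * (e t * e t))%C).
{ intros t. rewrite <- !e2, <- Cexp_plus. f_equal. field; auto. }
assert (qn : forall t, t0 < t -> q (v t) <> RtoC 0) by (intros t Ht; apply Hqn; apply Hv; auto).
assert (De : forall t, t0 < t -> Rder e t (e t * g t)%C).
{ intros t Ht. destruct (Hv t Ht) as [V1 [V2 _]]. eapply Rder_eq.
  - apply (Rder_comp (fun w => Cexp (w / 4)) v); [|exact V2].
    apply (Cder_comp Cexp (fun w => w / 4)%C); [apply Cder_Cexp|].
    apply (Cder_mult (fun w => w) (fun _ => / 4)%C); [apply Cder_id|apply Cder_const].
  - unfold g. change (Cexp (v t / 4)) with (e t). specialize (qn t Ht). field; auto. }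
assert (Dg : forall t, t0 < t -> Rder g t (psi t - g t * g t)%C).
{ intros t Ht. destruct (Hv t Ht) as [V1 [V2 _]]. specialize (qn t Ht). eapply Rder_eq.
  - apply (Rder_comp (fun w => / (4 * q w))%C v); [|exact V2].
    apply (Cder_comp Cinv (fun w => 4 * q w)%C); [apply Cder_inv; now apply Cmult_neq_0|].
    apply Cder_scal. apply (hol_Cder (halfplane c)); auto.
  - unfold psi, g. field; auto. }
assert (Dz : forall t, t0 < t -> Rder (fun t => phi (v t)) t (/ (e t * e t))%C).
{ intros t Ht. destruct (Hv t Ht) as [V1 [V2 _]]. specialize (qn t Ht). eapply Rder_eq.
  - apply (Rder_comp phi v); [apply Hphi; auto|exact V2].
  - rewrite e2. field; auto. }
assert (DY : forall t, t0 < t -> Rder Y t (Y1 t / (e t * e t))%C).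
{ intros t Ht. eapply Rder_eq; [apply (Rder_comp y (fun t => phi (v t))); [apply (hol_Cder (fun _ => True)); auto|now apply Dz]|].
  unfold Y1. field; auto. }
assert (DY1 : forall t, t0 < t -> Rder Y1 t (- (e t * e t * Y t))%C).
{ intros t Ht. eapply Rder_eq; [apply (Rder_comp (C_derive y) (fun t => phi (v t))); [apply (hol_Cder (fun _ => True)); auto|now apply Dz]|].
  destruct (Hv t Ht) as [V1 _]. specialize (Hode (phi (v t))). rewrite (proj1 (Hphi _ V1)), e4 in Hode. fold (Y t) in Hode.
  set (D2 := C_derive (C_derive y) (phi (v t))) in *.
  replace D2 with ((D2 + e t * e t * (e t * e t) * Y t) - e t * e t * (e t * e t) * Y t)%C by ring. rewrite Hode. field; auto. }
(* In the second derivative of [e * Y] the two terms containing [g * Y1] cancel. The 5 arises from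
   [|g|^2 + |g'| <= 1 / (16 m^2) + 1 / (4 m^2)], where [m = |q|] and [t <= 4 * m]. *)
destruct (perturbed_oscillator_bounded (fun t => e t * Y t)%C (fun t => e t * g t * Y t + Y1 t / e t)%C psi 5 (t0 + 1)) as [B [HB0 HB]].
- lra.
- lra.
- intros t Ht. eapply Rder_eq; [apply (Rder_mult e Y); [apply De|apply DY]; lra|]. field; auto.
- intros t Ht. assert (Ht' : t0 < t) by lra. eapply Rder_eq.
  + apply Rder_plus; [apply (Rder_mult (fun t => e t * g t)%C Y); [apply (Rder_mult e g); auto|auto]|].
    apply (Rder_div Y1 e); auto.
  + cbv beta. field; auto.
- intros t Ht. destruct (Hv t ltac:(lra)) as (V1 & _ & V3 & V4). specialize (qn t ltac:(lra)).
  set (m := Cmod (q (v t))) in *.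
  assert (Hm : 0 < m) by now apply Cmod_gt_0.
  assert (G1 : Cmod (g t) = / (4 * m)).
  { unfold g. rewrite Cmod_inv by (now apply Cmult_neq_0). rewrite Cmod_mult, Cmod_R, Rabs_right by lra. reflexivity. }
  assert (G2 : / (4 * m) <= / t) by (apply Rinv_le_contravar; lra).
  assert (G3 : 0 < / (4 * m)) by (apply Rinv_0_lt_compat; lra).
  unfold psi, Cminus. eapply Rle_trans; [apply Cmod_triangle|]. rewrite Cmod_opp, Cmod_mult, G1, Cmod_div by (repeat apply Cmult_neq_0; auto).
  rewrite !Cmod_mult, Cmod_R, (Rabs_right 4) by lra. fold m.
  apply Rle_trans with (/ (4 * m) * / (4 * m) + m / (4 * (m * m * m))).
  + apply Rplus_le_compat_l. apply Rmult_le_compat_r; auto. apply Rlt_le, Rinv_0_lt_compat. repeat apply Rmult_lt_0_compat; lra.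
  + replace (/ (4 * m) * / (4 * m) + m / (4 * (m * m * m))) with (5 * (/ (4 * m) * / (4 * m))) by (field; lra).
    replace (5 / t ^ 2) with (5 * (/ t * / t)) by (field; lra). apply Rmult_le_compat_l; [lra|]. apply Rmult_le_compat; lra.
- exists B. split; auto. intros t Ht. specialize (HB t Ht). rewrite Cmod_mult in HB. unfold e in HB. rewrite Cmod_Cexp in HB.
  replace (Re (v t / 4)) with (Re (v t) / 4) in HB.
  2: { unfold Cdiv. rewrite <- RtoC_inv by lra. destruct (v t); simpl; field. }
  replace (- Re (v t) / 4) with (- (Re (v t) / 4)) by field. rewrite exp_Ropp.
  fold (Y t). assert (P := exp_pos (Re (v t) / 4)). apply Rle_div_r; auto. rewrite Rmult_comm. exact HB.
Qed.

(** * The path in the tract and the decay of all solutions *)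

Theorem theorem1p3 (A : C -> C) (gamma : R -> C)
    (hA : transcendental_entire A)
    (hsing : logarithmic_singularity_infty A gamma) :
  exists (M : R) (Omega : C -> Prop) (Gamma : R -> C),
    0 < M /\
    singularity_neighbourhood A gamma M Omega /\
    path_to_infinity Gamma /\
    (forall t : R, 0 <= t -> Omega (Gamma t)) /\
    (forall y : C -> C, solves_ode A y ->
       filterlim (fun t : R => y (Gamma t)) (Rbar_locally p_infty) (locally (RtoC 0))).
Proof.
destruct hA as [hA _].
destruct hsing as [_ (M & Om & L & HM & Hnb & HL & HLexp & Hinj & Hsurj)].
assert (cA : forall z, Ccont A z) by (intros z; apply (hol_cont (fun _ => True)); auto).
assert (HO : @open C_UniformSpace Om).
{ apply (component_open (fun z => M < Cmod (A z))); [|apply Hnb].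
  intros z Hz. destruct (proj1 (Ccont_eps _ _) (cA z) (Cmod (A z) - M) ltac:(lra)) as [d [Hd H]].
  apply locally_C_Cmod. exists d. split; auto. intros w Hw. specialize (H w Hw). rewrite Cmod_sub_sym in H.
  assert (T := Cmod_triangle_inv (A z) (A z - A w)). replace (A z - (A z - A w))%C with (A w) in T by ring. lra. }
set (c := ln M). set (phi := inv_on Om L).
assert (Hsurj' : forall w, halfplane c w <-> exists z, Om z /\ L z = w) by exact Hsurj.
destruct (univalent_distortion c Om L HO HL Hinj Hsurj') as [K [HK HKd]]. fold phi in HKd.
assert (Hphi : forall v, halfplane c v -> Om (phi v) /\ L (phi v) = v).
{ intros v Hv. apply inv_on_spec. now apply Hsurj'. }
assert (HLn : forall z, Om z -> C_derive L z <> RtoC 0) by (intros z Hz; apply (injective_derive_neq0 Om); auto).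
assert (Dphi : forall v, halfplane c v -> Cder phi v (/ C_derive L (phi v))%C).
{ intros v Hv. destruct (Hphi v Hv) as [A1 A2]. rewrite <- A2 at 1. apply Cder_inv_on; auto. }
assert (Ephi : forall v, halfplane c v -> C_derive phi v = (/ C_derive L (phi v))%C) by (intros; apply Cder_derive; auto).
assert (holphi : holomorphic_on (halfplane c) phi) by (intros v Hv; eapply Cder_ex; eauto).
assert (holdphi := hol_derive _ phi (proj1 (halfplane_box c)) holphi).
assert (F2 : RtoC 2 <> RtoC 0) by (intros E; injection E; lra).
set (q := fun v => (Cexp (v / 2) * C_derive phi v)%C).
(* Differentiating [exp (v / 2)] contributes exactly [q / 2], so the distortion bound on [phi''] is
   the hypothesis on [q] in [real_trajectory]. *)
assert (Dq : forall v, halfplane c v -> Cder q v (q v / 2 + Cexp (v / 2) * C_derive (C_derive phi) v)%C).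
{ intros v Hv. eapply Cder_eq.
  - apply (Cder_mult (fun v => Cexp (v / 2)) (C_derive phi)); [|apply (hol_Cder (halfplane c)); auto].
    apply (Cder_comp Cexp (fun v => v / 2)%C); [apply Cder_Cexp|].
    apply (Cder_mult (fun v => v) (fun _ => / 2)%C); [apply Cder_id|apply Cder_const].
  - unfold q. field; auto. }
assert (holq : holomorphic_on (halfplane c) q) by (intros v Hv; eapply Cder_ex; eauto).
assert (qn : forall v, halfplane c v -> q v <> RtoC 0).
{ intros v Hv. unfold q. rewrite Ephi by auto. apply Cmult_neq_0; [apply Cexp_neq_0|].
  assert (Q := HLn _ (proj1 (Hphi v Hv))). intros E. apply (f_equal (Cmult (C_derive L (phi v)))) in E.
  rewrite Cinv_r in E by auto. apply (f_equal Re) in E. simpl in E. lra. }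
destruct (real_trajectory c K q HK holq qn) as (v & t0 & Ht0 & Hv).
{ intros w Hw. rewrite (Cder_derive _ _ _ (Dq w Hw)).
  replace (q w / 2 + Cexp (w / 2) * C_derive (C_derive phi) w - q w / 2)%C with (Cexp (w / 2) * C_derive (C_derive phi) w)%C by ring.
  unfold q. rewrite !Cmod_mult. specialize (HKd w Hw). assert (P := Cmod_ge_0 (Cexp (w / 2))). nra. }
assert (Aphi : forall w, halfplane c w -> A (phi w) = Cexp w).
{ intros w Hw. destruct (Hphi w Hw) as [A1 A2]. rewrite <- HLexp by auto. now rewrite A2. }
(* The shift starts the path at time 0 in the range where [liouville_bound] holds. *)
set (Gamma := fun t => phi (v (t0 + 1 + t))).
assert (Hv' : forall t, 0 <= t -> halfplane c (v (t0 + 1 + t))) by (intros t Ht; apply Hv; lra).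
assert (Hre : forall X, exists T, 0 <= T /\ forall t, T < t -> X < Re (v (t0 + 1 + t))).
{ intros X. exists (exp (X - c)). split; [apply Rlt_le, exp_pos|]. intros t Ht. assert (P := exp_pos (X - c)).
  destruct (Hv (t0 + 1 + t) ltac:(lra)) as (_ & _ & _ & _ & V).
  assert (X - c < ln (t0 + 1 + t)); [|lra]. rewrite <- (ln_exp (X - c)). apply ln_increasing; lra. }
exists M, Om, Gamma. split; [exact HM|]. split; [exact Hnb|]. split; [split|split].
- apply continuous_on_forall. intros t Ht.
  apply (continuous_comp (fun t => v (t0 + 1 + t)) phi).
  + apply (continuous_comp (fun t => t0 + 1 + t) v).
    * apply (continuous_plus (V := R_NormedModule)); [apply continuous_const|apply continuous_id].
    * destruct (Hv (t0 + 1 + t) ltac:(lra)) as (_ & V & _). exact (Rder_continuous _ _ _ V).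
  + eapply Cder_continuous, Dphi. auto.
(* [A] is bounded on every square while [|A| = exp (Re v)] is unbounded along the path, so the path
   leaves every square for good. *)
- apply is_lim_spec. intros B. 
  destruct (rect_bounded A (- Rabs B) (Rabs B) (- Rabs B) (Rabs B)) as [S HS]; try (assert (P := Rabs_pos B); lra).
  { intros x y _ _. apply cA. }
  destruct (Hre (ln (1 + Rabs S))) as [T [HT0 HT]]. exists T. intros t Ht. specialize (HT t Ht).
  assert (P := Rabs_pos S).
  apply Rnot_le_lt. intros Hle.
  assert (HAS : Cmod (A (Gamma t)) <= S).
  { assert (Q1 := re_le_Cmod (Gamma t)). assert (Q2 := im_le_Cmod (Gamma t)). assert (Q3 := Rle_abs B).
    destruct (Gamma t) as [a b]. simpl in Q1, Q2.
    assert (Q1' : Rabs a <= Rabs B) by lra. assert (Q2' : Rabs b <= Rabs B) by lra.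
    apply Rabs_le_between in Q1'. apply Rabs_le_between in Q2'. apply HS; lra. }
  unfold Gamma in HAS. rewrite Aphi, Cmod_Cexp in HAS by (apply Hv'; lra).
  apply exp_increasing in HT. rewrite exp_ln in HT by lra. assert (Q := Rle_abs S). lra.
- intros t Ht. apply Hphi. auto.
- intros y Hy.
  destruct (liouville_bound A phi q c t0 v y) as [B [HB0 HB]]; auto.
  { intros w Hw. split; [auto|]. unfold q. eapply Cder_eq; [apply (hol_Cder (halfplane c)); auto|]. field. apply Cexp_neq_0. }
  { intros t Ht. destruct (Hv t Ht) as (V1 & V2 & V3 & V4 & _). auto. }
  intros P HP. apply locally_C_Cmod in HP. destruct HP as [eps [Heps HP]].
  destruct (Hre (4 * ln (B / eps))) as [T [HT0 HT]]. exists T. intros t Ht. specialize (HT t Ht).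
  apply HP. replace (y (Gamma t) - 0)%C with (y (Gamma t)) by ring.
  eapply Rle_lt_trans; [apply HB; lra|].
  assert (HBe : 0 < B / eps) by (apply Rdiv_lt_0_compat; lra).
  assert (E1 : exp (- Re (v (t0 + 1 + t)) / 4) < / (B / eps)).
  { rewrite <- (exp_ln (B / eps)) by auto. rewrite <- exp_Ropp. apply exp_increasing. lra. }
  apply (Rmult_lt_compat_l B) in E1; auto. replace (B * / (B / eps)) with eps in E1 by (field; lra). exact E1.
Qed.
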